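(* Let $K\subset\mathbb R^n$ be a convex body, let $E,H$ be linear subspaces of $\mathbb R^n$ with $\dim E=i$, $\dim H=j$, where $i,j\in\{2,\dots,n-1\}$, $i+j\ge n+1$, and $E^\perp\subset H$. Put $k=i+j-n$, so that $1\le k\le n-2$. Then $$\mathrm{vol}_k(P_{E\cap H}K)\,\mathrm{vol}_n(K)\le\frac{\binom ik\binom jk}{\binom nk}\,\mathrm{vol}_i(P_EK)\,\mathrm{vol}_j(P_HK).$$ Equality holds if and only if there exist compact convex sets $K_1\subseteq H^\perp$, $K_2\subseteq E^\perp$ and a point $x_0\in P_{E\cap H}K$ such that for every $v\in E\cap H$ the set $K\cap(x_0+(E\cap H)^\perp+\mathbb R^+v)$ is the convex hull of $x_0+(K_1+K_2)$ and a single point.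
   Context: A convex body is a compact convex set with nonempty interior. $P_F$ denotes orthogonal projection onto the linear subspace $F$; $F^\perp$ is the orthogonal complement; $\mathrm{vol}_m$ is $m$-dimensional Lebesgue measure; $A+B$ is the Minkowski sum; $\mathbb R^+v=\{sv:s\ge0\}$. *)

(* Defs.v *)
From HB Require Import structures.
From mathcomp Require Import all_boot all_order all_algebra.
From mathcomp Require Import sesquilinear.
From mathcomp Require Import all_classical all_reals all_analysis.

Set Implicit Arguments.
Unset Strict Implicit.
Unset Printing Implicit Defensive.

Import Order.TTheory GRing.Theory Num.Theory.
Import numFieldNormedType.Exports.

Local Open Scope classical_set_scope.
Local Open Scope ring_scope.

Section DotProduct.
Variables (R : realType) (n : nat).
Implicit Types (u v : 'rV[R]_n) (F : {vspace 'rV[R]_n}).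

Definition dotmul u v : R := \sum_(i < n) u 0 i * v 0 i.

Lemma dotmulC u v : dotmul u v = dotmul v u.
Proof. by apply: eq_bigr => i _; rewrite mulrC. Qed.

Lemma dotmul_bilinear :
  bilinear_for (GRing.Scale.Law.clone _ _ *%R _)
    (GRing.Scale.Law.clone _ _ (idfun \; *%R) _) dotmul.
Proof.
split=> [w|w] a u v /=; last rewrite !(dotmulC w);
  rewrite /dotmul mulr_sumr -big_split /=;
  by apply: eq_bigr => i _; rewrite !mxE mulrDl mulrA.
Qed.

HB.instance Definition _ := bilinear_isBilinear.Build R
  'rV[R]_n 'rV[R]_n R _ _ dotmul dotmul_bilinear.

Lemma dotmul_hermitian u v : dotmul u v = (-1) ^+ false * idfun (dotmul v u).
Proof. by rewrite mul1r dotmulC. Qed.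

HB.instance Definition _ :=
  @isHermitianSesquilinear.Build R 'rV[R]_n false idfun dotmul dotmul_hermitian.

Lemma dotmul_gt0 u : u != 0 -> 0 < dotmul u u.
Proof.
move=> u0; rewrite lt_neqAle sumr_ge0 ?andbT; last first.
  by move=> i _; rewrite -expr2 sqr_ge0.
apply: contra u0 => /eqP/esym/eqP; rewrite psumr_eq0; last first.
  by move=> i _; rewrite -expr2 sqr_ge0.
move=> /allP u0; apply/eqP/rowP => i; rewrite mxE; apply/eqP.
by have := u0 i (mem_index_enum i); rewrite -expr2 sqrf_eq0.
Qed.

HB.instance Definition _ := isDotProduct.Build R 'rV[R]_n dotmul dotmul_gt0.

Definition orthc F : {vspace 'rV[R]_n} := orthov dotmul F.

Definition orthproj F : 'rV[R]_n -> 'rV[R]_n := daddv_pi F (orthc F).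

Definition is_onb F (s : (\dim F).-tuple 'rV[R]_n) : Prop :=
  orthonormal dotmul s /\ basis_of F s.

Definition onb F : (\dim F).-tuple 'rV[R]_n :=
  xget [tuple 0 | _ < \dim F] [set s | @is_onb F s].

Lemma orthc_disjoint F : (F :&: orthc F = 0)%VS.
Proof.
apply/eqP; rewrite -subv0; apply/subvP => x /memv_capP[xF /mem_orthovP/(_ _ xF)].
by move=> xx; rewrite memv0; apply: contraTT isT => /dotmul_gt0; rewrite xx ltxx.
Qed.

Lemma onb_exists F : exists s, @is_onb F s.
Proof.
suff [s [ss os sF]] : exists s : seq 'rV[R]_n,
    [/\ size s = \dim F, orthonormal dotmul s & span s = F].
  have ss' : size s == \dim F by apply/eqP.
  exists (Tuple ss'); split => //.
  by rewrite basisEdim /= sF subvv ss leqnn.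
have [d] := ubnP (\dim F); elim: d F => // d IH F; rewrite ltnS => dF.
have [/eqP|F0] := eqVneq (\dim F) 0%N.
  by rewrite dimv_eq0 => /eqP ->; exists [::]; rewrite dimv0 span_nil.
have v0 : vpick F != 0 by rewrite vpick0 -dimv_eq0.
have v2 := dotmul_gt0 v0; set v := vpick F in v0 v2.
pose u := (Num.sqrt (dotmul v v))^-1 *: v.
have uu : dotmul u u = 1.
  rewrite /u linearZl_LR linearZr_LR /= mulrA -expr2 exprVn sqr_sqrtr ?ltW//.
  by rewrite mulVf// gt_eqF.
have uF : u \in F by rewrite memvZ ?memv_pick.
have u0 : u != 0.
  by apply: contra_eq_neq uu => ->; rewrite linear0l eq_sym oner_neq0.
have un : u \notin orthov dotmul F.
  apply/negP => /mem_orthovP/(_ _ uF)/=; rewrite uu => /eqP.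
  by rewrite oner_eq0.
have dF' := eq_dim_orthov1 un; set F' := (F :&: _)%VS in dF'.
have [|s [ss os sF']] := IH F'; first by rewrite -dF' prednK ?lt0n.
exists (u :: s); split.
- by rewrite /= ss -dF' prednK ?lt0n.
- move: os; rewrite /orthonormal /= uu eqxx /= => /andP[-> ->].
  rewrite !andbT; apply/allP => w /memv_span; rewrite sF' => /memv_capP[_].
  by move=> /mem_orthovP/(_ _ (memv_line u)) /=; rewrite dotmulC => ->.
- rewrite span_cons sF'; apply/eqP; rewrite eqEdim subv_add -memvE uF capvSl /=.
  rewrite dimv_disjoint_sum ?dim_vline ?u0 -?dF' ?add1n ?prednK ?lt0n//.
  apply/eqP; rewrite -subv0 -(orthc_disjoint <[u]>); apply: capvS => //.
  exact: capvSr.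
Qed.

Lemma onbP F : is_onb (onb F).
Proof. by have [s] := onb_exists F; exact: xgetI. Qed.

Lemma addv_orthc F : (F + orthc F)%VS = fullv.
Proof.
have [/andP[/allP /= s1 s2] sF] := onbP F.
have s01 (t : seq 'rV[R]_n) : pair_ortho_rec dotmul t ->
    {in t, forall b, dotmul b b = 1} -> {in t, forall b x,
    dotmul (x - \sum_(c <- t) dotmul x c *: c) b = 0}.
  elim: t => // c t IH /= /andP[/= /andP[/allP ct _] tt] t1 b.
  rewrite inE => /predU1P[->|bt] x; rewrite big_cons opprD.
    rewrite addrA !linearDl /= !linearNl linearZl_LR /=.
    rewrite t1 ?mem_head// mulr1 subrr add0r.
    rewrite linear_sumlz /= big_seq big1 ?oppr0// => a at_.
    by rewrite linearZl_LR /= (dotmulC a) (eqP (ct _ at_)) mulr0.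
  rewrite addrCA linearDl /= linearNl linearZl_LR /= (eqP (ct _ bt)) mulr0 oppr0.
  by rewrite add0r IH// => a at_; rewrite t1// inE at_ orbT.
apply/eqP; rewrite eqEsubv subvf /=; apply/subvP => x _.
have -> : x = \sum_(c <- onb F) dotmul x c *: c +
  (x - \sum_(c <- onb F) dotmul x c *: c) by rewrite addrC subrK.
apply: memv_add.
  by rewrite big_seq memv_suml // => c cF; rewrite memvZ// (basis_mem sF).
have H b : b \in onb F -> dotmul (x - \sum_(c <- onb F) dotmul x c *: c) b = 0.
  by move=> bF; apply: s01 => // c /s1 /eqP.
apply/mem_orthovP => y /(coord_basis sF) ->.
rewrite linear_sumr /= big1 // => i _; rewrite linearZr_LR /= H ?mulr0//.
by rewrite mem_nth// size_tuple.
Qed.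

Lemma orthprojP F x : orthproj F x \in F /\ x - orthproj F x \in orthc F.
Proof.
split; first exact: memv_pi.
have := @daddv_pi_add _ _ F (orthc F) x (orthc_disjoint F).
rewrite addv_orthc memvf => /(_ isT) xE.
by rewrite -{1}xE addrC addKr memv_pi.
Qed.

Lemma dimv_cap_orthc E H : (orthc E <= H)%VS ->
  \dim (E :&: H) = (\dim E + \dim H - n)%N.
Proof.
move=> EH; rewrite -dimv_sum_cap (_ : (E + H)%VS = fullv); last first.
  by apply/eqP; rewrite eqEsubv subvf -(addv_orthc E) addvS.
by rewrite dimvf /dim /= mul1n addKn.
Qed.

End DotProduct.

Section LebesgueMeasure.
Variable R : realType.
Local Notation mR := (measurableTypeR R).

Definition cons_pair n (p : mR * n.-tuple mR) : n.+1.-tuple mR :=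
  [tuple of p.1 :: p.2].

Lemma measurable_cons_pair n : measurable_fun setT (@cons_pair n).
Proof. exact: measurable_cons. Qed.

Section Step.
Variables (n : nat) (mu : {sigma_finite_measure set n.-tuple mR -> \bar R}).

Definition lebesgue_cons : set (n.+1.-tuple mR) -> \bar R :=
  pushforward (lebesgue_measure \x mu)%E (@cons_pair n).

Let lebesgue_cons0 : lebesgue_cons set0 = 0%E.
Proof. by rewrite /lebesgue_cons /pushforward preimage_set0 measure0. Qed.

Let lebesgue_cons_ge0 A : (0 <= lebesgue_cons A)%E.
Proof. by rewrite /lebesgue_cons /pushforward measure_ge0. Qed.

Let lebesgue_cons_sigma_additive : semi_sigma_additive lebesgue_cons.
Proof.
move=> F mF tF mUF; rewrite /lebesgue_cons /pushforward preimage_bigcup.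
have mF' i : measurable (@cons_pair n @^-1` F i).
  by rewrite -[X in measurable X]setTI; exact: measurable_cons_pair.
apply: measure_semi_sigma_additive => //; last exact: bigcupT_measurable.
apply/trivIsetP => /= i j _ _ ij; rewrite -preimage_setI.
by move/trivIsetP : tF => /(_ _ _ _ _ ij) ->//; rewrite preimage_set0.
Qed.

HB.instance Definition _ := isMeasure.Build _ _ _ lebesgue_cons
  lebesgue_cons0 lebesgue_cons_ge0 lebesgue_cons_sigma_additive.

Lemma lebesgue_cons_sigma_finite : sigma_finite setT lebesgue_cons.
Proof.
pose uncons (t : n.+1.-tuple mR) := (thead t, [tuple of behead t]).
have muncons : measurable_fun setT uncons.
  apply: measurable_fun_pair; last exact: measurable_behead.
  exact: measurable_tnth.
have consK : cancel (@cons_pair n) uncons.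
  by move=> [x t]; congr (_, _); apply/val_inj.
have [G GT Gfin] : sigma_finite setT (lebesgue_measure \x mu)%E.
  have /sigma_finiteP[F [TF ndF Ffin]] := sigma_finiteT (@lebesgue_measure R).
  have /sigma_finiteP[G [TG ndG Gfin]] := sigma_finiteT mu.
  exists (fun k => F k `*` G k).
    rewrite -setXTT TF TG predeqE => -[x y]; split.
      move=> [/= [k _ Fkx] [l _ Gly]]; exists (maxn k l) => //; split.
      - by move: x Fkx; exact/subsetPset/ndF/leq_maxl.
      - by move: y Gly; exact/subsetPset/ndG/leq_maxr.
    by move=> [k _ []/= ? ?]; split; exists k.
  move=> k; have [? ?] := Ffin k; have [? ?] := Gfin k.
  split; first exact: measurableX.
  by rewrite product_measure1E// lte_mul_pinfty// ge0_fin_numE.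
exists (fun k => uncons @^-1` G k).
  by rewrite -preimage_bigcup -GT preimage_setT.
move=> k; have [mG finG] := Gfin k; split.
  by rewrite -[X in measurable X]setTI; exact: muncons.
rewrite /lebesgue_cons /pushforward -comp_preimage.
by rewrite (_ : uncons \o _ = id)//; apply/funext => p; exact: consK.
Qed.

HB.instance Definition _ :=
  Measure_isSigmaFinite.Build _ _ _ lebesgue_cons lebesgue_cons_sigma_finite.

End Step.

Fixpoint lebesgue_tuple n : {sigma_finite_measure set n.-tuple mR -> \bar R} :=
  match n with
  | 0 => \d_[tuple]
  | n'.+1 => lebesgue_cons (lebesgue_tuple n')
  end.

Lemma lebesgue_tuple_box n (A : 'I_n -> set mR) :
  (forall i, measurable (A i)) ->
  lebesgue_tuple n [set t | forall i, A i (tnth t i)] =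
  (\prod_(i < n) lebesgue_measure (A i))%E.
Proof.
elim: n A => [|n IH] A mA.
  by rewrite big_ord0 /= diracE mem_set// => -[].
rewrite big_ord_recl -IH; last by move=> i; exact: mA.
rewrite -product_measure1E//=; last first.
  rewrite (_ : [set t | _] =
      \bigcap_(i in [set: 'I_n]) ((@tnth _ mR ^~ i) @^-1` A (lift ord0 i))).
    apply: fin_bigcap_measurable => // i _; rewrite -[X in measurable X]setTI.
    exact: measurable_tnth.
  by rewrite predeqE => t; split=> [tA i _|tA i]; [exact: tA|exact: tA i Logic.I].
rewrite /lebesgue_cons /pushforward; congr (_ _).
apply/seteqP; split=> [[x t] /= xt|[x t] /= [Ax tA] i].
  split; first exact: (xt ord0).
  by move=> i; have := xt (lift ord0 i); rewrite tnthS.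
have [i' ->|->] := unliftP ord0 i; last exact: Ax.
by rewrite tnthS; exact: tA.
Qed.

Definition lebesgue_rV n (A : set 'rV[R]_n) : \bar R :=
  lebesgue_tuple n [set t | A (\row_i tnth t i)].

(* Since [onb F] is orthonormal, [x |-> \sum_i x 0 i *: (onb F)`_i] is a linear
   isometry of the coordinate space onto F; Lebesgue measure being invariant
   under linear isometries, the value does not depend on the basis chosen. *)
Definition vol n (F : {vspace 'rV[R]_n}) (A : set 'rV[R]_n) : \bar R :=
  lebesgue_rV
    [set x : 'rV[R]_(\dim F) | A (\sum_(i < \dim F) x 0 i *: (onb F)`_i)].

End LebesgueMeasure.

Section Convex.
Variables (R : realType) (n : nat).
Implicit Types (A B K : set 'rV[R]_n) (v : 'rV[R]_n).

Definition convex_body K : Prop :=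
  [/\ compact K, convex_set K & interior K !=set0].

Definition conv_hull A : set 'rV[R]_n := smallest (@convex_set R 'rV[R]_n) A.

Definition minkowski_sum A B : set 'rV[R]_n := [set x + y | x in A & y in B].

Definition ray v : set 'rV[R]_n := [set s *: v | s in [set s : R | 0 <= s]].

End Convex.

(* Main.v *)
(** Split [R^n] orthogonally as [G + P + Q], with [G = E :&: H], [P] the
    complement of [H] and [Q] that of [E].  For [x] in [G] let [f], [h] and [w]
    be the volumes of the fibres over [x] of the shadows of [K] on [E] and [H]
    and of [K] itself; they live over the common shadow [L] of [K] on [G].
    Then [w <= f h], and the weighted AM-GM inequality bounds [f h] by a convex
    combination of [f^((p+q)/p)] and [h^((p+q)/q)] (after normalisation).  By
    Brunn-Minkowski [f^(1/p)] and [h^(1/q)] are concave, so Berwald's inequality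
    bounds the integrals of these powers by those of the cone function over
    [L] with the same lower moment; this is the theorem.

    Berwald's inequality is obtained by comparing the level sets
    [{f^(1/p) >= t}] with those of a cone, of measure [|L| (1 - t)^k]: the two
    profiles cross only once.  In the equality case all level sets have the
    cone profile, [f], [h] and [w] peak at a common apex [x0], the fibre of [K]
    over [x0] is a product, and along each ray issued from [x0] the fibres
    shrink homothetically to a point.  Conversely such a [K] has all three
    volumes explicit. *)
Require Import Defs.
From HB Require Import structures.
From mathcomp Require Import all_boot all_order all_algebra.
From mathcomp Require Import sesquilinear.
From mathcomp Require Import all_classical all_reals all_analysis.
From mathcomp Require Import measurable_realfun.
From mathcomp Require Import zify ring lra.

Set Implicit Arguments.
Unset Strict Implicit.
Unset Printing Implicit Defensive.

Import Order.TTheory GRing.Theory Num.Theory.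
Import numFieldNormedType.Exports.

Local Open Scope classical_set_scope.
Local Open Scope ring_scope.

(** * Lebesgue measure on row vectors *)

Definition row_display (R : realType) : measure_display :=
  measure_tuple_display (R.-ocitv.-measurable.-sigma)%mdisp.

Section MeasurableRow.
Variables (R : realType) (n : nat).
Local Notation mR := (measurableTypeR R).

Definition row_of_tuple (t : n.-tuple mR) : 'rV[R]_n := \row_i tnth t i.

Definition tuple_of_row (x : 'rV[R]_n) : n.-tuple mR := [tuple x 0 i | i < n].

Lemma tuple_of_rowK : cancel tuple_of_row row_of_tuple.
Proof. by move=> x; apply/rowP => i; rewrite mxE tnth_mktuple. Qed.

Lemma row_of_tupleK : cancel row_of_tuple tuple_of_row.
Proof. by move=> t; apply: eq_from_tnth => i; rewrite tnth_mktuple mxE. Qed.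

Definition measurable_row : set (set 'rV[R]_n) :=
  [set A | measurable (row_of_tuple @^-1` A)].

Lemma measurable_row0 : measurable_row set0.
Proof. by rewrite /measurable_row /= preimage_set0. Qed.

Lemma measurable_rowC A : measurable_row A -> measurable_row (~` A).
Proof. by rewrite /measurable_row /= preimage_setC; exact: measurableC. Qed.

Lemma measurable_row_bigcup (F : (set 'rV[R]_n)^nat) :
  (forall i, measurable_row (F i)) -> measurable_row (\bigcup_i F i).
Proof.
by move=> mF; rewrite /measurable_row /= preimage_bigcup; exact: bigcupT_measurable.
Qed.

HB.instance Definition _ := isMeasurable.Build
  (row_display R) 'rV[R]_n
  measurable_row0 measurable_rowC measurable_row_bigcup.

End MeasurableRow.

Definition pushforward_measure d1 d2 (T1 : measurableType d1) (T2 : measurableType d2)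
    (R : realFieldType) (m : {measure set T1 -> \bar R}) (f : T1 -> T2)
    (mf : measurable_fun setT f) : {measure set T2 -> \bar R}.
Proof. by refine (pushforward m f). Defined.

Section LebRow.
Variable R : realType.
Local Notation mR := (measurableTypeR R).

Lemma measurable_row_of_tuple n : measurable_fun setT (@row_of_tuple R n).
Proof. by move=> _ A mA; rewrite setTI. Qed.

Lemma measurable_tuple_of_row n : measurable_fun setT (@tuple_of_row R n).
Proof.
move=> _ A mA; rewrite setTI /measurable /= /measurable_row /=.
rewrite -comp_preimage (_ : _ \o _ = id) //.
by apply/funext => t /=; rewrite row_of_tupleK.
Qed.

Lemma measurable_entry n (i : 'I_n) : measurable_fun setT (fun x : 'rV[R]_n => x 0 i : mR).
Proof.
rewrite (_ : (fun x => _) = (fun t => tnth t i) \o @tuple_of_row R n).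
  by apply: measurableT_comp (measurable_tnth _) (@measurable_tuple_of_row n).
by apply/funext => x /=; rewrite tnth_mktuple.
Qed.

Lemma measurable_fun_rowP d (T : measurableType d) n (f : T -> 'rV[R]_n) :
  (forall i, measurable_fun setT (fun x => f x 0 i : mR)) -> measurable_fun setT f.
Proof.
move=> mf; rewrite (_ : f = @row_of_tuple R n \o (@tuple_of_row R n \o f)).
  apply: measurableT_comp (@measurable_row_of_tuple n) _.
  apply/measurable_fun_tnthP => i /=.
  by rewrite (_ : _ \o _ = (fun x => f x 0 i))//; apply/funext => x /=; rewrite tnth_mktuple.
by apply/funext => x /=; rewrite tuple_of_rowK.
Qed.

Lemma measurable_row_add d (T : measurableType d) n (f g : T -> 'rV[R]_n) :
  measurable_fun setT f -> measurable_fun setT g ->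
  measurable_fun setT (fun x => f x + g x).
Proof.
move=> mf mg; apply: measurable_fun_rowP => i; under eq_fun do rewrite mxE.
by apply: measurable_funD; apply: (measurableT_comp (measurable_entry i)).
Qed.

Lemma measurable_row_opp d (T : measurableType d) n (f : T -> 'rV[R]_n) :
  measurable_fun setT f -> measurable_fun setT (fun x => - f x).
Proof.
move=> mf; apply: measurable_fun_rowP => i; under eq_fun do rewrite mxE.
apply: measurableT_comp; [exact: oppr_measurable|].
by apply: (measurableT_comp (measurable_entry i)).
Qed.

Lemma measurable_row_mulmx m n (M : 'M[R]_(m, n)) :
  measurable_fun setT (fun z : 'rV[R]_m => z *m M).
Proof.
apply: measurable_fun_rowP => i; under eq_fun do rewrite mxE.
apply: measurable_sum => j; apply: measurable_funM => //.
exact: measurable_entry.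
Qed.

Lemma measurable_row_mx d (T : measurableType d) m n (f : T -> 'rV[R]_m) (g : T -> 'rV[R]_n) :
  measurable_fun setT f -> measurable_fun setT g ->
  measurable_fun setT (fun z => row_mx (f z) (g z)).
Proof.
move=> mf mg; apply: measurable_fun_rowP => i; under eq_fun do rewrite mxE.
by case: (fintype.split i) => j; exact: (measurableT_comp (measurable_entry j)).
Qed.

Definition leb n : set 'rV[R]_n -> \bar R :=
  pushforward (lebesgue_tuple R n) (@row_of_tuple R n).

HB.instance Definition _ n := Measure.copy (@leb n)
  (pushforward_measure (lebesgue_tuple R n) (@measurable_row_of_tuple n)).

Lemma lebE n (A : set 'rV[R]_n) : leb A = lebesgue_rV A.
Proof. by []. Qed.

Lemma leb0 (A : set 'rV[R]_0) : leb A = (\1_A 0)%:E.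
Proof.
rewrite /leb /pushforward /= diracE indicE; congr ((nat_of_bool _)%:R%:E).
by apply/idP/idP; rewrite !inE /= (_ : row_of_tuple _ = 0)//; apply/rowP => -[].
Qed.

Lemma leb_box n (A : 'I_n -> set R) : (forall i, measurable (A i : set mR)) ->
  leb [set x : 'rV[R]_n | forall i, A i (x 0 i)] = (\prod_(i < n) lebesgue_measure (A i : set mR))%E.
Proof.
move=> mA; rewrite -lebesgue_tuple_box//; congr (lebesgue_tuple _ _ _).
by apply/seteqP; split => t /= At i; have := At i; rewrite mxE.
Qed.

Lemma leb_sigma_finite n : sigma_finite setT (@leb n).
Proof.
have [F FT Ffin] := sigma_finiteT (lebesgue_tuple R n).
exists (fun k => @tuple_of_row R n @^-1` F k).
  by rewrite -preimage_bigcup -FT preimage_setT.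
move=> k; have [mF finF] := Ffin k; split.
  by rewrite -[X in measurable X]setTI; exact: measurable_tuple_of_row.
rewrite /leb /pushforward -comp_preimage.
by rewrite (_ : _ \o _ = id)//; apply/funext => t /=; rewrite row_of_tupleK.
Qed.

HB.instance Definition _ n := Measure_isSigmaFinite.Build _ _ _ (@leb n) (@leb_sigma_finite n).

End LebRow.
Arguments leb {R n}.

Section Translation.
Variable R : realType.
Local Notation mR := (measurableTypeR R).
Local Open Scope ereal_scope.

Lemma lebesgue_measure_translate (c : R) (A : set mR) : measurable A ->
  lebesgue_measure [set x | A (x + c)%R] = lebesgue_measure A.
Proof.
move=> mA.
have mc : measurable_fun setT (fun x : mR => (x + c)%R : mR) by exact: measurable_funD.
pose mu : {measure set mR -> \bar R} := pushforward_measure lebesgue_measure mc.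
rewrite [RHS](@lebesgue_measure_unique R mu)// => X [[a b] /= ab <-].
rewrite /mu /= /pushforward (_ : _ @^-1` _ = `](a - c)%R, (b - c)%R]%classic).
  rewrite !lebesgue_measure_itv /= !lte_fin ltrD2r -!EFinB.
  by case: ifP => // _; congr (_%:E); rewrite opprB addrA subrK.
by apply/seteqP; split => x /=; rewrite !in_itv /= ltrBlDr lerBrDr.
Qed.

Definition tuple_add n (t c : n.-tuple mR) : n.-tuple mR :=
  [tuple (tnth t i + tnth c i)%R | i < n].

Lemma lebesgue_tuple_translate n (c : n.-tuple mR) (A : set (n.-tuple mR)) :
  measurable A -> lebesgue_tuple R n [set t | A (tuple_add t c)] = lebesgue_tuple R n A.
Proof.
elim: n c A => [c A mA|n IH c A mA].
  rewrite /= !diracE; congr (_%:R%:E); congr nat_of_bool.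
  by apply/idP/idP; rewrite !inE /= (_ : tuple_add _ _ = [tuple]) //; apply: eq_from_tnth => -[].
rewrite /= /lebesgue_cons /pushforward /=.
have mcA : measurable (@cons_pair R n @^-1` A).
  by rewrite -[X in measurable X]setTI; exact: measurable_cons_pair.
set B := _ @^-1` A in mcA.
rewrite /product_measure1.
pose c' : n.-tuple mR := [tuple of behead c].
have mF : measurable_fun setT (fun x : mR => lebesgue_tuple R n (xsection B x)).
  exact: measurable_fun_xsection.
transitivity (\int[lebesgue_measure]_x (lebesgue_tuple R n (xsection B ((x : mR) + thead c)%R))).
  apply: eq_integral => x _ /=.
  rewrite -[RHS](IH c'); last exact: measurable_xsection.
  congr (lebesgue_tuple R n _); apply/seteqP; split => t; rewrite /xsection /= !inE /B /=;
    rewrite (_ : tuple_add _ _ = cons_pair (x + thead c, tuple_add t c')%R)//; apply: eq_from_tnth => i;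
    rewrite tnth_mktuple; have [j ->|->] := unliftP ord0 i => //;
    by rewrite !tnthS tnth_mktuple /=; congr (_ + _)%R; rewrite {1}(tuple_eta c) tnthS.
have mc : measurable_fun setT (fun x : mR => (x + thead c)%R : mR) by exact: measurable_funD.
pose mu : {measure set mR -> \bar R} := pushforward_measure lebesgue_measure mc.
transitivity (\int[mu]_x lebesgue_tuple R n (xsection B x)).
  by rewrite /mu ge0_integral_pushforward.
by apply: eq_measure_integral => X mX _; exact: lebesgue_measure_translate.
Qed.

Lemma leb_translate n (c : 'rV[R]_n) (A : set 'rV[R]_n) :
  measurable A -> leb [set x | A (x + c)%R] = leb A.
Proof.
move=> mA; rewrite /leb /pushforward.
rewrite -[RHS](lebesgue_tuple_translate (tuple_of_row c))//.
congr (lebesgue_tuple _ _ _); apply/seteqP; split => t /=;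
 rewrite (_ : row_of_tuple (tuple_add _ _) = row_of_tuple t + c)%R//; by apply/rowP => i; rewrite !mxE !tnth_mktuple.
Qed.

Lemma tonelli_set d1 d2 (T1 : measurableType d1) (T2 : measurableType d2)
    (m1 : {sigma_finite_measure set T1 -> \bar R})
    (m2 : {sigma_finite_measure set T2 -> \bar R}) (C : set (T1 * T2)) :
  measurable C ->
  \int[m1]_x m2 [set y | C (x, y)] = \int[m2]_y m1 [set x | C (x, y)].
Proof.
move=> mC; have := indic_fubini_tonelli m1 m2 mC.
rewrite indic_fubini_tonelli_FE// indic_fubini_tonelli_GE//.
move=> H; transitivity (\int[m1]_x (m2 \o xsection C) x).
  by apply: eq_integral => x _ /=; rewrite xsectionE.
by rewrite H; apply: eq_integral => x _ /=; rewrite ysectionE.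
Qed.

Lemma integral_indic_mulr d (T : measurableType d) (m : {measure set T -> \bar R})
    (A : set T) (x : \bar R) : measurable A -> 0 <= x ->
  \int[m]_t ((\1_A t)%:E * x) = m A * x.
Proof.
move=> mA x0; rewrite ge0_integralZr//; last exact/measurable_EFinP/measurable_indic.
by rewrite integral_indic// setIT.
Qed.

Lemma measurable_preim d1 d2 (T1 : measurableType d1) (T2 : measurableType d2)
  (f : T1 -> T2) (A : set T2) : measurable_fun setT f -> measurable A ->
  measurable (f @^-1` A).
Proof. by move=> mf mA; rewrite -[X in measurable X]setTI; exact: mf. Qed.

(* Computing the double integral of 1_A(x) 1_B(x + y) in both orders. *)
Lemma translation_invariant_swap n (mu nu : {sigma_finite_measure set 'rV[R]_n -> \bar R})
    (A B : set 'rV[R]_n) :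
  (forall (c : 'rV[R]_n) (X : set 'rV[R]_n), measurable X -> mu [set x | X (x + c)%R] = mu X) ->
  (forall (c : 'rV[R]_n) (X : set 'rV[R]_n), measurable X -> nu [set x | X (x + c)%R] = nu X) ->
  measurable A -> measurable B ->
  mu A * nu B = mu B * nu (-%R @^-1` A).
Proof.
move=> tmu tnu mA mB.
have msub : measurable_fun setT (fun z : 'rV[R]_n * 'rV[R]_n => z.1 - z.2)%R.
  by apply: measurable_row_add => //; exact: measurable_row_opp.
have madd : measurable_fun setT (fun z : 'rV[R]_n * 'rV[R]_n => z.1 + z.2)%R.
  exact: measurable_row_add.
have mA' : measurable (-%R @^-1` A : set 'rV[R]_n).
  by apply: measurable_preim mA; exact: measurable_row_opp.
pose C : set ('rV[R]_n * 'rV[R]_n) := [set z | A z.1 /\ B (z.1 + z.2)%R].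
have mC : measurable C by apply: measurableI; apply: measurable_preim.
pose D : set ('rV[R]_n * 'rV[R]_n) := [set z | A (z.1 - z.2)%R /\ B z.1].
have mD : measurable D.
  by apply: measurableI; [exact: (measurable_preim msub)|exact: measurable_preim].
transitivity (\int[mu]_x nu [set y | C (x, y)]).
  rewrite -integral_indic_mulr//; apply: eq_integral => x _.
  rewrite indicE; have [Ax|nAx] := pselect (A x).
    rewrite mem_set// mul1e -(tnu x B mB); congr (nu _).
    by apply/seteqP; split => y /=; rewrite /C /= addrC => // -[].
  by rewrite memNset// mul0e (_ : [set _ | _] = set0)// -subset0 => y -[].
rewrite tonelli_set//.
transitivity (\int[nu]_y mu [set x | D (x, y)]).
  apply: eq_integral => y _; rewrite -[LHS](tmu (- y)%R).
    by congr (mu _); apply/seteqP; split => x /=; rewrite /C /D /= subrK.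
  apply: (measurable_preim (f := fun x => (x, y)) (A := C)) => //.
rewrite -tonelli_set// -integral_indic_mulr//; apply: eq_integral => x _.
rewrite indicE; have [Bx|nBx] := pselect (B x).
  rewrite mem_set// mul1e -(tnu (- x)%R _ mA'); congr (nu _).
  by apply/seteqP; split => y /=; rewrite /D /= opprB// => -[].
by rewrite memNset// mul0e (_ : [set _ | _] = set0)// -subset0 => y -[].
Qed.

Definition unit_cube n : set 'rV[R]_n := [set x | forall i, (0 <= x 0%R i <= 1)%R].

Lemma leb_cube n (a b : 'rV[R]_n) : (forall i, a 0%R i <= b 0%R i)%R ->
  leb [set x : 'rV[R]_n | forall i, (a 0%R i <= x 0%R i <= b 0%R i)%R] =
  (\prod_(i < n) (b 0%R i - a 0%R i))%R%:E.
Proof.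
move=> ab.
rewrite (_ : [set x | _] = [set x : 'rV[R]_n | forall i, `[a 0%R i, b 0%R i]%classic (x 0%R i)]); last first.
  by apply/seteqP; split => x /= H i; have := H i; rewrite in_itv.
rewrite (leb_box (A := fun i => `[a 0%R i, b 0%R i]%classic))//.
rewrite -prodEFin; apply: eq_bigr => i _.
rewrite lebesgue_measure_itv /= lte_fin -EFinB; case: ifP => //.
by rewrite lt_neqAle ab andbT => /negbFE/eqP ->; rewrite subrr.
Qed.

Lemma measurable_box n (a b : 'rV[R]_n) :
  measurable [set x : 'rV[R]_n | forall i, (a 0%R i <= x 0%R i <= b 0%R i)%R].
Proof.
rewrite (_ : [set x | _] = \bigcap_(i in [set: 'I_n]) ((fun x : 'rV[R]_n => x 0%R i : mR) @^-1` `[a 0%R i, b 0%R i]%classic)).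
  apply: fin_bigcap_measurable => // i _.
  by apply: measurable_preim => //; exact: measurable_entry.
apply/seteqP; split => x /= H i; first by move=> _; rewrite /preimage /= in_itv; exact: H.
by have := H i Logic.I; rewrite /= in_itv.
Qed.

Lemma measurable_unit_cube n : measurable (@unit_cube n).
Proof.
have := measurable_box (0%R : 'rV[R]_n) (\row__ 1%R).
rewrite (_ : [set x | _] = @unit_cube n)//.
by apply/seteqP; split => x /= H i; move: (H i); rewrite !mxE.
Qed.

Lemma leb_unit_cube n : leb (@unit_cube n) = 1.
Proof.
rewrite (_ : @unit_cube n = [set x : 'rV[R]_n | forall i, ((0 : 'rV[R]_n) 0 i <= x 0 i <= (\row__ 1 : 'rV[R]_n) 0 i)%R]).
  rewrite leb_cube; last by move=> i; rewrite !mxE.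
  by rewrite big1// => i _; rewrite !mxE subr0.
by apply/seteqP; split => x /= H i; move: (H i); rewrite !mxE.
Qed.

Lemma leb_opp n (A : set 'rV[R]_n) : measurable A -> leb (-%R @^-1` A : set 'rV[R]_n) = leb A.
Proof.
move=> mA; have := translation_invariant_swap (@leb_translate n) (@leb_translate n) mA (@measurable_unit_cube n).
by rewrite /= leb_unit_cube mule1 mul1e.
Qed.

Lemma leb_unique n (mu : {sigma_finite_measure set 'rV[R]_n -> \bar R}) (A B : set 'rV[R]_n) :
  (forall (c : 'rV[R]_n) (X : set 'rV[R]_n), measurable X -> mu [set x | X (x + c)%R] = mu X) ->
  measurable A -> measurable B -> mu A * leb B = mu B * leb A.
Proof.
by move=> tmu mA mB; rewrite (translation_invariant_swap tmu (@leb_translate n))//= leb_opp.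
Qed.

End Translation.

(** * Topology and linear maps *)

Section RowTopology.
Variable R : realType.
Local Notation mR := (measurableTypeR R).

Lemma ler_row_norm n (x : 'rV[R]_n) i : `|x 0 i| <= `|x|.
Proof.
rewrite [leRHS]/Num.norm /= mx_normrE; apply/bigmax_geP; right => /=.
by exists (0, i).
Qed.

Lemma row_norm_le n (x : 'rV[R]_n) (e : R) : 0 <= e -> (forall i, `|x 0 i| <= e) -> `|x| <= e.
Proof.
move=> e0 xe; rewrite [leLHS]/Num.norm /= mx_normrE; apply/bigmax_leP; split => //.
by move=> [a b] _ /=; rewrite (ord1 a).
Qed.

Lemma row_norm_lt n (x : 'rV[R]_n) (e : R) : 0 < e -> (forall i, `|x 0 i| < e) -> `|x| < e.
Proof.
move=> e0 xe; rewrite [ltLHS]/Num.norm /= mx_normrE; apply/bigmax_ltP; split => //.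
by move=> [a b] _ /=; rewrite (ord1 a).
Qed.

Lemma open_measurable_row n (U : set 'rV[R]_n) : open U -> measurable U.
Proof.
move=> oU.
pose c (q : 'rV[rat]_n) : 'rV[R]_n := map_mx ratr q.
pose B (z : 'rV[rat]_n * nat) := [set x : 'rV[R]_n |
  forall i, (c z.1 - const_mx z.2.+1%:R^-1) 0 i <= x 0 i <= (c z.1 + const_mx z.2.+1%:R^-1) 0 i].
pose F z := if `[< B z `<=` U >] then B z else set0.
rewrite (_ : U = \bigcup_z F z).
  apply: countable_bigcupT_measurable => [|z]; first exact: countableP.
  by rewrite /F; case: asboolP => // _; exact: measurable_box.
apply/seteqP; split => [x Ux|x [z _]]; last first.
  by rewrite /F; case: asboolP => // BU /BU.
have /nbhs_ballP[e /= e0 xeU] : nbhs x U by exact: open_nbhs_nbhs.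
have [N N0 Ne] : exists2 N : nat, True & 2 * N.+1%:R^-1 < e.
  exists (Num.truncn (2 / e)) => //.
  have e2 : 0 < 2 / e by rewrite divr_gt0.
  rewrite ltr_pdivrMr ?ltr0n// mulrC -ltr_pdivrMr//.
  by rewrite truncnS_gt.
have N0' : (0 : R) < N.+1%:R^-1 by rewrite invr_gt0 ltr0n.
have /choice[q' qE'] : forall i, exists q : rat, x 0 i - N.+1%:R^-1 < ratr q < x 0 i + N.+1%:R^-1.
  move=> i; have : x 0 i - N.+1%:R^-1 < x 0 i + N.+1%:R^-1.
    by rewrite ltrD2l; exact: lt_trans N0'; rewrite oppr_lt0.
  by move=> /rat_in_itvoo[q]; rewrite in_itv /= => H; exists q.
pose q : 'rV[rat]_n := \row_i q' i.
have qE i : x 0 i - N.+1%:R^-1 < ratr (q 0 i) < x 0 i + N.+1%:R^-1.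
  by rewrite mxE; exact: qE'.
exists (q, N) => //; rewrite /F asboolT.
  move=> i; have := qE i; rewrite /= !mxE /=.
  by move: (ratr _) (_^-1) => r d /andP[q1 q2]; apply/andP; split; lra.
move=> y By; apply: xeU; rewrite -ball_normE /=; apply: row_norm_lt => // i.
have := qE i; have := By i; rewrite /= !mxE => yN xN.
apply: lt_trans Ne; rewrite ltr_norml mulrDl mul1r.
move: (ratr _) (_^-1) yN xN => r d /andP[y1 y2] /andP[q1 q2].
by apply/andP; split; lra.
Qed.

Lemma closed_measurable_row n (A : set 'rV[R]_n) : closed A -> measurable A.
Proof.
by move=> cA; rewrite -(setCK A); apply: measurableC; apply: open_measurable_row; exact: closed_openC.
Qed.

Lemma compact_closed_row n (A : set 'rV[R]_n) : compact A -> closed A.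
Proof. by apply: compact_closed; exact: norm_hausdorff. Qed.

Lemma compact_measurable_row n (A : set 'rV[R]_n) : compact A -> measurable A.
Proof. by move=> /compact_closed_row; exact: closed_measurable_row. Qed.

Lemma compact_ball n (A : set 'rV[R]_n) : compact A ->
  exists2 M : R, 0 < M & forall x, A x -> `|x| <= M.
Proof.
move=> /compact_bounded [M [_ MA]]; exists (Num.max 0 M + 1).
  by rewrite ltr_wpDl// le_max lexx.
by move=> x Ax; apply: MA => //; rewrite ltr_pwDr// le_max lexx orbT.
Qed.

Lemma row_continuousP (T : topologicalType) n (f : T -> 'rV[R]_n) :
  (forall i, continuous (fun x => f x 0 i)) -> continuous f.
Proof.
move=> cf x; apply/cvgrPdist_lt => e e0.
have : \forall y \near x, forall i, `|f x 0 i - f y 0 i| < e.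
  apply: filter_forall => i.
  by have /cvgrPdist_lt/(_ _ e0) := cf i x.
apply: filterS => y fy; apply: row_norm_lt => // i; by rewrite !mxE.
Qed.

Lemma continuous_entry n (i : 'I_n) : continuous (fun x : 'rV[R]_n => x 0 i).
Proof. exact: coord_continuous. Qed.

Lemma linear_row_continuous m n (f : {linear 'rV[R]_m -> 'rV[R]_n}) : continuous f.
Proof.
apply: row_continuousP => i.
rewrite (_ : (fun x => _) = fun x : 'rV_m => \sum_j x 0 j * lin1_mx f j i).
  apply: continuous_big => [|j _ x]; first exact: add_continuous.
  by apply: continuousM; [exact: continuous_entry|exact: cst_continuous].
by apply/funext => x; rewrite -mul_rV_lin1 mxE.
Qed.

Lemma mulmxr_row_continuous m n (M : 'M[R]_(m, n)) : continuous (fun x : 'rV[R]_m => x *m M).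
Proof.
apply: row_continuousP => i.
rewrite (_ : (fun x => _) = fun x : 'rV_m => \sum_j x 0 j * M j i).
  apply: continuous_big => [|j _ x]; first exact: add_continuous.
  by apply: continuousM; [exact: continuous_entry|exact: cst_continuous].
by apply/funext => x; rewrite mxE.
Qed.

Lemma row_mx_continuous m n : continuous (fun z : 'rV[R]_m * 'rV[R]_n => row_mx z.1 z.2).
Proof.
apply: row_continuousP => i.
under eq_fun do rewrite mxE.
case: (fintype.split i) => j z.
  apply: (@cvg_comp _ _ _ fst (fun x : 'rV[R]_m => x 0 j)); first exact: cvg_fst.
  exact: continuous_entry.
apply: (@cvg_comp _ _ _ snd (fun x : 'rV[R]_n => x 0 j)); first exact: cvg_snd.
exact: continuous_entry.
Qed.

End RowTopology.

Section LebesgueLinear.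
Variable R : realType.
Local Open Scope ereal_scope.

Definition cube n (k : R) : set 'rV[R]_n :=
  [set x | forall i, ((const_mx (- k) : 'rV[R]_n) 0 i <= x 0 i <= (const_mx k : 'rV[R]_n) 0 i)%R].

Lemma measurable_cube n (k : R) : measurable (@cube n k).
Proof. exact: measurable_box. Qed.

Lemma cube_norm n (k : R) (x : 'rV[R]_n) : (`|x| <= k)%R -> @cube n k x.
Proof.
move=> xk i; rewrite !mxE -ler_norml; apply: le_trans xk; exact: ler_row_norm.
Qed.

Lemma leb_cube_fin n (k : R) : (0 <= k)%R -> leb (@cube n k) < +oo.
Proof.
by move=> k0; rewrite leb_cube ?ltry// => i; rewrite !mxE ge0_cp.
Qed.

Lemma leb_compact_fin n (A : set 'rV[R]_n) : compact A -> leb A < +oo.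
Proof.
move=> cA; have [M M0 AM] := compact_ball cA.
apply: le_lt_trans (@leb_cube_fin n M (ltW M0)).
apply: le_measure; rewrite ?inE; [exact: compact_measurable_row|exact: measurable_cube|].
by move=> x Ax; apply: cube_norm; exact: AM.
Qed.

Lemma pushforward_sigma_finite d1 d2 (T1 : measurableType d1) (T2 : measurableType d2)
    (m : {sigma_finite_measure set T1 -> \bar R}) (f : T1 -> T2) (g : T2 -> T1)
    (mf : measurable_fun setT f) :
  measurable_fun setT g -> cancel f g -> 
  sigma_finite setT (pushforward_measure m mf).
Proof.
move=> mg fK; have [F FT Ffin] := sigma_finiteT m.
exists (fun k => g @^-1` F k).
  by rewrite -preimage_bigcup -FT preimage_setT.
move=> k; have [mF finF] := Ffin k; split; first exact: measurable_preim.
rewrite /= /pushforward -comp_preimage.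
by rewrite (_ : _ \o _ = id)//; apply/funext => t /=; rewrite fK.
Qed.

Definition as_sigma_finite d (T : measurableType d) (mu : {measure set T -> \bar R})
  of sigma_finite setT mu : set T -> \bar R := mu.

HB.instance Definition _ d (T : measurableType d) (mu : {measure set T -> \bar R})
  (smu : sigma_finite setT mu) := Measure.copy (as_sigma_finite smu) mu.

HB.instance Definition _ d (T : measurableType d) (mu : {measure set T -> \bar R})
  (smu : sigma_finite setT mu) :=
  Measure_isSigmaFinite.Build _ _ _ (as_sigma_finite smu) smu.

Lemma leb_unique_measure n (mu : {measure set 'rV[R]_n -> \bar R}) (A B : set 'rV[R]_n) :
  sigma_finite setT mu ->
  (forall (c : 'rV[R]_n) (X : set 'rV[R]_n), measurable X -> mu [set x | X (x + c)%R] = mu X) ->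
  measurable A -> measurable B -> mu A * leb B = mu B * leb A.
Proof.
by move=> smu tmu mA mB; exact: (@leb_unique R n (as_sigma_finite smu)).
Qed.

Lemma leb_mulmx n (M N : 'M[R]_n) (A B : set 'rV[R]_n) :
  (M *m N = 1%:M)%R -> measurable A -> measurable B ->
  leb [set x | A (x *m M)%R] * leb B = leb [set x | B (x *m M)%R] * leb A.
Proof.
move=> MN mA mB.
have mM := @measurable_row_mulmx R _ _ M.
apply: (leb_unique_measure (mu := pushforward_measure leb mM)) => //.
  apply: (@pushforward_sigma_finite _ _ _ _ _ _ (fun x => x *m N)%R).
    exact: measurable_row_mulmx.
  by move=> x; rewrite -mulmxA MN mulmx1.
move=> c X mX; rewrite /= /pushforward /=.
rewrite -[RHS](leb_translate (c *m N)%R); last exact: measurable_preim.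
congr (leb _); apply/seteqP; split => x /=; by rewrite mulmxDl -mulmxA (mulmx1C MN) mulmx1.
Qed.

Lemma leb_scale n (c : R) (A : set 'rV[R]_n) : (0 < c)%R -> measurable A ->
  leb [set x | A (c^-1 *: x)%R] = (c ^+ n)%:E * leb A.
Proof.
move=> c0 mA.
have cn0 : c != 0%R by rewrite gt_eqF.
have MN : ((c^-1)%:M *m c%:M = 1%:M :> 'M[R]_n)%R.
  by rewrite -scalar_mxM mulVf.
have := leb_mulmx MN mA (@measurable_unit_cube R n).
rewrite leb_unit_cube mule1.
under eq_set do rewrite mul_mx_scalar.
move=> ->; congr (_ * _).
rewrite (_ : [set x | _] = [set x : 'rV[R]_n | forall i, ((0 : 'rV[R]_n) 0 i <= x 0 i <= (const_mx c : 'rV[R]_n) 0 i)%R]).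
  rewrite leb_cube; last by move=> i; rewrite !mxE ltW.
  under eq_bigr do rewrite !mxE subr0.
  by rewrite prodr_const card_ord.
apply/seteqP; split => x /= H i; move: (H i); rewrite mul_mx_scalar !mxE mulrC.
  by rewrite pmulr_lge0 ?invr_gt0// ler_pdivrMr// mul1r.
by rewrite pmulr_lge0 ?invr_gt0// ler_pdivrMr// mul1r.
Qed.

Lemma mulmx_sqr n (x : 'rV[R]_n) : ((x *m x^T) 0 0 = \sum_i (x 0 i) ^+ 2)%R.
Proof. by rewrite mxE; apply: eq_bigr => i _; rewrite mxE expr2. Qed.

Lemma leb_orthogonal n (M : 'M[R]_n) (A : set 'rV[R]_n) :
  (M *m M^T = 1%:M)%R -> measurable A -> leb [set x | A (x *m M)%R] = leb A.
Proof.
move=> MM mA.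
pose B : set 'rV[R]_n := [set x | (x *m x^T) 0 0 <= 1]%R.
have xB (x : 'rV[R]_n) : B x -> forall i, (`|x 0 i| <= 1)%R.
  rewrite /B /= mulmx_sqr => x1 i; rewrite -(ler_pXn2r (n := 2))// ?nnegrE//.
  rewrite expr1n real_normK ?num_real//; apply: le_trans x1.
  by rewrite (bigD1 i)//= lerDl sumr_ge0// => j _; exact: sqr_ge0.
have cB : compact B.
  apply: bounded_closed_compact.
    exists 1%R; split => // y y1 x /xB x1; apply: le_trans (ltW y1).
    exact: row_norm_le.
  rewrite (_ : B = (fun x : 'rV[R]_n => \sum_i (x 0 i) ^+ 2)%R @^-1` [set y | y <= 1]%R); last first.
    by apply/seteqP; split => x /=; rewrite /B /= mulmx_sqr.
  apply: closed_comp; last exact: closed_le.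
  move=> x _; apply: continuous_big => [|i _ y]; first exact: add_continuous.
  apply: (@continuous_comp _ _ _ (fun x : 'rV[R]_n => x 0 i)%R (fun z : R => z ^+ 2)%R);
    [exact: continuous_entry|exact: exprn_continuous].
have mB := compact_measurable_row cB.
have := leb_mulmx MM mA mB.
rewrite (_ : [set x | B (x *m M)%R] = B); last first.
  by apply/seteqP; split => x; rewrite /B /= trmx_mul mulmxA -(mulmxA x) MM mulmx1.
have Bfin : leb B \is a fin_num by rewrite ge0_fin_numE// leb_compact_fin.
have B0 : leb B != 0.
  pose d : R := (n.+1%:R^-1)%R.
  have d0 : (0 < d)%R by rewrite invr_gt0.
  rewrite gt_eqF//; apply: (@lt_le_trans _ _ (leb [set x : 'rV[R]_n | forall i, ((0 : 'rV[R]_n) 0 i <= x 0 i <= (const_mx d : 'rV[R]_n) 0 i)%R])).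
    rewrite leb_cube; last by move=> i; rewrite !mxE ltW.
    by rewrite lte_fin; apply: prodr_gt0 => i _; rewrite !mxE subr0.
  apply: le_measure; rewrite ?inE//; first exact: measurable_box.
  move=> x /= xd; rewrite /B /= mulmx_sqr.
  apply: (@le_trans _ _ (\sum_(i < n) d)%R).
    apply: ler_sum => i _; have := xd i; rewrite !mxE => /andP[x0 x1].
    rewrite expr2 -[leRHS]mul1r ler_pM// (le_trans x1)//.
    by rewrite invf_le1 ?ler1n.
  rewrite sumr_const card_ord -mulr_natr mulrC ler_pdivrMr// mul1r ler_nat.
  exact: leqnSn.
have B1 : 0 < leb B by rewrite lt0e B0 measure_ge0.
rewrite [RHS]muleC => H; apply/eqP; rewrite eq_le.
by rewrite -(lee_pmul2r Bfin B1) H lexx /= -(lee_pmul2r Bfin B1) H lexx.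
Qed.

Lemma leb_isometry m n (M : 'M[R]_(m, n)) (A : set 'rV[R]_n) : m = n ->
  (M *m M^T = 1%:M)%R -> measurable A -> leb [set x | A (x *m M)%R] = leb A.
Proof. by move=> mn; case: n / mn M A => M A; exact: leb_orthogonal. Qed.

Lemma ge0_integral_translate n (c : 'rV[R]_n) (f : 'rV[R]_n -> \bar R) :
  measurable_fun setT f -> (forall x, 0 <= f x) ->
  \int[leb]_x f (x + c)%R = \int[leb]_x f x.
Proof.
move=> mf f0; have mc : measurable_fun setT (fun x : 'rV[R]_n => x + c)%R.
  exact: measurable_row_add.
transitivity (\int[pushforward_measure leb mc]_x f x).
  by rewrite [RHS]ge0_integral_pushforward// => y _; exact: f0.
by apply: eq_measure_integral => X mX _; exact: leb_translate.
Qed.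

Lemma measurable_row_section m n (A : set 'rV[R]_(m + n)) (x : 'rV[R]_m) :
  measurable A -> measurable [set y : 'rV[R]_n | A (row_mx x y)].
Proof.
move=> mA; apply: (measurable_preim (f := fun y => row_mx x y)) => //.
exact: measurable_row_mx.
Qed.

Lemma measurable_leb_section m n (A : set 'rV[R]_(m + n)) :
  measurable A -> measurable_fun setT (fun x : 'rV[R]_m => leb [set y : 'rV[R]_n | A (row_mx x y)]).
Proof.
move=> mA.
have mA' : measurable [set z : 'rV[R]_m * 'rV[R]_n | A (row_mx z.1 z.2)].
  by apply: measurable_preim mA; exact: measurable_row_mx.
have := measurable_fun_xsection (leb : {sigma_finite_measure set 'rV[R]_n -> \bar R}) mA'.
congr (measurable_fun _ _); apply/funext => x /=; congr (leb _).
by rewrite xsectionE.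
Qed.

Lemma cube_sigma_finite n (mu : {measure set 'rV[R]_n -> \bar R}) :
  (forall k : nat, mu (@cube n k%:R) < +oo) -> sigma_finite setT mu.
Proof.
move=> fin; exists (fun k => @cube n k%:R); last first.
  by move=> k; split => //; exact: measurable_cube.
apply/seteqP; split => // x _; exists (Num.truncn `|x|).+1 => //.
by apply: cube_norm; apply/ltW; exact: truncnS_gt.
Qed.

Lemma leb_row_mx m n (A : set 'rV[R]_(m + n)) : measurable A ->
  leb A = \int[leb]_x leb [set y : 'rV[R]_n | A (row_mx (x : 'rV[R]_m) y)].
Proof.
move=> mA.
have mr : measurable_fun setT (fun z : 'rV[R]_m * 'rV[R]_n => row_mx z.1 z.2).
  exact: measurable_row_mx.
have msub : measurable_fun setT (fun z : 'rV[R]_(m + n) => (lsubmx z, rsubmx z)).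
  apply/measurable_fun_pair; apply: measurable_fun_rowP => i; under eq_fun do rewrite mxE; exact: measurable_entry.
pose mu := pushforward_measure (leb \x leb : {measure set ('rV[R]_m * 'rV[R]_n) -> \bar R}) mr.
have muE X : measurable X -> mu X = \int[leb]_x leb [set y : 'rV[R]_n | X (row_mx (x : 'rV[R]_m) y)].
  move=> mX; rewrite /mu /= /pushforward /product_measure1.
  by apply: eq_integral => x _ /=; congr (leb _); rewrite xsectionE.
rewrite -muE//.
have := @leb_unique_measure _ mu A (@unit_cube R _).
rewrite leb_unit_cube mule1 => ->//; last exact: measurable_unit_cube.
- rewrite muE; last exact: measurable_unit_cube.
  rewrite (_ : integral _ _ _ = 1) ?mul1e//.
  rewrite -[RHS](@leb_unit_cube R m) -[RHS]mule1 -integral_indic_mulr//; last exact: measurable_unit_cube.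
  apply: eq_integral => x _; rewrite indicE.
  have [cx|ncx] := pselect (unit_cube x).
    rewrite mem_set// mul1e -[RHS](@leb_unit_cube R n); congr (leb _).
    apply/seteqP; split => y /= H i.
      by have := H (rshift m i); rewrite row_mxEr.
    by rewrite mxE; case: (fintype.split i) => j; [exact: cx|exact: H].
  rewrite memNset// mul0e (_ : [set _ | _] = set0)// -subset0 => y /= H.
  by apply: ncx => i; have := H (lshift n i); rewrite row_mxEl.
- apply: cube_sigma_finite => k; have mk := @measurable_cube (m + n) k%:R.
  rewrite muE//.
  apply: (@le_lt_trans _ _ (leb (@cube m k%:R) * leb (@cube n k%:R))).
    rewrite -integral_indic_mulr//; last exact: measurable_cube.
    apply: ge0_le_integral => //.
    + exact: measurable_leb_section.
    + apply: emeasurable_funM; last exact: measurable_cst.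
      by apply/measurable_EFinP; apply: measurable_indic; exact: measurable_cube.
    move=> x _; rewrite indicE; have [cx|ncx] := pselect (@cube m k%:R x).
      rewrite mem_set// mul1e; apply: le_measure; rewrite ?inE.
      * exact: measurable_row_section (@measurable_cube _ _).
      * exact: measurable_cube.
      * by move=> y H i; have := H (rshift m i); rewrite row_mxEr !mxE.
    rewrite memNset// mul0e (_ : [set _ | _] = set0) ?measure0// -subset0 => y H.
    by apply: ncx => i; have := H (lshift n i); rewrite row_mxEl !mxE.
  by apply: lte_mul_pinfty => //; rewrite ?ge0_fin_numE// ?leb_cube_fin.
- move=> c X mX.
  have mX' : measurable [set x | X (x + c)%R].
    have mc : measurable_fun setT (fun x : 'rV[R]_(m + n) => x + c)%R by exact: measurable_row_add.
    exact: measurable_preim mc mX.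
  rewrite !muE//; rewrite -[RHS](ge0_integral_translate (lsubmx c)) //; last exact: measurable_leb_section.
  apply: eq_integral => x _.
  rewrite -[RHS](leb_translate (rsubmx c)); last exact: measurable_row_section.
  by congr (leb _); apply/seteqP; split => y /=; rewrite -add_row_mx hsubmxK.
Qed.

End LebesgueLinear.

Section LayerCake.
Variable R : realType.
Local Notation mR := (measurableTypeR R).
Local Open Scope ereal_scope.

Lemma integral_monomial (m : nat) (a : R) : (0 <= a)%R ->
  \int[lebesgue_measure]_(t in `]0%R, a]) (m.+1%:R * t ^+ m)%:E = (a ^+ m.+1)%:E.
Proof.
rewrite le_eqVlt => /orP[/eqP <-|a0].
  by rewrite set_itvoc0 integral_set0 expr0n.
rewrite integral_itv_obnd_cbnd; last first.
  by apply/measurable_EFinP; apply: measurable_funM => //; exact: exprn_measurable.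
rewrite (@continuous_FTC2 _ _ (fun x => x ^+ m.+1)%R)//=.
- by rewrite expr0n sube0.
- apply/continuous_subspaceT => x.
  by apply: cvgM; [exact: cvg_cst|exact: exprn_continuous].
- split.
    by move=> x x01; exact: exprn_derivable.
    exact/cvg_at_right_filter/exprn_continuous.
    exact/cvg_at_left_filter/exprn_continuous.
- by move=> x x01; rewrite derive1E exp_derive scaler1.
Qed.

Lemma layer_cake d (T : measurableType d) (mu : {sigma_finite_measure set T -> \bar R})
    (f : T -> R) (b : R) m : measurable_fun setT f -> (forall x, 0 <= f x <= b)%R ->
  \int[mu]_x (f x ^+ m.+1)%:E =
  \int[lebesgue_measure]_(t in `]0%R, b]) ((m.+1%:R * t ^+ m)%:E * mu [set x | t <= f x]%R).
Proof.
move=> mf fb.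
pose C : set (T * mR) := [set z | (0 < z.2)%R /\ (z.2 <= f z.1)%R].
have mC1 : measurable [set z : T * mR | (0 < z.2)%R].
  rewrite (_ : [set _ | _] = snd @^-1` `]0%R, +oo[%classic); first exact: measurable_preim.
  by apply/seteqP; split => z /=; rewrite in_itv /= andbT.
have mC2 : measurable [set z : T * mR | (z.2 <= f z.1)%R].
  have mle : measurable_fun setT (fun z : T * mR => z.2 <= f z.1)%R.
    by apply: measurable_fun_ler => //; exact: (measurableT_comp mf).
  rewrite (_ : [set _ | _] = (fun z : T * mR => z.2 <= f z.1)%R @^-1` [set true]) //.
  exact: measurable_preim.
have mC : measurable C by exact: measurableI.
pose g (z : T * mR) : \bar R := (m.+1%:R * z.2 ^+ m * \1_C z)%:E.
have g0 z : 0 <= g z.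
  rewrite /g lee_fin indicE; have [Cz|nCz] := pselect (C z).
    by rewrite mem_set// mulr1 mulr_ge0// exprn_ge0// ltW//; case: Cz.
  by rewrite memNset// mulr0.
have mg : measurable_fun setT g.
  apply/measurable_EFinP; apply: measurable_funM; last exact: measurable_indic.
  by apply: measurable_funM => //; apply: measurable_funX.
have fub := fubini_tonelli (m1 := mu) (m2 := @lebesgue_measure R) g mg g0.
transitivity (\int[mu]_x \int[lebesgue_measure]_t g (x, t)).
  apply: eq_integral => x _; have /andP[fx0 fxb] := fb x.
  rewrite -integral_monomial// integral_mkcond; apply: eq_integral => t _.
  rewrite patchE /g indicE; case: ifPn => tf.
    by move: tf; rewrite inE /= in_itv /= => /andP[t0 tf]; rewrite mem_set// mulr1.
  rewrite memNset ?mulr0// => -[/= t0 tf']; move/negP: tf; apply.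
  by rewrite inE /= in_itv /= t0.
rewrite fub [RHS]integral_mkcond; apply: eq_integral => t _.
rewrite patchE; case: ifPn => tf.
  move: tf; rewrite inE /= in_itv /= => /andP[t0 tb].
  transitivity (\int[mu]_x ((m.+1%:R * t ^+ m)%:E * (\1_[set x | t <= f x]%R x)%:E)).
    apply: eq_integral => x _; rewrite /g -EFinM !indicE; congr (_ * _%:R)%:E; congr nat_of_bool.
    by apply/idP/idP; rewrite !inE /C /= => // -[].
  have mt : measurable [set x | (t <= f x)%R].
    rewrite (_ : [set _ | _] = f @^-1` `[t, +oo[%classic).
      exact: measurable_preim.
    by apply/seteqP; split => z /=; rewrite in_itv /= andbT.
  rewrite ge0_integralZl//; last first.
    - by rewrite lee_fin mulr_ge0// exprn_ge0// ltW.
    - by apply/measurable_EFinP; exact: measurable_indic.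
  by rewrite integral_indic// setIT.
apply: integral0_eq => x _; rewrite /g indicE memNset ?mulr0// => -[/= t0 tfx].
move/negP: tf; apply; rewrite inE /= in_itv /= t0 (le_trans tfx)//.
by case/andP: (fb x).
Qed.

End LayerCake.

(** * Sections, shadows and the Brunn-Minkowski inequality *)

Section Sections.
Variable R : realType.

Definition sec m n (D : set 'rV[R]_(m + n)) (x : 'rV[R]_m) : set 'rV[R]_n :=
  [set y | D (row_mx x y)].

Definition lebr n (A : set 'rV[R]_n) : R := fine (leb A).

Lemma lebrE n (A : set 'rV[R]_n) : compact A -> (lebr A)%:E = leb A.
Proof. by move=> cA; rewrite fineK// ge0_fin_numE// leb_compact_fin. Qed.

Lemma lebr_ge0 n (A : set 'rV[R]_n) : 0 <= lebr A.
Proof. exact: fine_ge0. Qed.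

Lemma le_lebr n (A B : set 'rV[R]_n) : compact A -> compact B -> A `<=` B -> lebr A <= lebr B.
Proof.
move=> cA cB AB; rewrite -lee_fin !lebrE//; apply: le_measure; rewrite ?inE//;
  exact: compact_measurable_row.
Qed.

Lemma row_closedP n (S : set 'rV[R]_n) :
  (forall x, (forall e : R, 0 < e -> exists2 y, S y & `|x - y| < e) -> S x) -> closed S.
Proof.
move=> H x cx; apply: H => e e0.
have [y [Sy xy]] := cx _ (nbhsx_ballx x e e0).
by exists y => //; move: xy; rewrite -ball_normE.
Qed.

Lemma closed_row_seq n (S : set 'rV[R]_n) x : closed S ->
  (forall e : R, 0 < e -> exists2 y, S y & `|x - y| < e) -> S x.
Proof.
move=> cS H; apply: cS => B /nbhs_ballP[e /= e0 eB].
have [y Sy xy] := H _ e0; exists y; split => //; apply: eB.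
by rewrite -ball_normE.
Qed.

Lemma row_norm_r m n (x : 'rV[R]_m) (y : 'rV[R]_n) : `|y| <= `|row_mx x y|.
Proof.
apply: row_norm_le => // i; rewrite -(row_mxEr x y); exact: ler_row_norm.
Qed.

Lemma compact_rowP n (A : set 'rV[R]_n) M : closed A -> (forall x, A x -> `|x| <= M) -> compact A.
Proof.
move=> cA AM; apply: bounded_closed_compact cA; exists M; split; first exact: num_real.
by move=> N MN x Ax; apply: le_trans (AM _ Ax) (ltW MN).
Qed.

Lemma sec_ball m n (D : set 'rV[R]_(m + n)) M x : (forall z, D z -> `|z| <= M) ->
  forall y, sec D x y -> `|y| <= M.
Proof. by move=> DM y /DM; apply: le_trans; exact: row_norm_r. Qed.

Lemma compact_sec m n (D : set 'rV[R]_(m + n)) x : compact D -> compact (sec D x).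
Proof.
move=> cD; have [M M0 DM] := compact_ball cD.
apply: (@compact_rowP _ _ M); last exact: sec_ball.
apply: row_closedP => y H; apply: closed_row_seq (compact_closed_row cD) _ => e e0.
have [z Dz yz] := H _ e0; exists (row_mx x z) => //.
rewrite opp_row_mx add_row_mx subrr; apply: row_norm_lt => // i.
rewrite mxE; case: (fintype.split i) => j; first by rewrite mxE normr0.
by apply: le_lt_trans yz; exact: ler_row_norm.
Qed.

Lemma inv_lt (e : R) : 0 < e -> exists N : nat, N.+1%:R^-1 < e.
Proof.
move=> e0; exists (Num.truncn e^-1); rewrite invf_plt ?posrE//.
exact: truncnS_gt.
Qed.

(* Along a sequence of base points, the sections accumulate inside the
   section at the limit, whose measure bounds the limsup of theirs. *)
Lemma closed_leb_sec m n (D : set 'rV[R]_(m + n)) (c : \bar R) : compact D ->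
  closed [set x | (c <= leb (sec D x))%E].
Proof.
move=> cD; have [M M0 DM] := compact_ball cD.
apply: row_closedP => x H.
have /choice[u Hu] : forall k : nat, exists y, (c <= leb (sec D y))%E /\ `|x - y| < k.+1%:R^-1.
  by move=> k; have [|y] := H k.+1%:R^-1; [rewrite invr_gt0|move=> ? ?; exists y].
pose U N := \bigcup_(k in [set k | (N <= k)%N]) sec D (u k).
have mU N : measurable (U N).
  by apply: bigcup_measurable => k _; apply: compact_measurable_row; exact: compact_sec.
have mcap : measurable (\bigcap_N U N) by exact: bigcapT_measurable.
have niU : nonincreasing_seq U.
  move=> a b ab; apply/subsetPset => y [k /= bk Dk]; exists k => //=; exact: leq_trans bk.
have UM : U 0%N `<=` cube M.
  by move=> y [k _ /(sec_ball DM)] /cube_norm.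
have U0 : (leb (U 0%N) < +oo)%E.
  apply: le_lt_trans (leb_cube_fin n (ltW M0)).
  by apply: le_measure; rewrite ?inE//; exact: measurable_cube.
have := nonincreasing_cvg_mu U0 mU mcap niU => Ucvg.
apply: (@le_trans _ _ (leb (\bigcap_N U N))).
  apply: cvge_ge Ucvg; apply: nearW => k /=; apply: le_trans (Hu k).1 _.
  apply: le_measure; rewrite ?inE//; first by apply: compact_measurable_row; exact: compact_sec.
  by move=> y Dy; exists k => /=.
apply: le_measure; rewrite ?inE//; first by apply: compact_measurable_row; exact: compact_sec.
move=> y Uy; apply: closed_row_seq (compact_closed_row cD) _ => e e0.
have [N Ne] := inv_lt e0.
have [k /= Nk Dk] := Uy N Logic.I; exists (row_mx (u k) y) => //.
rewrite opp_row_mx add_row_mx subrr; apply: row_norm_lt => // i.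
rewrite mxE; case: (fintype.split i) => j; last by rewrite mxE normr0.
apply: le_lt_trans (ler_row_norm _ _) _; apply: lt_le_trans (Hu k).2 _.
by apply: le_trans (ltW Ne); rewrite lef_pV2 ?posrE// ler_nat.
Qed.

Definition fstproj m n (D : set 'rV[R]_(m + n)) : set 'rV[R]_m := [set x | exists y, D (row_mx x y)].

Lemma compact_fstproj m n (D : set 'rV[R]_(m + n)) : compact D -> compact (fstproj D).
Proof.
move=> cD; rewrite (_ : fstproj D = lsubmx @` D).
  apply: continuous_compact => //; apply: continuous_subspaceT.
  exact: (@linear_row_continuous _ _ _ (lsubmx : {linear 'rV[R]_(m + n) -> 'rV[R]_m})).
apply/seteqP; split => [x [y Dxy]|_ [z Dz <-]].
  by exists (row_mx x y) => //; rewrite row_mxKl.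
by exists (rsubmx z); rewrite hsubmxK.
Qed.

Lemma sec0 m n (D : set 'rV[R]_(m + n)) x : ~ fstproj D x -> sec D x = set0.
Proof. by move=> Dx; rewrite -subset0 => y Dxy; apply: Dx; exists y. Qed.

Lemma compact_leb_sec m n (D : set 'rV[R]_(m + n)) (c : R) : compact D -> 0 < c ->
  compact [set x | c <= lebr (sec D x)].
Proof.
move=> cD c0; apply: (subclosed_compact _ (compact_fstproj cD)).
  rewrite (_ : [set _ | _] = [set x | (c%:E <= leb (sec D x))%E]); first exact: closed_leb_sec.
  by apply/seteqP; split => x /=; rewrite -lebrE ?lee_fin//; exact: compact_sec.
move=> x /= cx; apply: contrapT => /sec0 Dx; move: cx; rewrite Dx /lebr measure0 /=.
by rewrite leNgt c0.
Qed.

Lemma lebr_sec_max m n (D : set 'rV[R]_(m + n)) : compact D -> D !=set0 ->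
  exists2 x0, fstproj D x0 & forall x, lebr (sec D x) <= lebr (sec D x0).
Proof.
move=> cD [z Dz]; have cP := compact_fstproj cD.
have [M M0 DM] := compact_ball cD.
pose V := [set lebr (sec D x) | x in fstproj D].
have V0 : V !=set0.
  exists (lebr (sec D (lsubmx z))); exists (lsubmx z) => //.
  by exists (rsubmx z); rewrite hsubmxK.
have Vub : has_ubound V.
  exists (fine (leb (@cube R n M))) => _ [x _ <-].
  rewrite -lee_fin lebrE; last exact: compact_sec.
  rewrite fineK; last by rewrite ge0_fin_numE// (leb_cube_fin n (ltW M0)).
  apply: le_measure; rewrite ?inE//; first by apply: compact_measurable_row; exact: compact_sec.
    exact: measurable_cube.
  by move=> y /(sec_ball DM)/cube_norm.
have leV x : fstproj D x -> lebr (sec D x) <= sup V.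
  by move=> Px; apply: ub_le_sup => //; exists x.
have /choice[u Hu] : forall k : nat, exists x, fstproj D x /\ sup V - k.+1%:R^-1 < lebr (sec D x).
  move=> k; have k0 : (0 : R) < k.+1%:R^-1 by rewrite invr_gt0.
  by have [_ [x Px <-] ?] := sup_adherent k0 (conj V0 Vub); exists x.
have Pu : (u @ \oo) (fstproj D) by exists 0%N => // k _; exact: (Hu k).1.
have [x [Px cx]] := cP (u @ \oo) (fmap_proper_filter _ _) Pu.
have ax : sup V <= lebr (sec D x).
  apply/ler_addgt0Pr => e e0; have [N Ne] := inv_lt e0.
  rewrite -lerBlDr.
  have SN : closed [set x | ((sup V - e)%:E <= leb (sec D x))%E] by exact: closed_leb_sec.
  have : [set x | ((sup V - e)%:E <= leb (sec D x))%E] x.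
    apply: SN => B Bx; apply: cx => //.
    exists N => // k /= Nk; rewrite -lebrE ?lee_fin; last exact: compact_sec.
    apply: ltW; apply: le_lt_trans (Hu k).2; rewrite lerD2l lerN2.
    by apply: le_trans (ltW Ne); rewrite lef_pV2 ?posrE// ler_nat.
  by rewrite /= -lebrE ?lee_fin//; exact: compact_sec.
exists x => // y; have [Py|/sec0 ->] := pselect (fstproj D y).
  by apply: le_trans (leV _ Py) ax.
by rewrite [leLHS]/lebr measure0; exact: lebr_ge0.
Qed.

Lemma measurable_lebr_sec m n (D : set 'rV[R]_(m + n)) : compact D ->
  measurable_fun setT (fun x => lebr (sec D x)).
Proof.
move=> cD; apply: measurableT_comp; first exact: fine_measurable.
by apply: measurable_leb_section; exact: compact_measurable_row.
Qed.

Lemma lebr_row_mx m n (D : set 'rV[R]_(m + n)) : compact D ->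
  (lebr D)%:E = (\int[leb]_x (lebr (sec D x))%:E)%E.
Proof.
move=> cD; rewrite lebrE// leb_row_mx; last exact: compact_measurable_row.
by apply: eq_integral => x _; rewrite lebrE//; exact: compact_sec.
Qed.

Definition convex n (A : set 'rV[R]_n) : Prop :=
  forall (s : R) x y, 0 <= s <= 1 -> A x -> A y -> A (s *: x + (1 - s) *: y).

Lemma convex_setE n (A : set 'rV[R]_n) : convex_set A <-> convex A.
Proof.
split=> [cA s x y s01 Ax Ay|cA x y l].
  have := cA x y (Itv01 (andP s01).1 (andP s01).2).
  by rewrite !inE; apply.
by rewrite !inE => Ax Ay; apply: (cA l%:num) => //; apply/andP; split; [exact: ge0|exact: le1].
Qed.

Definition mcomb n (s : R) (A B : set 'rV[R]_n) : set 'rV[R]_n :=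
  [set s *: x + (1 - s) *: y | x in A & y in B].

Lemma compact_mcomb n (s : R) (A B : set 'rV[R]_n) : compact A -> compact B -> compact (mcomb s A B).
Proof.
move=> cA cB.
rewrite (_ : mcomb s A B = (fun z : 'rV[R]_n * 'rV[R]_n => s *: z.1 + (1 - s) *: z.2) @` (A `*` B)).
  apply: continuous_compact; last exact: compact_setX.
  apply: continuous_subspaceT => z; apply: cvgD; apply: cvgZl_tmp; [exact: cvg_fst|exact: cvg_snd].
apply/seteqP; split => [_ [x Ax [y By <-]]|_ [[x y] [/= Ax By] <-]]; first by exists (x, y).
by exists x => //; exists y.
Qed.

Lemma lebr_affine n (s : R) (c : 'rV[R]_n) (A : set 'rV[R]_n) : 0 < s -> compact A ->
  lebr [set s *: x + c | x in A] = s ^+ n * lebr A.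
Proof.
move=> s0 cA; have mA := compact_measurable_row cA.
have sn0 : s != 0 by rewrite gt_eqF.
have mB : measurable [set x : 'rV[R]_n | A (s^-1 *: x)].
  apply: (measurable_preim (f := fun x : 'rV[R]_n => s^-1 *: x)) mA.
  apply: measurable_fun_rowP => i; under eq_fun do rewrite mxE.
  by apply: measurable_funM => //; exact: measurable_entry.
rewrite /lebr (_ : [set _ | _ in _] = [set x | [set x | A (s^-1 *: x)] (x + - c)]).
  rewrite leb_translate// leb_scale//.
  by rewrite fineM// ge0_fin_numE// leb_compact_fin.
apply/seteqP; split => [_ [x Ax <-] /=|x /= Ax].
  by rewrite addrK scalerA mulVf// scale1r.
by exists (s^-1 *: (x - c)) => //; rewrite scalerA mulfV// scale1r subrK.
Qed.

Lemma compact_affine n (s : R) (c : 'rV[R]_n) (A : set 'rV[R]_n) : compact A ->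
  compact [set s *: x + c | x in A].
Proof.
move=> cA; apply: continuous_compact => //.
by apply: continuous_subspaceT => z; apply: continuousD; [exact: scaler_continuous|exact: cst_continuous].
Qed.

Lemma leb_row1 (z : 'rV[R]_1) : leb [set z] = 0%E.
Proof.
rewrite (_ : [set z] = [set x : 'rV[R]_1 | forall i, z 0 i <= x 0 i <= z 0 i]).
  by rewrite leb_cube// big_ord1 subrr.
apply/seteqP; split => [_ -> i|x H /=]; first by rewrite lexx.
by apply/rowP => i; apply/eqP; rewrite eq_le andbC; exact: H.
Qed.

Lemma brunn_minkowski1 (s : R) (A B : set 'rV[R]_1) : 0 < s < 1 ->
  compact A -> compact B -> A !=set0 -> B !=set0 ->
  s * lebr A + (1 - s) * lebr B <= lebr (mcomb s A B).
Proof.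
move=> /andP[s0 s1] cA cB A0 B0; have s1' : 0 < 1 - s by rewrite subr_gt0.
have ce : continuous (fun x : 'rV[R]_1 => x 0 0) by exact: continuous_entry.
have [a /set_mem Aa maxa] := EVT_max_rV A0 cA (continuous_subspaceT ce).
have [b /set_mem Bb minb] := EVT_min_rV B0 cB (continuous_subspaceT ce).
pose U := [set s *: x + (1 - s) *: b | x in A].
pose V := [set (1 - s) *: y + s *: a | y in B].
have cU : compact U by exact: compact_affine.
have cV : compact V by exact: compact_affine.
rewrite (_ : s * _ = lebr U); last by rewrite lebr_affine ?expr1.
rewrite (_ : (1 - s) * _ = lebr V); last by rewrite lebr_affine ?expr1.
pose z := s *: a + (1 - s) *: b.
have cC := compact_mcomb (s := s) cA cB.
rewrite -lee_fin EFinD !lebrE//.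
have [mU mV] := (compact_measurable_row cU, compact_measurable_row cV).
have mz : measurable [set z] by apply: compact_measurable_row; exact: compact_set1.
have -> : leb V = leb (V `\` [set z]).
  rewrite measureD//=; last exact: leb_compact_fin.
  rewrite (_ : leb (V `&` _) = 0%E) ?sube0//.
  apply/eqP; rewrite eq_le measure_ge0 andbT -[leRHS](leb_row1 z).
  by apply: le_measure; rewrite ?inE//; exact: measurableI.
have mD : measurable (V `\` [set z]) by exact: measurableD.
rewrite -measureU//; last first.
  rewrite -subset0 => w [[x Ax <-] [[y By yz] wz]]; apply: wz => /=.
  apply/rowP => i; rewrite (ord1 i); apply/eqP; rewrite eq_le.
  have xa : x 0 0 <= a 0 0 by apply: maxa; rewrite inE.
  have yb : b 0 0 <= y 0 0 by apply: minb; rewrite inE.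
  apply/andP; split; first by rewrite !mxE lerD2r ler_pM2l.
  by rewrite -yz !mxE addrC lerD2r ler_pM2l.
apply: le_measure; rewrite ?inE//; [exact: measurableU|exact: compact_measurable_row|].
move=> w [[x Ax <-]|[[y By <-] _]]; first by exists x => //; exists b.
by exists a => //; exists y => //; rewrite addrC.
Qed.

Lemma amgm_powR (s x y : R) : 0 < s < 1 -> 0 <= x -> 0 <= y ->
  x `^ s * y `^ (1 - s) <= s * x + (1 - s) * y.
Proof.
move=> /andP[s0 s1] x0 y0; have s1' : 0 < 1 - s by rewrite subr_gt0.
have := @conjugate_powR R (x `^ s) (y `^ (1 - s)) s^-1 (1 - s)^-1.
rewrite !invrK -!powRrM !mulfV ?gt_eqF// !powRr1// (mulrC x) (mulrC y); apply; rewrite ?invr_gt0 ?powR_ge0//.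
by rewrite addrC subrK.
Qed.

End Sections.

Section BrunnMinkowski.
Variable R : realType.

Lemma sec_mcomb m n (s : R) (A B : set 'rV[R]_(m + n)) x y :
  mcomb s (sec A x) (sec B y) `<=` sec (mcomb s A B) (s *: x + (1 - s) *: y).
Proof.
move=> _ [a Aa [b Bb <-]]; exists (row_mx x a) => //; exists (row_mx y b) => //.
by rewrite !scale_row_mx add_row_mx.
Qed.

Lemma lebr_nonempty n (A : set 'rV[R]_n) : 0 < lebr A -> A !=set0.
Proof.
move=> A0; apply: contrapT => /nonemptyPn A0'.
by move: A0; rewrite A0' /lebr measure0 ltxx.
Qed.

Definition level m n (D : set 'rV[R]_(m + n)) (c : R) : set 'rV[R]_m :=
  [set x | c <= lebr (sec D x)].

Lemma level_le m n (D : set 'rV[R]_(m + n)) (c d : R) : c <= d -> level D d `<=` level D c.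
Proof. by move=> cd x; exact: le_trans. Qed.

Lemma level_fstproj m n (D : set 'rV[R]_(m + n)) (c : R) : 0 < c -> level D c `<=` fstproj D.
Proof.
move=> c0 x cx; have [y Dxy] : sec D x !=set0 by apply: lebr_nonempty; exact: lt_le_trans cx.
by exists y.
Qed.

Lemma measurable_level m n (D : set 'rV[R]_(m + n)) (g : R -> R) (J : set (measurableTypeR R)) :
  compact D -> (forall t, 0 < t -> 0 < g t) -> (forall t u, 0 < t -> t <= u -> g t <= g u) ->
  measurable J -> J `<=` `]0, +oo[%classic ->
  measurable_fun J (fun t => lebr (level D (g t))).
Proof.
move=> cD g0 gmono mJ J0.
pose f t := if 0 < t then lebr (level D (g t)) else lebr (fstproj D).
have cl t : 0 < t -> compact (level D (g t)).
  by move=> t0; apply: compact_leb_sec => //; exact: g0.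
apply: (eq_measurable_fun f).
  by move=> t; rewrite inE => /J0 /=; rewrite in_itv /= andbT /f => ->.
apply: nonincreasing_measurable => // x y xy; rewrite /f.
case: ifPn => [y0|y0]; last first.
  by rewrite ifN// -leNgt (le_trans xy)// leNgt.
case: ifPn => [x0|_].
  by apply: le_lebr; [exact: cl|exact: cl|apply: level_le; exact: gmono].
by apply: le_lebr; [exact: cl|exact: compact_fstproj|apply: level_fstproj; exact: g0].
Qed.

Lemma layer_cake_sec m n (D : set 'rV[R]_(m + n)) (a : R) : compact D -> 0 < a ->
  (forall x, lebr (sec D x) <= a) ->
  (\int[lebesgue_measure]_(t in `]0%R, 1%R]) (lebr (level D (a * t)%R))%:E)%E =
  (lebr D / a)%:E.
Proof.
move=> cD a0 Da.
have mf : measurable_fun setT (fun x => lebr (sec D x) / a).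
  by apply: measurable_funM => //; exact: measurable_lebr_sec.
have f01 x : 0 <= lebr (sec D x) / a <= 1.
  by rewrite divr_ge0 ?lebr_ge0 ?(ltW a0)//= ler_pdivrMr// mul1r.
have := layer_cake leb 0 mf f01.
under eq_integral do rewrite expr1 EFinM.
rewrite ge0_integralZr//; last first.
- by rewrite lee_fin invr_ge0 ltW.
- by move=> x _; rewrite lee_fin lebr_ge0.
- by apply/measurable_EFinP; exact: measurable_lebr_sec.
rewrite -lebr_row_mx// -EFinM => ->; apply: eq_integral => t.
rewrite inE /= in_itv /= => /andP[t0 t1].
rewrite expr0 mulr1 mul1e lebrE; last by apply: compact_leb_sec => //; rewrite mulr_gt0.
by congr (leb _); apply/seteqP; split => x; rewrite /level /= ler_pdivlMr// mulrC.
Qed.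

Lemma brunn_minkowski_mul n (s : R) (A B : set 'rV[R]_n) : 0 < s < 1 ->
  compact A -> compact B -> A !=set0 -> B !=set0 ->
  lebr A `^ s * lebr B `^ (1 - s) <= lebr (mcomb s A B).
Proof.
move=> s01; have /andP[s0 s1] := s01; have s1' : 0 < 1 - s by rewrite subr_gt0.
elim: n A B => [|n IH] A B cA cB A0 B0.
  have leb1 (C : set 'rV[R]_0) : C !=set0 -> lebr C = 1.
    by move=> [x Cx]; rewrite /lebr leb0 indicE mem_set// (_ : 0 = x)//; apply/rowP => -[].
  rewrite !leb1 ?powR1 ?mulr1//.
  by case: A0 B0 => [a Aa] [b Bb]; exists (s *: a + (1 - s) *: b), a => //; exists b.
suff step : forall A B : set 'rV[R]_(1 + n), compact A -> compact B -> A !=set0 -> B !=set0 ->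
    lebr A `^ s * lebr B `^ (1 - s) <= lebr (mcomb s A B) by exact: step.
move: A B cA cB A0 B0 => _ _ _ _ _ _ A B cA cB A0 B0.
have cC := compact_mcomb (s := s) cA cB; set C := mcomb s A B in cC *.
have [lA0|lA0] := leP (lebr A) 0.
  have -> : lebr A = 0 by apply/eqP; rewrite eq_le lA0 lebr_ge0.
  by rewrite powR0 ?gt_eqF// mul0r lebr_ge0.
have [lB0|lB0] := leP (lebr B) 0.
  have -> : lebr B = 0 by apply/eqP; rewrite eq_le lB0 lebr_ge0.
  by rewrite [0 `^ _]powR0 ?gt_eqF// mulr0 lebr_ge0.
have pos (D : set 'rV[R]_(1 + n)) : compact D -> D !=set0 -> 0 < lebr D ->
    exists2 x0, 0 < lebr (sec D x0) & forall x, lebr (sec D x) <= lebr (sec D x0).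
  move=> cD D0 lD0; have [x0 _ maxx] := lebr_sec_max cD D0; exists x0 => //.
  rewrite lt_neqAle lebr_ge0 andbT eq_sym; apply/eqP => x00.
  have : (lebr D)%:E = 0%E.
    rewrite (lebr_row_mx (m := 1))//; apply: integral0_eq => x _; congr (_%:E).
    by apply/eqP; rewrite eq_le lebr_ge0 andbT -x00 maxx.
  by move=> [D00]; rewrite D00 ltxx in lD0.
have [xA a0 maxA] := pos A cA A0 lA0; set a := lebr (sec A xA) in a0 maxA.
have [xB b0 maxB] := pos B cB B0 lB0; set b := lebr (sec B xB) in b0 maxB.
pose g := a `^ s * b `^ (1 - s).
have g0 : 0 < g by rewrite mulr_gt0// powR_gt0.
have levels t : 0 < t <= 1 ->
    mcomb s (level (m := 1) A (a * t)) (level (m := 1) B (b * t)) `<=` level (m := 1) C (g * t).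
  move=> /andP[t0 t1] _ [x /= Ax [y /= By <-]].
  have cAx := compact_sec (x := x) cA; have cBy := compact_sec (x := y) cB.
  have Ax0 : sec A x !=set0 by apply: lebr_nonempty; apply: lt_le_trans Ax; rewrite mulr_gt0.
  have By0 : sec B y !=set0 by apply: lebr_nonempty; apply: lt_le_trans By; rewrite mulr_gt0.
  apply: (@le_trans _ _ (lebr (mcomb s (sec A x) (sec B y)))); last first.
    apply: le_lebr; [exact: compact_mcomb|exact: compact_sec|exact: sec_mcomb].
  apply: le_trans (IH _ _ cAx cBy Ax0 By0).
  have -> : g * t = (a * t) `^ s * (b * t) `^ (1 - s).
    rewrite !powRM ?(ltW t0) ?(ltW a0) ?(ltW b0)// mulrACA -powRD; last by rewrite (gt_eqF t0) implybT.
    by rewrite subrKC powRr1// ltW.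
  have ple (r u v : R) : 0 < r -> 0 <= u -> u <= v -> u `^ r <= v `^ r.
    move=> r0 u0 uv; apply: ge0_ler_powR => //; first exact: ltW.
    by rewrite nnegrE (le_trans u0).
  by apply: ler_pM; rewrite ?powR_ge0//; apply: ple => //; rewrite mulr_ge0// ltW.
have mf : measurable_fun setT (fun z : 'rV[R]_1 => Num.min (lebr (sec C z) / g) 1).
  apply: measurable_minr => //; apply: measurable_funM => //; exact: measurable_lebr_sec.
have minC (z : 'rV[R]_1) : 0 <= Num.min (lebr (sec C z) / g) 1 <= 1.
  by rewrite ge_min lexx orbT andbT le_min ler01 andbT divr_ge0 ?lebr_ge0// ltW.
have intC : (\int[lebesgue_measure]_(t in `]0%R, 1%R]) (lebr (level (m := 1) C (g * t)%R))%:E <=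
    (lebr C / g)%:E)%E.
  have := layer_cake leb 0 mf minC.
  have <- : (\int[lebesgue_measure]_(t in `]0%R, 1%R]) (lebr (level (m := 1) C (g * t)%R))%:E =
     \int[lebesgue_measure]_(t in `]0%R, 1%R]) ((1%:R * t ^+ 0)%:E *
      leb [set z : 'rV[R]_1 | t <= Num.min (lebr (sec C z) / g) 1]%R))%E.
    apply: eq_integral => t; rewrite inE /= in_itv /= => /andP[t0 t1]; rewrite expr0 mulr1 mul1e.
    rewrite lebrE; last by apply: compact_leb_sec => //; rewrite mulr_gt0.
    congr (leb _); apply/seteqP; split => x; rewrite /level /= le_min t1 andbT ler_pdivlMr//;
      by rewrite mulrC.
  move=> <-; rewrite EFinM (lebr_row_mx (m := 1))// -ge0_integralZr//; last first.
  - by rewrite lee_fin invr_ge0 ltW.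
  - by move=> x _; rewrite lee_fin lebr_ge0.
  - by apply/measurable_EFinP; exact: measurable_lebr_sec.
  apply: ge0_le_integral => //.
  - by move=> x _; rewrite lee_fin expr1; case/andP: (minC x).
  - by apply/measurable_EFinP; under eq_fun do rewrite expr1.
  - apply/measurable_EFinP; apply: measurable_funM => //; exact: measurable_lebr_sec.
  - by move=> x _; rewrite lee_fin expr1 ge_min lexx.
have itv0 : ([set` `]0, 1]] : set R) `<=` `]0, +oo[%classic.
  by move=> t /=; rewrite !in_itv /= andbT => /andP[].
have mlev (D : set 'rV[R]_(1 + n)) d : compact D -> 0 < d ->
    measurable_fun ([set` `]0%R, 1%R]] : set (measurableTypeR R)) (fun t : R => lebr (level (m := 1) D (d * t))).
  move=> cD d0; apply: measurable_level => // [t t0|t u t0 tu]; first by rewrite mulr_gt0.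
  by rewrite ler_pM2l.
have main : s * (lebr A / a) + (1 - s) * (lebr B / b) <= lebr C / g.
  rewrite -lee_fin; apply: le_trans intC.
  rewrite EFinD (EFinM s) (EFinM (1 - s)).
  rewrite -(layer_cake_sec (m := 1) cA a0 maxA) -(layer_cake_sec (m := 1) cB b0 maxB).
  rewrite -!ge0_integralZl//; try by move=> *; rewrite ?lee_fin ?lebr_ge0// ltW.
  2,3: by apply/measurable_EFinP; exact: mlev.
  rewrite -ge0_integralD//; try by move=> *; rewrite -EFinM lee_fin mulr_ge0 ?lebr_ge0// ltW.
  2,3: by apply: emeasurable_funM => //; apply/measurable_EFinP; exact: mlev.
  apply: ge0_le_integral => //.
  - by move=> t _; rewrite -!EFinM -EFinD lee_fin addr_ge0// mulr_ge0 ?lebr_ge0// ltW.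
  - by apply: emeasurable_funD; apply: emeasurable_funM => //; apply/measurable_EFinP; exact: mlev.
  - by apply/measurable_EFinP; exact: mlev.
  - move=> t /=; rewrite in_itv /= => /andP[t0 t1].
    rewrite -!EFinM -EFinD lee_fin.
    have [at0 bt0 gt0] : [/\ 0 < a * t, 0 < b * t & 0 < g * t] by split; rewrite mulr_gt0.
    apply: le_trans (le_lebr _ _ (levels t _)); rewrite ?t0//; last 2 first.
    + by apply: compact_mcomb; apply: compact_leb_sec.
    + exact: compact_leb_sec.
    apply: brunn_minkowski1 => //; try exact: compact_leb_sec.
    + by exists xA; rewrite /level /= -/a ger_pMr.
    + by exists xB; rewrite /level /= -/b ger_pMr.
have := le_trans (amgm_powR s01 (divr_ge0 (lebr_ge0 A) (ltW a0)) (divr_ge0 (lebr_ge0 B) (ltW b0))) main.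
rewrite ler_pdivlMr//; apply: le_trans.
rewrite -{1}(divfK (lt0r_neq0 a0) (lebr A)) -{1}(divfK (lt0r_neq0 b0) (lebr B)).
by rewrite [X in X * _]powRM ?[X in _ * X]powRM ?divr_ge0 ?lebr_ge0 ?(ltW a0) ?(ltW b0)// mulrACA.
Qed.

End BrunnMinkowski.

Section Crossing.
Variable R : realType.

Definition nroot n (x : R) : R := x `^ n%:R^-1.

Lemma nrootK n (x : R) : 0 <= x -> nroot n.+1 x ^+ n.+1 = x.
Proof.
by move=> x0; rewrite -powR_mulrn ?powR_ge0// -powRrM mulVf ?pnatr_eq0// powRr1.
Qed.

Lemma nroot_ge0 n (x : R) : 0 <= nroot n x.
Proof. exact: powR_ge0. Qed.

Lemma nroot_gt0 n (x : R) : 0 < x -> 0 < nroot n x.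
Proof. exact: powR_gt0. Qed.

Lemma brunn_minkowski n (s a b : R) (A B : set 'rV[R]_n) : 0 < s < 1 ->
  compact A -> compact B -> A !=set0 -> B !=set0 -> 0 < a -> 0 < b ->
  lebr A = a ^+ n -> lebr B = b ^+ n ->
  (s * a + (1 - s) * b) ^+ n <= lebr (mcomb s A B).
Proof.
move=> /andP[s0 s1] cA cB A0 B0 a0 b0 lA lB; have s1' : 0 < 1 - s by rewrite subr_gt0.
set d := s * a + (1 - s) * b.
have d0 : 0 < d by rewrite addr_gt0// mulr_gt0.
pose A' := [set a^-1 *: x + 0 | x in A]; pose B' := [set b^-1 *: x + 0 | x in B].
have [cA' cB'] : compact A' /\ compact B' by split; exact: compact_affine.
have lA' : lebr A' = 1.
  by rewrite lebr_affine ?invr_gt0// lA -exprMn mulVf ?gt_eqF// expr1n.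
have lB' : lebr B' = 1.
  by rewrite lebr_affine ?invr_gt0// lB -exprMn mulVf ?gt_eqF// expr1n.
pose th := s * a / d.
have th1 : 1 - th = (1 - s) * b / d.
  by rewrite /th -[X in X - _](divff (lt0r_neq0 d0)) -mulrBl {1}/d addrC addKr.
have th01 : 0 < th < 1.
  by rewrite -(subr_gt0 th) th1 !(divr_gt0, mulr_gt0).
have A'0 : A' !=set0 by case: A0 => x Ax; exists (a^-1 *: x + 0), x.
have B'0 : B' !=set0 by case: B0 => x Bx; exists (b^-1 *: x + 0), x.
have := brunn_minkowski_mul th01 cA' cB' A'0 B'0.
rewrite lA' lB' !powR1 mulr1 => H.
have cM := compact_mcomb (s := th) cA' cB'.
have -> : mcomb s A B = [set d *: x + 0 | x in mcomb th A' B'].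
  have e x y : d *: (th *: (a^-1 *: x + 0) + (1 - th) *: (b^-1 *: y + 0)) + 0 = s *: x + (1 - s) *: y :> 'rV[R]_n.
    rewrite !addr0 scalerDr th1 !scalerA; congr (_ *: _ + _ *: _).
      by rewrite /th; field; rewrite !gt_eqF.
    by field; rewrite !gt_eqF.
  apply/seteqP; split => [_ [x Ax [y By <-]]|_ [_ [_ [x Ax <-] [_ [y By <-] <-]] <-]].
    rewrite -e; eexists; last by reflexivity.
    by exists (a^-1 *: x + 0); [exists x|exists (b^-1 *: y + 0) => //; exists y].
  by rewrite e; exists x => //; exists y.
rewrite lebr_affine// -[leLHS]mulr1 ler_pM2l//; exact: exprn_gt0.
Qed.

Lemma sec_star m n (D : set 'rV[R]_(m + n)) (s : R) x y : compact D -> convex D ->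
  0 < s <= 1 -> fstproj D y ->
  s ^+ n * lebr (sec D x) <= lebr (sec D (s *: x + (1 - s) *: y)).
Proof.
move=> cD vD /andP[s0 s1] [b Db].
rewrite -(lebr_affine ((1 - s) *: b) s0 (compact_sec cD)).
apply: le_lebr; [by apply: compact_affine; exact: compact_sec|exact: compact_sec|].
move=> _ [a Da <-]; rewrite /sec /=.
have := vD s (row_mx x a) (row_mx y b) _ Da Db.
by rewrite !scale_row_mx add_row_mx; apply; rewrite ltW.
Qed.

Lemma convex_fstproj m n (D : set 'rV[R]_(m + n)) : convex D -> convex (fstproj D).
Proof.
move=> vD s x y s01 [a Da] [b Db]; exists (s *: a + (1 - s) *: b).
by have := vD s _ _ s01 Da Db; rewrite !scale_row_mx add_row_mx.
Qed.

Lemma level_star m n (D : set 'rV[R]_(m + n)) (s c t : R) : compact D -> convex D ->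
  0 < s <= 1 ->
  mcomb s (level D (c * t ^+ n)) (fstproj D) `<=` level D (c * (s * t) ^+ n).
Proof.
move=> cD vD s01 _ [x /= Dx [y Ly <-]]; apply: le_trans (sec_star x cD vD s01 Ly).
by rewrite exprMn mulrCA ler_pM2l// exprn_gt0//; case/andP: s01.
Qed.

Definition cone_profile (k : nat) (l t : R) : R := if t <= 1 then l * (1 - t) ^+ k else 0.

Lemma level_crossing m n (D : set 'rV[R]_(m.+1 + n)) (s c t : R) :
  compact D -> convex D -> 0 < lebr (fstproj D) -> 0 < c -> 0 < t -> 0 < s < 1 ->
  cone_profile m.+1 (lebr (fstproj D)) t < lebr (level D (c * t ^+ n)) ->
  cone_profile m.+1 (lebr (fstproj D)) (s * t) <= lebr (level D (c * (s * t) ^+ n)).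
Proof.
move=> cD vD l0 c0 t0 s01 H; have /andP[s0 s1] := s01.
set l := lebr _ in l0 H *.
have cn (r : R) : 0 < r -> 0 < c * r ^+ n by move=> r0; rewrite mulr_gt0// exprn_gt0.
have cS r : 0 < r -> compact (level D (c * r ^+ n)) by move=> r0; apply: compact_leb_sec => //; exact: cn.
have st0 : 0 < s * t by rewrite mulr_gt0.
have f0 : 0 < lebr (level D (c * t ^+ n)).
  apply: le_lt_trans H; rewrite /cone_profile; case: ifPn => // t1.
  by rewrite mulr_ge0 ?exprn_ge0 ?subr_ge0// ltW.
rewrite {1}/cone_profile; case: ifPn => [st1|_]; last exact: lebr_ge0.
pose a := nroot m.+1 (lebr (level D (c * t ^+ n))); pose b := nroot m.+1 l.
have [a0 b0] : 0 < a /\ 0 < b by split; exact: nroot_gt0.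
have bE : b ^+ m.+1 = l by rewrite nrootK// ltW.
have aE : a ^+ m.+1 = lebr (level D (c * t ^+ n)) by rewrite nrootK// ltW.
clearbody a b.
have BM : (s * a + (1 - s) * b) ^+ m.+1 <= lebr (level D (c * (s * t) ^+ n)).
  apply: (@le_trans _ _ (lebr (mcomb s (level D (c * t ^+ n)) (fstproj D)))).
    apply: brunn_minkowski => //; [exact: cS|exact: compact_fstproj|exact: lebr_nonempty|exact: lebr_nonempty].
  apply: le_lebr; [apply: compact_mcomb; [exact: cS|exact: compact_fstproj]|exact: cS|].
  by apply: level_star => //; rewrite s0 ltW.
apply: le_trans BM; rewrite -bE -exprMn ler_pXn2r// ?nnegrE ?mulr_ge0 ?subr_ge0 ?(ltW b0)//; last first.
  by rewrite addr_ge0// mulr_ge0// ?subr_ge0 ltW.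
have [t1|t1] := leP t 1.
  have ab : b * (1 - t) <= a.
    rewrite -(ler_pXn2r (n := m.+1))// ?nnegrE ?mulr_ge0 ?subr_ge0 ?(ltW b0) ?(ltW a0)//.
    by rewrite exprMn bE aE; move: H; rewrite /cone_profile t1 => /ltW.
  have : s * (b * (1 - t)) <= s * a by rewrite ler_pM2l.
  by lra.
have : 0 <= s * a by rewrite mulr_ge0// ltW.
have : s * b <= s * t * b by rewrite -mulrA ler_pM2l// ler_peMl// ltW.
by lra.
Qed.

End Crossing.

(** * Berwald's inequality *)

Section SingleCrossing.
Variable R : realType.
Local Notation mR := (measurableTypeR R).
Local Notation mu := (@lebesgue_measure R).
Implicit Types (M t : R) (phi : R -> R).

Definition itv0 M : set mR := [set` `]0%R, M]].

Lemma itv0P M t : itv0 M t <-> 0 < t <= M.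
Proof. by rewrite /itv0 /= in_itv. Qed.

Lemma measurable_itv0 M : measurable (itv0 M).
Proof. exact: measurable_itv. Qed.

Lemma itv0_fin M : (mu (itv0 M) < +oo)%E.
Proof. by rewrite /itv0 lebesgue_measure_itv /=; case: ifP => _; rewrite ?ltry// -EFinB ltry. Qed.

Definition moment M p phi : R := \int[mu]_(t in itv0 M) (t ^+ p * phi t).

Definition admissible M phi := measurable_fun (itv0 M) phi /\
  exists B : R, forall t, itv0 M t -> `|phi t| <= B.

Lemma admissibleM M phi psi : admissible M phi -> admissible M psi ->
  admissible M (fun t => phi t * psi t).
Proof.
move=> [mf [B fB]] [mg [C gC]]; split; first exact: measurable_funM.
by exists (B * C) => t Mt; rewrite normrM ler_pM// ?fB ?gC.
Qed.

Lemma admissibleB M phi psi : admissible M phi -> admissible M psi ->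
  admissible M (fun t => phi t - psi t).
Proof.
move=> [mf [B fB]] [mg [C gC]]; split; first exact: measurable_funB.
by exists (B + C) => t Mt; rewrite (le_trans (ler_normB _ _))// lerD ?fB ?gC.
Qed.

Lemma admissible_exp M p : admissible M (fun t => t ^+ p).
Proof.
split; first exact: measurable_funX.
exists (M ^+ p) => t /itv0P /andP[t0 tM]; rewrite ger0_norm ?exprn_ge0 ?(ltW t0)//.
by rewrite lerXn2r// nnegrE ?(ltW t0)// (le_trans (ltW t0)).
Qed.

Lemma admissible_cst M (c : R) : admissible M (fun=> c).
Proof. by split => //; exists `|c|. Qed.

Lemma admissible_integrable M phi : admissible M phi -> mu.-integrable (itv0 M) (EFin \o phi).
Proof.
move=> [mf [B fB]]; apply: measurable_bounded_integrable => //.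
- exact: measurable_itv0.
- exact: itv0_fin.
exists B; split; first exact: num_real.
by move=> C BC t /= Mt; apply: le_trans (fB _ Mt) (ltW BC).
Qed.

Lemma moment_integrable M p phi : admissible M phi ->
  mu.-integrable (itv0 M) (EFin \o (fun t => t ^+ p * phi t)).
Proof. by move=> aphi; apply: admissible_integrable; apply: admissibleM => //; exact: admissible_exp. Qed.

Lemma EFin_moment M p phi : admissible M phi ->
  (\int[mu]_(t in itv0 M) (t ^+ p * phi t)%:E)%E = (moment M p phi)%:E.
Proof.
move=> aphi; rewrite /moment /Rintegral fineK//.
apply: integrable_fin_num; [exact: measurable_itv0|exact: moment_integrable].
Qed.

(* If [phi - psi] changes sign once, from + to -, at [t0], then
   [t^p (t0^q - t^q) (phi - psi)] is nonnegative. *)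
Lemma single_crossing M t0 p q phi psi : 0 <= t0 -> admissible M phi -> admissible M psi ->
  (forall t, itv0 M t -> t < t0 -> psi t <= phi t) ->
  (forall t, itv0 M t -> t0 < t -> phi t <= psi t) ->
  moment M p phi = moment M p psi ->
  moment M (p + q.+1) phi <= moment M (p + q.+1) psi /\
  (moment M (p + q.+1) phi = moment M (p + q.+1) psi ->
   {ae mu, forall t, itv0 M t -> phi t = psi t}).
Proof.
move=> t00 aphi apsi lo hi eqp.
pose chi t := t ^+ p * ((t0 ^+ q.+1 - t ^+ q.+1) * (phi t - psi t)).
have chi0 t : itv0 M t -> 0 <= chi t.
  move=> Mt; have /itv0P /andP[tp _] := Mt.
  rewrite mulr_ge0 ?exprn_ge0 ?(ltW tp)//.
  have [tt0|t0t|->] := ltgtP t t0; last by rewrite subrr mul0r.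
    by rewrite mulr_ge0// subr_ge0 ?lo// lerXn2r// ?nnegrE ?(ltW tp) ?(ltW tt0).
  by rewrite mulr_le0// subr_le0 ?hi// lerXn2r// ?nnegrE ?(ltW tp) ?(ltW t0t).
have aB := admissibleB aphi apsi.
have achi : admissible M chi.
  apply: admissibleM; first exact: admissible_exp.
  by apply: admissibleM => //; apply: admissibleB; [exact: admissible_cst|exact: admissible_exp].
have mB r : moment M r (fun t => phi t - psi t) = moment M r phi - moment M r psi.
  rewrite /moment -RintegralB; [|exact: measurable_itv0|exact: moment_integrable|exact: moment_integrable].
  by apply: eq_Rintegral => t _; rewrite mulrBr.
have intchi : \int[mu]_(t in itv0 M) chi t = moment M (p + q.+1) psi - moment M (p + q.+1) phi.
  transitivity (\int[mu]_(t in itv0 M) (t0 ^+ q.+1 * (t ^+ p * (phi t - psi t)) - t ^+ (p + q.+1) * (phi t - psi t))).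
    by apply: eq_Rintegral => t _; rewrite /chi exprD; ring.
  rewrite RintegralB; [|exact: measurable_itv0| |exact: moment_integrable]; last first.
    apply: admissible_integrable; apply: admissibleM; first exact: admissible_cst.
    by apply: admissibleM => //; exact: admissible_exp.
  rewrite RintegralZl; [|exact: measurable_itv0|exact: moment_integrable].
  by rewrite -!/(moment _ _ _) !mB eqp subrr mulr0 sub0r opprB.
have ichi0 : 0 <= \int[mu]_(t in itv0 M) chi t by exact: Rintegral_ge0.
split; first by move: ichi0; rewrite intchi subr_ge0.
move=> eqpq; have {}ichi0 : \int[mu]_(t in itv0 M) chi t = 0 by rewrite intchi eqpq subrr.
have : (\int[mu]_(t in itv0 M) `|(chi t)%:E| = 0)%E.
  transitivity (\int[mu]_(t in itv0 M) (chi t)%:E)%E.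
    by apply: eq_integral => t; rewrite inE => Mt; rewrite /= ger0_norm// chi0.
  move: ichi0; rewrite /Rintegral => /eqP; rewrite fine_eq0; last first.
    by apply: integrable_fin_num; [exact: measurable_itv0|exact: admissible_integrable].
  by move=> /eqP.
move=> /(ae_eq_integral_abs _ (measurable_itv0 M) _).1 H.
have /H {H} : measurable_fun (itv0 M) (fun t => (chi t)%:E).
  by apply/measurable_EFinP; case: achi.
move=> [N [mN N0 sN]].
exists (N `|` [set t0]); split; first exact: measurableU.
  apply: null_set_setU => //; exact: lebesgue_measure_set1.
move=> t /= H; apply: contrapT => /not_orP[Nt tt0]; apply: H => Mt.
have : chi t = 0.
  by have /contrapT/(_ Mt)[] : ~ ~ (itv0 M t -> (chi t)%:E = cst 0%E t) by move=> /sN.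
move: Mt => /itv0P /andP[tp _].
move/eqP; rewrite !mulf_eq0 expf_eq0 (gt_eqF tp) andbF /= !subr_eq0 => /orP[|/eqP//].
rewrite eqrXn2 ?(ltW tp)// => /eqP tE; by case: tt0; rewrite /= tE.
Qed.

Lemma ae_eq_nonincreasing M phi psi t1 t2 : {ae mu, forall t, itv0 M t -> phi t = psi t} ->
  0 <= t1 -> t1 < t2 -> t2 <= M -> exists2 t, t1 < t < t2 & phi t = psi t.
Proof.
move=> [N [mN N0 sN]] t10 t12 t2M; apply: contrapT => H.
have : (mu (`]t1, t2[%classic : set mR) <= mu N)%E.
  apply: le_measure; rewrite ?inE//.
  move=> t /=; rewrite in_itv /= => /andP[a b]; apply: sN => /= E; apply: H; exists t.
    by rewrite a b.
  apply: E; apply/itv0P; rewrite (le_lt_trans t10)//= (le_trans (ltW b))//.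
rewrite N0 lebesgue_measure_itv /= lte_fin t12 -EFinB lee_fin subr_le0.
by rewrite leNgt t12.
Qed.

End SingleCrossing.

Section Berwald.
Variable R : realType.
Local Notation mu := (@lebesgue_measure R).

Lemma cone_profile_nonincreasing k (l x y : R) : 0 <= l -> x <= y ->
  cone_profile k l y <= cone_profile k l x.
Proof.
move=> l0 xy; rewrite /cone_profile; case: ifPn => [y1|_].
  rewrite (le_trans xy y1) ler_wpM2l// lerXn2r// ?nnegrE ?subr_ge0//.
    exact: le_trans xy y1.
  by rewrite lerD2l lerN2.
by case: ifPn => // x1; rewrite mulr_ge0// exprn_ge0// subr_ge0.
Qed.

Lemma cone_profile_ge0 k (l x : R) : 0 <= l -> 0 <= cone_profile k l x.
Proof.
by move=> l0; rewrite /cone_profile; case: ifPn => // x1; rewrite mulr_ge0// exprn_ge0// subr_ge0.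
Qed.

Lemma admissible_cone M k (l : R) : 0 <= l -> admissible M (cone_profile k l).
Proof.
move=> l0; split.
  apply: nonincreasing_measurable; first exact: measurable_itv0.
  by move=> x y xy; exact: cone_profile_nonincreasing.
exists (cone_profile k l 0) => t /itv0P /andP[t0 _].
rewrite ger0_norm ?cone_profile_ge0//; apply: cone_profile_nonincreasing => //; exact: ltW.
Qed.

Lemma moment_restrict M r (phi : R -> R) : 1 <= M -> (forall t, 1 < t -> phi t = 0) ->
  moment M r phi = moment 1 r phi.
Proof.
move=> M1 phi0; rewrite /moment Rintegral_mkcond [RHS]Rintegral_mkcond.
apply: eq_Rintegral => t _; rewrite !patchE.
have [t1|t1] := pselect (itv0 1 t).
  have tM : itv0 M t.
    by move: t1 => /itv0P /andP[t0 t1]; apply/itv0P; rewrite t0 (le_trans t1).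
  by rewrite !mem_set.
rewrite [in RHS]memNset//; have [tM|tM] := pselect (itv0 M t); last by rewrite memNset.
rewrite mem_set// phi0 ?mulr0// ltNge; apply/negP => t1'; apply: t1.
by move: tM => /itv0P /andP[t0 _]; apply/itv0P; rewrite t0.
Qed.

Lemma moment_cone r k (l : R) :
  r.+1%:R * moment 1 r (cone_profile k l) = l / 'C(k + r.+1, k)%:R.
Proof.
have -> : moment 1 r (cone_profile k l) = l * beta_fun r.+1 k.+1.
  rewrite /beta_fun /= -Rintegral_mkcond.
  rewrite -Rintegral_itv_obnd_cbnd; last first.
    apply: (@integrableS _ _ _ mu `[0, 1]) => //; last exact: integrable_XMonemX.
    by apply: subset_itvr; rewrite bnd_simp.
  rewrite -RintegralZl//; last first.
    apply: (@integrableS _ _ _ mu `[0, 1]) => //; last exact: integrable_XMonemX.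
    by apply: subset_itvr; rewrite bnd_simp.
  apply: eq_Rintegral => t; rewrite inE => /itv0P /andP[t0 t1].
  by rewrite /cone_profile t1 /XMonemX mulrCA.
have := bin_fact (leq_addr r.+1 k); rewrite addKn => binE.
rewrite beta_fun_fact (_ : (r + k).+1 = (k + r.+1)%N); last by rewrite addnS addnC.
rewrite -binE factS !natrM.
have f0 p : (p`!%:R : R) != 0 by rewrite pnatr_eq0 -lt0n fact_gt0.
have C0 : ('C(k + r.+1, k)%:R : R) != 0 by rewrite pnatr_eq0 -lt0n bin_gt0 leq_addr.
have r0 : (r.+1%:R : R) != 0 by rewrite pnatr_eq0.
move: (f0 k) (f0 r) C0 r0.
move: (k`!%:R : R) (r`!%:R : R) ('C(k + r.+1, k)%:R : R) (r.+1%:R : R) => a b c d a0 b0 c0 d0.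
by field; rewrite a0 b0 c0 d0.
Qed.

Variables (k m : nat) (D : set 'rV[R]_(k.+1 + m.+1)).
Hypotheses (cD : compact D) (vD : convex D).
Let l := lebr (fstproj D).
Hypothesis l0 : 0 < l.

Definition fiber_radius (c : R) (x : 'rV[R]_k.+1) : R := nroot m.+1 (lebr (sec D x) / c).

Definition level_profile (c t : R) : R := lebr (level D (c * t ^+ m.+1)).

Lemma fiber_radiusE c x : 0 < c -> fiber_radius c x ^+ m.+1 = lebr (sec D x) / c.
Proof. by move=> c0; rewrite nrootK// divr_ge0 ?lebr_ge0// ltW. Qed.

Lemma fiber_radius_ge0 c x : 0 <= fiber_radius c x.
Proof. exact: nroot_ge0. Qed.

Lemma le_fiber_radius c t x : 0 < c -> 0 <= t -> (t <= fiber_radius c x) = (c * t ^+ m.+1 <= lebr (sec D x)).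
Proof.
move=> c0 t0; rewrite -[LHS](ler_pXn2r (n := m.+1))// ?nnegrE ?fiber_radius_ge0//.
by rewrite fiber_radiusE// ler_pdivlMr// mulrC.
Qed.

Lemma fiber_radius_le c t x : 0 < c -> 0 <= t -> (fiber_radius c x <= t) = (lebr (sec D x) <= c * t ^+ m.+1).
Proof.
move=> c0 t0; rewrite -[LHS](ler_pXn2r (n := m.+1))// ?nnegrE ?fiber_radius_ge0//.
by rewrite fiber_radiusE// ler_pdivrMr// mulrC.
Qed.

Lemma level_profile_nonincreasing c s t : 0 < c -> 0 < s -> s <= t ->
  level_profile c t <= level_profile c s.
Proof.
move=> c0 s0 st; have t0 := lt_le_trans s0 st.
apply: le_lebr; try by apply: compact_leb_sec => //; rewrite mulr_gt0// exprn_gt0.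
by apply: level_le; rewrite ler_pM2l// lerXn2r// nnegrE ltW.
Qed.

Lemma level_profile_le c t : 0 < c -> 0 < t -> level_profile c t <= l.
Proof.
move=> c0 t0; have ct : 0 < c * t ^+ m.+1 by rewrite mulr_gt0// exprn_gt0.
apply: le_lebr; [exact: compact_leb_sec|exact: compact_fstproj|exact: level_fstproj].
Qed.

Lemma admissible_level M c : 0 < c -> admissible M (level_profile c).
Proof.
move=> c0; split.
  apply: measurable_level => //.
  - by move=> t t0; rewrite mulr_gt0// exprn_gt0.
  - by move=> t u t0 tu; rewrite ler_pM2l// lerXn2r// nnegrE ?(le_trans (ltW t0))// ltW.
  - exact: measurable_itv0.
  - by move=> t /itv0P /andP[t0 _]; rewrite /= in_itv /= t0.
exists l => t /itv0P /andP[t0 _]; rewrite ger0_norm ?lebr_ge0//.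
exact: level_profile_le.
Qed.

Lemma measurable_fiber_radius c : measurable_fun setT (fiber_radius c).
Proof.
apply: (measurableT_comp (f := fun z => powR z m.+1%:R^-1)); first exact: measurable_powR.
by apply: measurable_funM => //; exact: measurable_lebr_sec.
Qed.

Lemma integral_fiber_radius M c r : 0 < c -> (forall x, fiber_radius c x <= M) ->
  (\int[leb]_x (fiber_radius c x ^+ r.+1)%:E)%E = (r.+1%:R * moment M r (level_profile c))%:E.
Proof.
move=> c0 uM.
rewrite (layer_cake leb r (measurable_fiber_radius c) (b := M)); last first.
  by move=> x; rewrite fiber_radius_ge0 uM.
rewrite EFinM -EFin_moment; last exact: admissible_level.
rewrite -ge0_integralZl//; last 3 first.
- exact: measurable_itv0.
- apply/measurable_EFinP; apply: measurable_funM; first exact: measurable_funX.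
  by case: (admissible_level M c0).
- by move=> t /itv0P /andP[t0 _]; rewrite lee_fin mulr_ge0 ?lebr_ge0// exprn_ge0// ltW.
apply: eq_integral => t; rewrite inE => /itv0P /andP[t0 tM].
rewrite EFinM -muleA; congr (_ * _)%E.
rewrite EFinM /level_profile lebrE; last first.
  by apply: compact_leb_sec => //; rewrite mulr_gt0// exprn_gt0.
congr (_ * leb _)%E; apply/seteqP; split => x; rewrite /level /= le_fiber_radius ?(ltW t0)//.
Qed.

Lemma integral_fiber_radius_m c : 0 < c ->
  (\int[leb]_x (fiber_radius c x ^+ m.+1)%:E)%E = (lebr D / c)%:E.
Proof.
move=> c0; under eq_integral do rewrite fiber_radiusE// EFinM.
rewrite ge0_integralZr//; last 3 first.
- by apply/measurable_EFinP; exact: measurable_lebr_sec.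
- by move=> x _; rewrite lee_fin lebr_ge0.
- by rewrite lee_fin invr_ge0 ltW.
by rewrite -lebr_row_mx// -EFinM.
Qed.

Lemma integral_cone c r : 0 < c -> (forall x, lebr (sec D x) <= c) ->
  (forall t, 0 < t < 1 -> level_profile c t = l * (1 - t) ^+ k.+1) ->
  (\int[leb]_x (fiber_radius c x ^+ r.+1)%:E)%E = (l / 'C(k.+1 + r.+1, k.+1)%:R)%:E.
Proof.
move=> c0 Dc phi; rewrite (@integral_fiber_radius 1)//; last first.
  by move=> x; rewrite fiber_radius_le// expr1n mulr1.
congr (_%:E); rewrite -moment_cone; congr (_ * _).
rewrite /moment /itv0 -!Rintegral_itv_bndo_bndc; last 2 first.
- apply: (integrableS _ _ _ (moment_integrable r (admissible_cone 1 k.+1 (ltW l0)))) => //.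
    exact: measurable_itv0.
  by apply: subset_itvl; rewrite bnd_simp.
- apply: (integrableS _ _ _ (moment_integrable r (admissible_level 1 c0))) => //.
    exact: measurable_itv0.
  by apply: subset_itvl; rewrite bnd_simp.
apply: eq_Rintegral => t; rewrite inE /= in_itv /= => /andP[t0 t1].
by rewrite phi ?t0// /cone_profile ltW.
Qed.

Lemma berwald c q : 0 < c -> lebr D / c = l / 'C(k.+1 + m.+1, k.+1)%:R ->
  (\int[leb]_x (fiber_radius c x ^+ (m.+1 + q.+1))%:E <=
    (l / 'C(k.+1 + (m.+1 + q.+1), k.+1)%:R)%:E)%E /\
  ((\int[leb]_x (fiber_radius c x ^+ (m.+1 + q.+1))%:E)%E =
    (l / 'C(k.+1 + (m.+1 + q.+1), k.+1)%:R)%:E ->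
  forall t, 0 < t < 1 -> level_profile c t = l * (1 - t) ^+ k.+1).
Proof.
move=> c0 Dc.
have D0 : D !=set0.
  apply: lebr_nonempty; move: Dc => /(congr1 ( *%R^~ c)); rewrite divfK ?gt_eqF// => ->.
  by rewrite mulr_gt0// divr_gt0// ltr0n bin_gt0 leq_addr.
have [x0 _ maxx] := lebr_sec_max cD D0.
pose M := Num.max 1 (fiber_radius c x0).
have M1 : 1 <= M by rewrite le_max lexx.
have M0 : 0 < M by exact: lt_le_trans M1.
have uM x : fiber_radius c x <= M.
  rewrite le_max fiber_radius_le ?fiber_radius_ge0//; apply/orP; right.
  by rewrite fiber_radius_le ?fiber_radius_ge0// -ler_pdivrMl// mulrC fiber_radiusE// ler_pM2r ?invr_gt0.
pose phi := level_profile c; pose psi := cone_profile k.+1 l.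
have aphi : admissible M phi by exact: admissible_level.
have apsi : admissible M psi by apply: admissible_cone; exact: ltW.
have psi0 t : 1 < t -> psi t = 0 by move=> t1; rewrite /psi /cone_profile leNgt t1.
have psiM r : r.+1%:R * moment M r psi = l / 'C(k.+1 + r.+1, k.+1)%:R.
  by rewrite moment_restrict// moment_cone.
have rpos r : (r.+1%:R : R) != 0 by rewrite pnatr_eq0.
have eqm : moment M m phi = moment M m psi.
  apply: (mulfI (rpos m)); rewrite psiM -Dc; apply: EFin_inj.
  by rewrite -integral_fiber_radius_m// (@integral_fiber_radius M).
pose T := [set t : R | t = 0 \/ itv0 M t /\ psi t < phi t].
have T0 : T !=set0 by exists 0; left.
have Tub : has_ubound T by exists M => t [->|[/itv0P /andP[]]] //; exact: ltW.
have t00 : 0 <= sup T by apply: ub_le_sup => //; left.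
have [|||le_r eq_r] := @single_crossing R M (sup T) m q phi psi t00 aphi apsi.
- move=> t /itv0P /andP[t0 tM] /(sup_gt T0) [t' [->|[/itv0P /andP[t'0 t'M] H]] tt'].
    by move: (lt_trans t0 tt'); rewrite ltxx.
  have -> : t = (t / t') * t' by rewrite divfK ?gt_eqF.
  by apply: level_crossing => //; rewrite divr_gt0//= ltr_pdivrMr// mul1r.
- move=> t Mt tt; rewrite leNgt; apply/negP => H.
  by move: tt; rewrite ltNge => /negP; apply; apply: ub_le_sup => //; right.
- exact: eqm.
rewrite addSn (@integral_fiber_radius M)// -psiM; split.
  by rewrite lee_fin ler_pM2l ?ltr0n.
move=> H; have aeE := eq_r (mulfI (rpos _) (EFin_inj H)); move=> t /andP[t0 t1].
pose g (z : R) := l * (1 - z) ^+ k.+1.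
have psig z : z < 1 -> psi z = g z by move=> z1; rewrite /psi /cone_profile ltW.
have cg : {for t, continuous g}.
  apply: continuousM; first exact: cst_continuous.
  apply: (@continuous_comp _ _ _ (fun z : R => 1 - z) (fun z : R => z ^+ k.+1)).
    by apply: continuousB; [exact: cst_continuous|by move=> ?].
  exact: exprn_continuous.
rewrite -/(g t) -/(phi t); apply/eqP; rewrite eq_le; apply/andP; split; rewrite leNgt; apply/negP => tg.
  have /nbhs_ballP[e /= e0 eg] : \forall z \near t, g z < phi t by apply: cvgr_lt cg _ tg.
  have [|||t'' /andP[t''1 t''2] E] := @ae_eq_nonincreasing R M phi psi (Num.max (t / 2) (t - e / 2)) t aeE.
  - by rewrite le_max divr_ge0// ltW.
  - by rewrite gt_max; apply/andP; split; lra.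
  - by rewrite (le_trans _ M1)// ltW.
  move: t''1; rewrite gt_max => /andP[a1 a2].
  have : phi t <= phi t'' by apply: level_profile_nonincreasing => //; [lra|exact: ltW].
  rewrite leNgt E psig ?(lt_trans t''2)// => /negP; apply; apply: eg.
  by rewrite /ball /= ltr_norml; apply/andP; split; lra.
have /nbhs_ballP[e /= e0 eg] : \forall z \near t, phi t < g z by apply: cvgr_gt cg _ tg.
have [|||t'' /andP[t''1 t''2] E] := @ae_eq_nonincreasing R M phi psi t (Num.min ((t + 1) / 2) (t + e / 2)) aeE.
- exact: ltW.
- by rewrite lt_min; apply/andP; split; lra.
- by rewrite (le_trans _ M1)// ge_min; apply/orP; left; lra.
move: t''2; rewrite lt_min => /andP[a1 a2].
have : phi t'' <= phi t by apply: level_profile_nonincreasing => //; exact: ltW.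
rewrite leNgt E psig; last by lra.
move=> /negP; apply; apply: eg.
by rewrite /ball /= ltr_norml; apply/andP; split; lra.
Qed.

End Berwald.

(** * Rigidity and cones *)

Section Geometry.
Variable R : realType.

Definition homothet n (s : R) (x : 'rV[R]_n) (A : set 'rV[R]_n) : set 'rV[R]_n :=
  [set s *: x + (1 - s) *: y | y in A].

Lemma homothetE n (s : R) (x : 'rV[R]_n) (A : set 'rV[R]_n) :
  homothet s x A = [set (1 - s) *: y + s *: x | y in A].
Proof. by apply: eq_imagel => y _; rewrite addrC. Qed.

Lemma compact_homothet n (s : R) (x : 'rV[R]_n) (A : set 'rV[R]_n) :
  compact A -> compact (homothet s x A).
Proof. by rewrite homothetE; exact: compact_affine. Qed.

Lemma lebr_homothet n (s : R) (x : 'rV[R]_n) (A : set 'rV[R]_n) : s < 1 ->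
  compact A -> lebr (homothet s x A) = (1 - s) ^+ n * lebr A.
Proof. by move=> s1 cA; rewrite homothetE lebr_affine// subr_gt0. Qed.

Lemma lebr_disjoint n (A B T : set 'rV[R]_n) : compact A -> compact B -> compact T ->
  A `<=` T -> B `<=` T -> A `&` B = set0 -> lebr A + lebr B <= lebr T.
Proof.
move=> cA cB cT AT BT AB; rewrite -lee_fin EFinD !lebrE//.
have [mA mB mT] : [/\ measurable A, measurable B & measurable T].
  by split; exact: compact_measurable_row.
rewrite -measureU//; apply: le_measure; rewrite ?inE//; first exact: measurableU.
by move=> x [/AT|/BT].
Qed.

Lemma closed_separated n (A : set 'rV[R]_n) x : closed A -> ~ A x ->
  exists2 e : R, 0 < e & forall y, A y -> e <= `|x - y|.
Proof.
move=> cA Ax; apply: contrapT => H; apply: Ax; apply: closed_row_seq cA _ => e e0.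
apply: contrapT => H'; apply: H; exists e => // y Ay; rewrite leNgt; apply/negP => xy.
by apply: H'; exists y.
Qed.

(* A point of the convex set [T] off [S] sees a small homothetic copy of [T]
   inside [T] and off [S]. *)
Lemma full_measure_eq n (S T : set 'rV[R]_n) : compact S -> compact T -> convex T ->
  S `<=` T -> 0 < lebr T -> lebr T <= lebr S -> S = T.
Proof.
move=> cS cT vT ST T0 TS; apply/seteqP; split => // z Tz; apply: contrapT => Sz.
have [e e0 ze] := closed_separated (compact_closed_row cS) Sz.
have [M M0 TM] := compact_ball cT.
have MM0 : 0 < M + M by rewrite addr_gt0.
pose d := Num.min (1 / 2) (e / (M + M) / 2).
have d0 : 0 < d by rewrite lt_min !divr_gt0.
have d1 : d < 1 by rewrite gt_min; apply/orP; left; lra.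
have dM : d * (M + M) < e.
  rewrite -ltr_pdivlMr//; apply: (@le_lt_trans _ _ (e / (M + M) / 2)); first by rewrite ge_min lexx orbT.
  by rewrite ltr_pdivrMr// ltr_pMr ?divr_gt0//; lra.
have := @lebr_disjoint n S (homothet (1 - d) z T) T cS (compact_homothet cT) cT ST.
rewrite lebr_homothet//; last by rewrite ltrBlDr ltrDl.
rewrite subKr => H.
have : lebr S + d ^+ n * lebr T <= lebr T.
  apply: H.
    by move=> _ [y Ty <-]; apply: vT => //; apply/andP; split; lra.
  rewrite -subset0 => w [Sw [y Ty wE]]; move: Sw; rewrite -wE => /ze.
  rewrite leNgt => /negP; apply; apply: le_lt_trans dM.
  have -> : z - ((1 - d) *: z + (1 - (1 - d)) *: y) = d *: (z - y).
    by apply/rowP => i; rewrite !mxE; ring.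
  rewrite normrZ gtr0_norm// ler_pM2l//; apply: le_trans (ler_normB _ _) _.
  by rewrite lerD// TM.
have : 0 < d ^+ n * lebr T by rewrite mulr_gt0// exprn_gt0.
by move: TS; lra.
Qed.

Lemma lebr_point n (x : 'rV[R]_n.+1) : lebr [set x] = 0.
Proof.
have c1 : compact [set x] by exact: compact_set1.
have h2 : (1 / 2 : R) < 1 by lra.
have := lebr_homothet x h2 c1.
have -> : homothet (1 / 2) x [set x] = [set x].
  by rewrite /homothet image_set1 -scalerDl subrKC scale1r.
have : (1 - 1 / 2) ^+ n.+1 < 1 :> R.
  by rewrite exprn_ilt1 ?andbT //; lra.
by have := lebr_ge0 [set x]; nra.
Qed.

Definition prodset p q (A : set 'rV[R]_p) (B : set 'rV[R]_q) : set 'rV[R]_(p + q) :=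
  [set w | A (lsubmx w) /\ B (rsubmx w)].

Lemma prodsetP p q (A : set 'rV[R]_p) (B : set 'rV[R]_q) a b :
  prodset A B (row_mx a b) <-> A a /\ B b.
Proof. by rewrite /prodset /= row_mxKl row_mxKr. Qed.

Lemma compact_prodset p q (A : set 'rV[R]_p) (B : set 'rV[R]_q) :
  compact A -> compact B -> compact (prodset A B).
Proof.
move=> cA cB.
rewrite (_ : prodset A B = (fun z : 'rV[R]_p * 'rV[R]_q => row_mx z.1 z.2) @` (A `*` B)).
  apply: continuous_compact; last exact: compact_setX.
  exact: continuous_subspaceT (@row_mx_continuous R p q).
apply/seteqP; split => [w [Aw Bw]|_ [[x y] [/= Ax By] <-]]; last exact/prodsetP.
by exists (lsubmx w, rsubmx w) => //=; rewrite hsubmxK.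
Qed.

Lemma convex_prodset p q (A : set 'rV[R]_p) (B : set 'rV[R]_q) :
  convex A -> convex B -> convex (prodset A B).
Proof.
move=> vA vB s x y s01 [Ax Bx] [Ay By].
rewrite -(hsubmxK x) -(hsubmxK y) !scale_row_mx add_row_mx; apply/prodsetP.
by split; [exact: vA|exact: vB].
Qed.

Lemma lebr_prodset p q (A : set 'rV[R]_p) (B : set 'rV[R]_q) :
  compact A -> compact B -> lebr (prodset A B) = lebr A * lebr B.
Proof.
move=> cA cB; apply: EFin_inj; rewrite lebr_row_mx; last exact: compact_prodset.
have mA := compact_measurable_row cA.
rewrite EFinM lebrE// -integral_indic_mulr//; last by rewrite lee_fin lebr_ge0.
apply: eq_integral => x _; rewrite indicE.
have [Ax|nAx] := pselect (A x).
  rewrite mem_set// mul1e; congr (lebr _)%:E; apply/seteqP; split => y.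
    by move=> /prodsetP[].
  by move=> By; exact/prodsetP.
rewrite memNset// mul0e (_ : sec _ _ = set0) ?/lebr ?measure0//.
by rewrite -subset0 => y /prodsetP[].
Qed.

Section Apex.
Variables (k m : nat) (D : set 'rV[R]_(k.+1 + m.+1)).
Hypotheses (cD : compact D) (vD : convex D).
Let L := fstproj D.
Let l := lebr L.
Hypothesis l0 : 0 < l.
Variable c : R.
Hypothesis c0 : 0 < c.
Hypothesis profile : forall t, 0 < t < 1 -> level_profile D c t = l * (1 - t) ^+ k.+1.

Let cL : compact L := compact_fstproj cD.

Let homothet_level s t x : 0 < s < 1 -> 0 < t -> c * t ^+ m.+1 <= lebr (sec D x) ->
  homothet s x L `<=` level D (c * (s * t) ^+ m.+1).
Proof.
move=> /andP[s0 s1] t0 Dx _ [y Ly <-]; apply: (level_star (s := s)) => //.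
  by rewrite s0 ltW.
by exists x => //; exists y.
Qed.

Let compact_lev t : 0 < t -> compact (level D (c * t ^+ m.+1)).
Proof. by move=> t0; apply: compact_leb_sec => //; rewrite mulr_gt0// exprn_gt0. Qed.

Lemma profile_bound x : lebr (sec D x) <= c.
Proof.
rewrite leNgt; apply/negP => Dx; pose r := fiber_radius D c x.
have r1 : 1 < r by rewrite ltNge fiber_radius_le// expr1n mulr1 -ltNge.
have r0 : 0 < r by exact: lt_trans r1.
pose s := (2 * r)^-1.
have sr : s * r = 2^-1 by rewrite /s invfM mulfVK ?gt_eqF.
have s0 : 0 < s by rewrite invr_gt0 mulr_gt0.
have sr' : s < s * r by rewrite ltr_pMr.
have s01 : 0 < s < 1 by rewrite s0; lra.
have /(homothet_level s01 r0) sub : c * r ^+ m.+1 <= lebr (sec D x) by rewrite -le_fiber_radius// ltW.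
have srp : 0 < s * r by rewrite sr; lra.
have := le_lebr (compact_homothet cL) (compact_lev srp) sub.
rewrite -/(level_profile D c (s * r)) profile; last by rewrite srp sr; lra.
rewrite lebr_homothet//; last by lra.
rewrite mulrC ler_pM2l// leNgt ltrXn2r ?nnegrE//; lra.
Qed.

Lemma exists_apex : exists x0, [/\ L x0, lebr (sec D x0) = c &
  forall s z, 0 < s < 1 -> c * s ^+ m.+1 <= lebr (sec D z) -> homothet s x0 L z].
Proof.
have L0 : L !=set0 by exact: lebr_nonempty.
have D0 : D !=set0 by case: L0 => x [y Dxy]; exists (row_mx x y).
have [x0 Lx0 maxx] := lebr_sec_max cD D0.
have Dx0 : lebr (sec D x0) = c.
  apply/eqP; rewrite eq_le profile_bound /= leNgt; apply/negP => Dc.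
  pose r := fiber_radius D c x0.
  have r1 : r < 1 by rewrite ltNge le_fiber_radius// expr1n mulr1 -ltNge.
  have r0 : 0 <= r by exact: fiber_radius_ge0.
  pose t := (r + 1) / 2.
  have t01 : 0 < t < 1 by apply/andP; split; rewrite /t; lra.
  have := profile t01; rewrite /level_profile (_ : level _ _ = set0).
    rewrite [LHS]/lebr measure0 /= => /esym/eqP; rewrite mulf_eq0 gt_eqF//= expf_eq0 /=.
    by rewrite subr_eq0 => /eqP tE; move: t01; rewrite -tE ltxx andbF.
  rewrite -subset0 => x /= Dx; have := le_trans Dx (maxx x).
  case/andP: t01 => t0 _; rewrite -le_fiber_radius// ?(ltW t0)// -/r /t; lra.
exists x0; split => // s z s01 Dz; have /andP[s0 s1] := s01; apply: contrapT => Hz.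
have cH : compact (homothet s x0 L) by exact: compact_homothet.
have [e e0 ze] := closed_separated (compact_closed_row cH) Hz.
have [M M0 LM] := compact_ball cL.
pose d := e / (M + M) / 2.
have MM0 : 0 < M + M by rewrite addr_gt0.
have d0 : 0 < d by rewrite !divr_gt0.
have dM : d * (M + M) < e.
  by rewrite /d mulrAC divfK ?gt_eqF// ltr_pdivrMr// ltr_pMr//; lra.
pose g := (1 + d)^-1.
have d10 : 0 < 1 + d by rewrite addr_gt0.
have g01 : 0 < g < 1 by rewrite invr_gt0 d10 /= invf_lt1// ltrDl.
have /andP[g0 g1] := g01.
have gs01 : 0 < g * s < 1 by rewrite mulr_gt0//= -[ltRHS]mulr1 ltr_pM// ltW.
have /andP[gs0 gs1] := gs01.
have sub1 := homothet_level g01 s0 Dz.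
have sub2 : homothet (g * s) x0 L `<=` level D (c * (g * s) ^+ m.+1).
  have := @homothet_level (g * s) 1 x0 gs01 ltr01; rewrite expr1n !mulr1 Dx0 lexx.
  by apply.
have := lebr_disjoint (compact_homothet cL) (compact_homothet cL) (compact_lev gs0) sub1 sub2.
rewrite !lebr_homothet// -/(level_profile D c (g * s)) profile// => H.
have H0 : (1 - g) ^+ k.+1 * l + (1 - g * s) ^+ k.+1 * l <= l * (1 - g * s) ^+ k.+1.
  apply: H; rewrite -subset0 => w [[y Ly <-] [y' Ly' E]].
  have := ze (s *: x0 + (1 - s) *: y'); rewrite leNgt => H; suff : e < e by rewrite ltxx.
  have /H/negP : homothet s x0 L (s *: x0 + (1 - s) *: y') by exists y'.
  case; apply: le_lt_trans dM.
  have -> : z - (s *: x0 + (1 - s) *: y') = d *: (y' - y).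
    have gd : 1 - (1 + d) * g = 0 by rewrite mulfV ?gt_eqF// subrr.
    apply/rowP => i; apply/eqP; rewrite -subr_eq0.
    move/(congr1 (fun w : 'rV[R]_k.+1 => w 0 i)): E; rewrite !mxE => E.
    rewrite [X in X == _](_ : _ = (1 + d) * ((g * z 0 i + (1 - g) * y 0 i) -
      (g * s * x0 0 i + (1 - g * s) * y' 0 i)) +
      (1 - (1 + d) * g) * (z 0 i - y 0 i - s * x0 0 i + s * y' 0 i)); last by ring.
    by rewrite gd E subrr mulr0 mul0r addr0.
  rewrite normrZ gtr0_norm// ler_pM2l//; apply: le_trans (ler_normB _ _) _.
  by rewrite lerD// LM.
have : 0 < (1 - g) ^+ k.+1 * l by rewrite mulr_gt0// exprn_gt0// subr_gt0.
by move: H0; rewrite [X in _ <= X]mulrC; lra.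
Qed.

End Apex.

End Geometry.

Section Estimates.
Variable R : realType.

Lemma weighted_AGM p q (a b : R) : (0 < p)%N -> (0 < q)%N -> 0 <= a -> 0 <= b ->
  a ^+ p * b ^+ q <= (p%:R * a ^+ (p + q) + q%:R * b ^+ (p + q)) / (p + q)%:R /\
  (a ^+ p * b ^+ q = (p%:R * a ^+ (p + q) + q%:R * b ^+ (p + q)) / (p + q)%:R -> a = b).
Proof.
move=> p0 q0 a0 b0.
have N0 : (0 < p + q)%N by rewrite addn_gt0 p0.
pose E (i : 'I_(p + q)) := if (i < p)%N then a ^+ (p + q) else b ^+ (p + q).
have E0 : {in (fun _ => true) : {pred 'I_(p + q)}, forall i, 0 <= E i}.
  by move=> i _; rewrite /E; case: ifP => _; exact: exprn_ge0.
have := leif_AGM E0.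
rewrite big_split_ord /= [X in X * _](_ : _ = a ^+ (p + q) ^+ p); last first.
  rewrite (eq_bigr (fun=> a ^+ (p + q))) => [|i _]; first by rewrite prodr_const card_ord.
  by rewrite /E /= ltn_ord.
rewrite [X in _ * X](_ : _ = b ^+ (p + q) ^+ q); last first.
  rewrite (eq_bigr (fun=> b ^+ (p + q))) => [|i _]; first by rewrite prodr_const card_ord.
  by rewrite /E /= ltnNge leq_addr.
rewrite big_split_ord /= [X in X + _](_ : _ = p%:R * a ^+ (p + q)); last first.
  rewrite (eq_bigr (fun=> a ^+ (p + q))) => [|i _]; first by rewrite sumr_const card_ord mulr_natl.
  by rewrite /E /= ltn_ord.
rewrite [X in _ + X](_ : _ = q%:R * b ^+ (p + q)); last first.
  rewrite (eq_bigr (fun=> b ^+ (p + q))) => [|i _]; first by rewrite sumr_const card_ord mulr_natl.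
  by rewrite /E /= ltnNge leq_addr.
rewrite cardT size_enum_ord.
set mean := _ / _; have mean0 : 0 <= mean.
  by rewrite divr_ge0// addr_ge0// mulr_ge0// exprn_ge0.
have -> : a ^+ (p + q) ^+ p * b ^+ (p + q) ^+ q = (a ^+ p * b ^+ q) ^+ (p + q).
  by rewrite exprMn -!exprM (mulnC p) (mulnC q).
have ab0 : 0 <= a ^+ p * b ^+ q by rewrite mulr_ge0// exprn_ge0.
case=> le eqE; split; first by rewrite -(ler_pXn2r N0).
move=> abE; move: eqE; rewrite abE eqxx => /esym /forallP.
have lt0 : (0 < p + q)%N by [].
move=> /(_ (Ordinal lt0)) /= /forallP.
have ltp : (p < p + q)%N by rewrite -[ltnLHS]addn0 ltn_add2l.
move=> /(_ (Ordinal ltp)) /=; rewrite /E /= p0 ltnn eqrXn2// => /eqP //.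
Qed.

Lemma cone_volume k m (D : set 'rV[R]_(k.+1 + m.+1)) x0 w0 :
  compact D -> convex D -> 0 < lebr (fstproj D) -> 0 < w0 -> fstproj D x0 ->
  lebr (sec D x0) = w0 ->
  (forall x, fstproj D x -> exists t, [/\ 0 <= t <= 1, lebr (sec D x) = (1 - t) ^+ m.+1 * w0 &
     forall s, 0 < s < 1 -> s <= 1 - t -> homothet s x0 (fstproj D) x]) ->
  lebr D = w0 * (lebr (fstproj D) / 'C(k.+1 + m.+1, k.+1)%:R).
Proof.
move=> cD vD l0 w00 Lx0 Dx0 H; have cL := compact_fstproj cD; have vL := convex_fstproj vD.
have Dw x : lebr (sec D x) <= w0.
  have [/H[t [/andP[t0 t1] -> _]]|/sec0 ->] := pselect (fstproj D x); last first.
    by rewrite /lebr measure0 ltW.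
  by rewrite ger_pMl// exprn_ile1//; lra.
have profile t : 0 < t < 1 -> level_profile D w0 t = lebr (fstproj D) * (1 - t) ^+ k.+1.
  move=> t01; have /andP[t0 t1] := t01; rewrite mulrC -(lebr_homothet x0 t1 cL).
  congr lebr; apply/seteqP; split => [x Dx|_ [y Ly <-]].
    have wt : 0 < w0 * t ^+ m.+1 by rewrite mulr_gt0// exprn_gt0.
    have [u [/andP[u0 u1] Du Hu]] := H _ (level_fstproj wt Dx).
    apply: Hu => //; move: Dx; rewrite /level /= Du mulrC ler_pM2r//.
    by rewrite ler_pXn2r// nnegrE ?subr_ge0// ltW.
  have t01' : 0 < t <= 1 by rewrite t0 ltW.
  by have := sec_star x0 cD vD t01' Ly; rewrite Dx0 mulrC.
have := integral_fiber_radius_m cD w00.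
rewrite (integral_cone cD l0 m w00 Dw profile) => -[->].
by rewrite mulrC divfK// gt_eqF.
Qed.

Lemma lebr_ae_eq n (A B N : set 'rV[R]_n) : compact A -> compact B -> measurable N ->
  leb N = 0%E -> A `\` N = B `\` N -> lebr A = lebr B.
Proof.
move=> cA cB mN N0 AB.
have E (C : set 'rV[R]_n) : compact C -> leb C = leb (C `\` N).
  move=> cC; have mC := compact_measurable_row cC.
  rewrite measureD//=; last exact: leb_compact_fin.
  rewrite (_ : leb (C `&` N) = 0%E) ?sube0//.
  apply/eqP; rewrite eq_le measure_ge0 andbT -N0.
  by apply: le_measure; rewrite ?inE//; exact: measurableI.
by rewrite /lebr E// AB -E.
Qed.

Lemma ae_eq_of_integral d (T : measurableType d) (mu : {measure set T -> \bar R}) (f g : T -> R) :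
  measurable_fun setT f -> measurable_fun setT g -> (forall x, 0 <= f x <= g x) ->
  (\int[mu]_x (g x)%:E <= \int[mu]_x (f x)%:E)%E -> (\int[mu]_x (f x)%:E < +oo)%E ->
  exists N, [/\ measurable N, mu N = 0%E & forall x, ~ N x -> f x = g x].
Proof.
move=> mf mg fg gf fy.
have f0 x : 0 <= f x by case/andP: (fg x).
have le_fg x : f x <= g x by case/andP: (fg x).
have mgf : measurable_fun setT (fun x => g x - f x) by exact: measurable_funB.
have gfE : (\int[mu]_x (g x)%:E = \int[mu]_x (f x)%:E + \int[mu]_x (g x - f x)%:E)%E.
  rewrite -ge0_integralD//.
  - by apply: eq_integral => x _; rewrite -EFinD subrKC.
  - by move=> x _; rewrite lee_fin.
  - exact/measurable_EFinP.
  - by move=> x _; rewrite lee_fin subr_ge0.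
  - exact/measurable_EFinP.
have d0 : (\int[mu]_x `|(g x - f x)%:E| = 0)%E.
  transitivity (\int[mu]_x (g x - f x)%:E)%E.
    by apply: eq_integral => x _; rewrite /= ger0_norm// subr_ge0.
  apply/eqP; rewrite eq_le; apply/andP; split; last first.
    by apply: integral_ge0 => x _; rewrite lee_fin subr_ge0.
  have ffin : (\int[mu]_x (f x)%:E)%E \is a fin_num.
    by rewrite ge0_fin_numE// integral_ge0// => x _; rewrite lee_fin.
  by move: gf; rewrite gfE -[leRHS]adde0 leeD2lE.
have mgfE : measurable_fun setT (fun x => (g x - f x)%:E) by exact/measurable_EFinP.
have [N [mN N0 sN]] := (ae_eq_integral_abs mu measurableT mgfE).1 d0.
exists N; split => // x Nx; apply/esym/eqP; rewrite -subr_eq0; apply/eqP.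
apply: contrapT => H; apply: Nx; apply: sN => /= /(_ Logic.I) [].
exact: H.
Qed.

End Estimates.

(** * The inequality in coordinates *)

Lemma eq_continuous (T U : topologicalType) (f g : T -> U) :
  f =1 g -> continuous f -> continuous g.
Proof. by move=> /funext ->. Qed.

Section Product.
Variables (R : realType) (k p q : nat).
Variable C : set 'rV[R]_(k.+1 + (p.+1 + q.+1)).

(* [C] is [K] read in [G + P + Q]; [projl] and [projr] are its shadows on [E = G + P]
   and [H = G + Q]. *)
Definition projl : set 'rV[R]_(k.+1 + p.+1) :=
  [set w | exists b, C (row_mx (lsubmx w) (row_mx (rsubmx w) b))].

Definition projr : set 'rV[R]_(k.+1 + q.+1) :=
  [set w | exists a, C (row_mx (lsubmx w) (row_mx a (rsubmx w)))].

Lemma sec_projl x a : sec projl x a <-> exists b, C (row_mx x (row_mx a b)).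
Proof. by rewrite /sec /projl /= row_mxKl row_mxKr. Qed.

Lemma sec_projr x b : sec projr x b <-> exists a, C (row_mx x (row_mx a b)).
Proof. by rewrite /sec /projr /= row_mxKl row_mxKr. Qed.

Lemma fstproj_projl : fstproj projl = fstproj C.
Proof.
apply/seteqP; split => [x [a /sec_projl [b Cx]]|x [y Cx]]; first by exists (row_mx a b).
by exists (lsubmx y); apply/sec_projl; exists (rsubmx y); rewrite hsubmxK.
Qed.

Lemma fstproj_projr : fstproj projr = fstproj C.
Proof.
apply/seteqP; split => [x [b /sec_projr [a Cx]]|x [y Cx]]; first by exists (row_mx a b).
by exists (rsubmx y); apply/sec_projr; exists (lsubmx y); rewrite hsubmxK.
Qed.

Lemma sec_prodset x : sec C x `<=` prodset (sec projl x) (sec projr x).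
Proof.
move=> y Cy; split; [apply/sec_projl; exists (rsubmx y)|apply/sec_projr; exists (lsubmx y)];
  by rewrite hsubmxK.
Qed.

Lemma convex_projl : convex C -> convex projl.
Proof.
move=> vC s x y s01 [b Cb] [b' Cb']; exists (s *: b + (1 - s) *: b').
have := vC s _ _ s01 Cb Cb'.
by rewrite !scale_row_mx !add_row_mx !linearD !linearZ.
Qed.

Lemma convex_projr : convex C -> convex projr.
Proof.
move=> vC s x y s01 [b Cb] [b' Cb']; exists (s *: b + (1 - s) *: b').
have := vC s _ _ s01 Cb Cb'.
by rewrite !scale_row_mx !add_row_mx !linearD !linearZ.
Qed.

Hypothesis cC : compact C.

Lemma compact_projl : compact projl.
Proof.
rewrite (_ : projl = (fun z => row_mx (lsubmx z) (lsubmx (rsubmx z))) @` C).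
  apply: continuous_compact => //; apply: continuous_subspaceT; apply: row_continuousP => i.
  have [j ij|j ij] := fintype.splitP i.
    apply: (eq_continuous (f := fun z : 'rV[R]_(k.+1 + (p.+1 + q.+1)) => z 0 (lshift _ j))).
      by move=> z; rewrite (_ : i = lshift _ j) ?row_mxEl ?mxE//; exact/val_inj.
    exact: continuous_entry.
  apply: (eq_continuous (f := fun z : 'rV[R]_(k.+1 + (p.+1 + q.+1)) => z 0 (rshift _ (lshift _ j)))).
    by move=> z; rewrite (_ : i = rshift _ j) ?row_mxEr ?mxE//; exact/val_inj.
  exact: continuous_entry.
apply/seteqP; split => [w [b Cb]|_ [z Cz <-]].
  by exists (row_mx (lsubmx w) (row_mx (rsubmx w) b)) => //; rewrite row_mxKr !row_mxKl hsubmxK.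
by exists (rsubmx (rsubmx z)); rewrite row_mxKl row_mxKr !hsubmxK.
Qed.

Lemma compact_projr : compact projr.
Proof.
rewrite (_ : projr = (fun z => row_mx (lsubmx z) (rsubmx (rsubmx z))) @` C).
  apply: continuous_compact => //; apply: continuous_subspaceT; apply: row_continuousP => i.
  have [j ij|j ij] := fintype.splitP i.
    apply: (eq_continuous (f := fun z : 'rV[R]_(k.+1 + (p.+1 + q.+1)) => z 0 (lshift _ j))).
      by move=> z; rewrite (_ : i = lshift _ j) ?row_mxEl ?mxE//; exact/val_inj.
    exact: continuous_entry.
  apply: (eq_continuous (f := fun z : 'rV[R]_(k.+1 + (p.+1 + q.+1)) => z 0 (rshift _ (rshift _ j)))).
    by move=> z; rewrite (_ : i = rshift _ j) ?row_mxEr ?mxE//; exact/val_inj.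
  exact: continuous_entry.
apply/seteqP; split => [w [b Cb]|_ [z Cz <-]].
  by exists (row_mx (lsubmx w) (row_mx b (rsubmx w))) => //; rewrite row_mxKl !row_mxKr hsubmxK.
by exists (lsubmx (rsubmx z)); rewrite row_mxKl row_mxKr !hsubmxK.
Qed.

Let F x := lebr (sec projl x).
Let H x := lebr (sec projr x).
Let W x := lebr (sec C x).

Lemma lebr_sec_le x : W x <= F x * H x.
Proof.
rewrite -lebr_prodset; try (apply: compact_sec; [exact: compact_projl || exact: compact_projr]).
apply: le_lebr; [exact: compact_sec| |exact: sec_prodset].
by apply: compact_prodset; apply: compact_sec; [exact: compact_projl|exact: compact_projr].
Qed.

Lemma lebr_le_fstproj : exists B : R, lebr C <= lebr (fstproj C) * B.
Proof.
pose S : set 'rV[R]_(p.+1 + q.+1) := rsubmx @` C.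
have cS : compact S.
  apply: continuous_compact => //; apply: continuous_subspaceT.
  exact: (@linear_row_continuous _ _ _ (rsubmx : {linear 'rV[R]_(k.+1 + (p.+1 + q.+1)) -> 'rV[R]_(p.+1 + q.+1)})).
exists (lebr S); rewrite -lebr_prodset//; last exact: compact_fstproj.
apply: le_lebr => //; first by apply: compact_prodset => //; exact: compact_fstproj.
move=> z Cz; split; last by exists z.
by exists (rsubmx z); rewrite hsubmxK.
Qed.

Hypothesis C0 : 0 < lebr C.

Lemma lebr_fstproj_gt0 : 0 < lebr (fstproj C).
Proof.
have [B CB] := lebr_le_fstproj; rewrite lt_neqAle lebr_ge0 andbT eq_sym; apply/eqP => L0.
by move: CB; rewrite L0 mul0r leNgt C0.
Qed.

Lemma lebr_section_factor (G : 'rV[R]_k.+1 -> R) m (D : set 'rV[R]_(k.+1 + m.+1)) B :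
  compact D -> measurable_fun setT G -> (forall x, 0 <= G x <= B) ->
  (forall x, W x <= lebr (sec D x) * G x) -> 0 < lebr D.
Proof.
move=> cD mG GB WG; rewrite lt_neqAle lebr_ge0 andbT eq_sym; apply/eqP => D0.
have B0 : 0 <= B by case/andP: (GB 0) => /le_trans; apply.
suff : ((lebr C)%:E <= 0)%E by rewrite lee_fin leNgt C0.
have := @lebr_row_mx R _ _ C cC.
rewrite -[X in (_ <= X)%E](_ : (lebr D * B)%:E = 0%E); last by rewrite D0 mul0r.
rewrite EFinM (lebr_row_mx cD) -ge0_integralZr//; last 2 first.
- by apply/measurable_EFinP; exact: measurable_lebr_sec.
- by move=> x _; rewrite lee_fin lebr_ge0.
move=> ->; apply: ge0_le_integral => //.
- by move=> x _; rewrite lee_fin lebr_ge0.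
- by apply/measurable_EFinP; exact: measurable_lebr_sec.
- by apply: emeasurable_funM => //; apply/measurable_EFinP; exact: measurable_lebr_sec.
- move=> x _; rewrite -EFinM lee_fin; apply: le_trans (WG x) _.
  by apply: ler_wpM2l; [exact: lebr_ge0|case/andP: (GB x)].
Qed.

Lemma C_nonempty : C !=set0. Proof. exact: lebr_nonempty. Qed.

Lemma projl_nonempty : projl !=set0.
Proof.
case: C_nonempty => z Cz; exists (row_mx (lsubmx z) (lsubmx (rsubmx z))).
by exists (rsubmx (rsubmx z)); rewrite row_mxKl row_mxKr !hsubmxK.
Qed.

Lemma projr_nonempty : projr !=set0.
Proof.
case: C_nonempty => z Cz; exists (row_mx (lsubmx z) (rsubmx (rsubmx z))).
by exists (lsubmx (rsubmx z)); rewrite row_mxKl row_mxKr !hsubmxK.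
Qed.

Lemma lebr_projl_gt0 : 0 < lebr projl.
Proof.
have [x0 _ maxx] := lebr_sec_max compact_projr projr_nonempty.
apply: (@lebr_section_factor H p projl (H x0)).
- exact: compact_projl.
- by apply: measurable_lebr_sec; exact: compact_projr.
- by move=> x; rewrite lebr_ge0 maxx.
- exact: lebr_sec_le.
Qed.

Lemma lebr_projr_gt0 : 0 < lebr projr.
Proof.
have [x0 _ maxx] := lebr_sec_max compact_projl projl_nonempty.
apply: (@lebr_section_factor F q projr (F x0)).
- exact: compact_projr.
- by apply: measurable_lebr_sec; exact: compact_projl.
- by move=> x; rewrite lebr_ge0 maxx.
- by move=> x; rewrite mulrC; exact: lebr_sec_le.
Qed.

End Product.

Section Inequality.
Variables (R : realType) (k p q : nat).
Variable C : set 'rV[R]_(k.+1 + (p.+1 + q.+1)).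
Hypotheses (cC : compact C) (vC : convex C) (C0 : 0 < lebr C).

Local Notation N := (p.+1 + q.+1)%N.
Let l := lebr (fstproj C).
Let bA : R := 'C(k.+1 + p.+1, k.+1)%:R.
Let bB : R := 'C(k.+1 + q.+1, k.+1)%:R.
Let bC : R := 'C(k.+1 + N, k.+1)%:R.
Let cA := lebr (projl C) * bA / l.
Let cB := lebr (projr C) * bB / l.
Let f := fiber_radius (projl C) cA.
Let h := fiber_radius (projr C) cB.
Let w x := lebr (sec C x) / (cA * cB).
Let T x := (p.+1%:R * f x ^+ N + q.+1%:R * h x ^+ N) / N%:R.

Let l0 : 0 < l := lebr_fstproj_gt0 cC C0.
Let A0 : 0 < lebr (projl C) := lebr_projl_gt0 cC C0.
Let B0 : 0 < lebr (projr C) := lebr_projr_gt0 cC C0.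

Let bin_pos a : 0 < 'C(k.+1 + a, k.+1)%:R :> R.
Proof. by rewrite ltr0n bin_gt0 leq_addr. Qed.

Let bA0 : 0 < bA. Proof. exact: bin_pos. Qed.
Let bB0 : 0 < bB. Proof. exact: bin_pos. Qed.
Let bC0 : 0 < bC. Proof. exact: bin_pos. Qed.
Let cA0 : 0 < cA. Proof. by rewrite divr_gt0// mulr_gt0. Qed.
Let cB0 : 0 < cB. Proof. by rewrite divr_gt0// mulr_gt0. Qed.
Let cAB0 : 0 < cA * cB. Proof. by rewrite mulr_gt0. Qed.
Let N0 : 0 < N%:R :> R. Proof. by rewrite ltr0n. Qed.

Let mf : measurable_fun setT f.
Proof. by apply: measurable_fiber_radius; exact: compact_projl. Qed.
Let mh : measurable_fun setT h.
Proof. by apply: measurable_fiber_radius; exact: compact_projr. Qed.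
Let mw : measurable_fun setT w.
Proof. by apply: measurable_funM => //; exact: measurable_lebr_sec. Qed.
Let mT : measurable_fun setT T.
Proof.
apply: measurable_funM => //; apply: measurable_funD; apply: measurable_funM => //;
  exact: measurable_funX.
Qed.

Let f0 x : 0 <= f x. Proof. exact: fiber_radius_ge0. Qed.
Let h0 x : 0 <= h x. Proof. exact: fiber_radius_ge0. Qed.

Let wfh x : w x <= f x ^+ p.+1 * h x ^+ q.+1.
Proof.
rewrite !fiber_radiusE// mulrACA -invfM ler_pM2r ?invr_gt0//.
exact: lebr_sec_le.
Qed.

Let wT x : 0 <= w x <= T x.
Proof.
rewrite divr_ge0 ?lebr_ge0 ?(ltW cAB0)//=; apply: le_trans (wfh x) _.
by have [] := @weighted_AGM R p.+1 q.+1 (f x) (h x).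
Qed.

Let intw : (\int[leb]_x (w x)%:E)%E = (lebr C / (cA * cB))%:E.
Proof.
under eq_integral do rewrite EFinM.
rewrite ge0_integralZr//; last 3 first.
- by apply/measurable_EFinP; exact: measurable_lebr_sec.
- by move=> x _; rewrite lee_fin lebr_ge0.
- by rewrite lee_fin invr_ge0 ltW.
by rewrite -lebr_row_mx.
Qed.

Let berwaldA := @berwald R k p (projl C) (compact_projl cC) (convex_projl vC).
Let berwaldB := @berwald R k q (projr C) (compact_projr cC) (convex_projr vC).

Let intf : (\int[leb]_x (f x ^+ N)%:E <= (l / bC)%:E)%E /\
  ((\int[leb]_x (f x ^+ N)%:E)%E = (l / bC)%:E ->
   forall t, 0 < t < 1 -> level_profile (projl C) cA t = l * (1 - t) ^+ k.+1).
Proof.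
have := berwaldA; rewrite fstproj_projl => /(_ l0 cA q cA0); apply.
rewrite -/l -/bA /cA; field; rewrite ?gt_eqF//.
Qed.

Let inth : (\int[leb]_x (h x ^+ N)%:E <= (l / bC)%:E)%E /\
  ((\int[leb]_x (h x ^+ N)%:E)%E = (l / bC)%:E ->
   forall t, 0 < t < 1 -> level_profile (projr C) cB t = l * (1 - t) ^+ k.+1).
Proof.
have := berwaldB; rewrite fstproj_projr => /(_ l0 cB p cB0); rewrite (addnC q.+1); apply.
rewrite -/l -/bB /cB; field; rewrite ?gt_eqF//.
Qed.

Let intT : (\int[leb]_x (T x)%:E)%E =
  ((p.+1%:R / N%:R)%:E * \int[leb]_x (f x ^+ N)%:E + (q.+1%:R / N%:R)%:E * \int[leb]_x (h x ^+ N)%:E)%E.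
Proof.
have mX (g : 'rV[R]_k.+1 -> R) : measurable_fun setT g -> measurable_fun setT (fun x => (g x ^+ N)%:E).
  by move=> mg; apply/measurable_EFinP; exact: measurable_funX.
have [mfX mhX] := (mX _ mf, mX _ mh).
have c0 (c : nat) : 0 <= c%:R / N%:R :> R by rewrite divr_ge0.
rewrite -!ge0_integralZl//; try by move=> *; rewrite lee_fin ?exprn_ge0.
rewrite -ge0_integralD//; try by move=> *; rewrite -EFinM lee_fin mulr_ge0// exprn_ge0.
- apply: eq_integral => x _; rewrite -!EFinM -EFinD /T; congr (_%:E).
  by rewrite mulrDl; congr (_ + _); rewrite mulrAC.
- exact: emeasurable_funM.
- exact: emeasurable_funM.
Qed.

Let intT_le : (\int[leb]_x (T x)%:E <= (l / bC)%:E)%E.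
Proof.
rewrite intT; have [fle _] := intf; have [hle _] := inth.
have pq1 : p.+1%:R / N%:R + q.+1%:R / N%:R = 1 :> R by rewrite -mulrDl -natrD divff// gt_eqF.
have c0 (c : nat) : (0 <= (c%:R / N%:R : R)%:E)%E by rewrite lee_fin divr_ge0.
have -> : (l / bC)%:E = ((p.+1%:R / N%:R)%:E * (l / bC)%:E + (q.+1%:R / N%:R)%:E * (l / bC)%:E)%E.
  by rewrite -!EFinM -EFinD -mulrDl pq1 mul1r.
exact: leeD (lee_wpmul2l (c0 p.+1) fle) (lee_wpmul2l (c0 q.+1) hle).
Qed.

Lemma coord_inequality :
  l * lebr C <= bA * bB / bC * lebr (projl C) * lebr (projr C).
Proof.
have : (\int[leb]_x (w x)%:E <= (l / bC)%:E)%E.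
  apply: le_trans intT_le; apply: ge0_le_integral => //.
  - by move=> x _; rewrite lee_fin; case/andP: (wT x).
  - exact/measurable_EFinP.
  - exact/measurable_EFinP.
  - by move=> x _; rewrite lee_fin; case/andP: (wT x).
rewrite intw lee_fin ler_pdivrMr// => H.
apply: le_trans (ler_wpM2l (ltW l0) H) _; rewrite le_eqVlt; apply/orP; left; apply/eqP.
by rewrite /cA /cB; field; rewrite !gt_eqF.
Qed.

Lemma coord_equality_profiles :
  l * lebr C = bA * bB / bC * lebr (projl C) * lebr (projr C) ->
  exists a b : R, [/\ 0 < a, 0 < b,
    forall t, 0 < t < 1 -> level_profile (projl C) a t = l * (1 - t) ^+ k.+1,
    forall t, 0 < t < 1 -> level_profile (projr C) b t = l * (1 - t) ^+ k.+1 &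
    forall t, 0 < t < 1 -> level_profile C (a * b) t = l * (1 - t) ^+ k.+1].
Proof.
move=> eqC; have l_neq0 : l != 0 by rewrite gt_eqF.
have intwE : (\int[leb]_x (w x)%:E)%E = (l / bC)%:E.
  rewrite intw; congr (_%:E); apply: (mulfI l_neq0).
  by rewrite mulrA eqC /cA /cB; field; rewrite !gt_eqF.
have [Z [mZ Z0 wTZ]] : exists Z, [/\ measurable Z, leb Z = 0%E & forall x, ~ Z x -> w x = T x].
  by apply: ae_eq_of_integral => //; rewrite intwE// ltry.
have fhZ x : ~ Z x -> f x = h x.
  move=> /wTZ wTx; have [le eq] := @weighted_AGM R p.+1 q.+1 (f x) (h x) isT isT (f0 x) (h0 x).
  by apply: eq; apply/eqP; rewrite eq_le le /= -/(T x) -wTx wfh.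
have intTE : (\int[leb]_x (T x)%:E)%E = (l / bC)%:E.
  apply/eqP; rewrite eq_le intT_le /= -intwE; apply: ge0_le_integral => //.
  - by move=> x _; rewrite lee_fin; case/andP: (wT x).
  - exact/measurable_EFinP.
  - exact/measurable_EFinP.
  - by move=> x _; rewrite lee_fin; case/andP: (wT x).
have [fle fprof] := intf; have [hle hprof] := inth.
have fin0 (g : 'rV[R]_k.+1 -> R) : (forall x, 0 <= g x) -> (\int[leb]_x (g x ^+ N)%:E <= (l / bC)%:E)%E ->
    exists2 r : R, (\int[leb]_x (g x ^+ N)%:E)%E = r%:E & r <= l / bC.
  move=> g0 gle; have gf : (\int[leb]_x (g x ^+ N)%:E)%E \is a fin_num.
    rewrite ge0_fin_numE; first exact: le_lt_trans gle (ltry _).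
    by apply: integral_ge0 => x _; rewrite lee_fin exprn_ge0.
  by exists (fine (\int[leb]_x (g x ^+ N)%:E)); rewrite -?lee_fin fineK.
have [rf rfE rfle] := fin0 f f0 fle; have [rh rhE rhle] := fin0 h h0 hle.
have : p.+1%:R / N%:R * rf + q.+1%:R / N%:R * rh = l / bC.
  by apply: EFin_inj; rewrite -intTE intT rfE rhE.
have pq1 : p.+1%:R / N%:R + q.+1%:R / N%:R = 1 :> R by rewrite -mulrDl -natrD divff// gt_eqF.
have pN0 : 0 < p.+1%:R / N%:R :> R by rewrite divr_gt0.
have qN0 : 0 < q.+1%:R / N%:R :> R by rewrite divr_gt0.
move: (p.+1%:R / N%:R) (q.+1%:R / N%:R) pq1 pN0 qN0 => u v uv u0 v0 avg.
have [rfl rhl] : rf = l / bC /\ rh = l / bC.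
  move: avg rfle rhle; set z := l / bC; have -> : u = 1 - v by rewrite -uv addrK.
  by move=> avg a b; split; nra.
have {}fprof := fprof (etrans rfE (congr1 EFin rfl)).
have {}hprof := hprof (etrans rhE (congr1 EFin rhl)).
exists cA, cB; split; [exact: cA0|exact: cB0|exact: fprof|exact: hprof|move=> t t01].
rewrite -(fprof _ t01); have /andP[t0 t1] := t01.
have tN0 c n : 0 < c -> 0 < c * t ^+ n :> R by move=> c0; rewrite mulr_gt0// exprn_gt0.
apply: (lebr_ae_eq (N := Z)).
- by apply: compact_leb_sec => //; exact: tN0.
- by apply: compact_leb_sec; [exact: compact_projl|exact: tN0].
- exact: mZ.
- exact: Z0.
have E x : ~ Z x -> level C (cA * cB * t ^+ N) x <-> level (projl C) (cA * t ^+ p.+1) x.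
  move=> Zx; rewrite /level /= -(le_fiber_radius (projl C) x cA0 (ltW t0)) -/(f x).
  rewrite mulrC -ler_pdivlMr// -/(w x) (wTZ _ Zx) /T -(fhZ _ Zx) -mulrDl -natrD mulrAC divff ?gt_eqF//.
  by rewrite mul1r ler_pXn2r// ?nnegrE// ltW.
by apply/seteqP; split => x [Cx Zx]; split => //; apply/(E _ Zx).
Qed.

End Inequality.

(** * The equality case in coordinates *)

Section Rays.
Variable R : realType.

Definition join n (S : set 'rV[R]_n) (w : 'rV[R]_n) : set 'rV[R]_n :=
  [set z | z = w \/ exists s t, [/\ S s, 0 <= t <= 1 & z = (1 - t) *: s + t *: w]].

Lemma ray_end n (L : set 'rV[R]_n) x v r0 : compact L -> v != 0 -> 0 <= r0 -> L (x + r0 *: v) ->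
  exists r1, [/\ r0 <= r1, L (x + r1 *: v) & forall r, 0 <= r -> L (x + r *: v) -> r <= r1].
Proof.
move=> cL v0 r00 Lr0; have [M M0 LM] := compact_ball cL.
have nv0 : 0 < `|v| by rewrite normr_gt0.
pose g (r : R) := x + r *: v.
have cg : continuous g.
  apply: row_continuousP => i; apply: (eq_continuous (f := fun r : R => x 0 i + r * v 0 i)).
    by move=> r; rewrite !mxE.
  by move=> r; apply: cvgD; [exact: cvg_cst|apply: cvgM; [exact: cvg_id|exact: cvg_cst]].
pose B := (M + `|x|) / `|v|.
have LB r : 0 <= r -> L (g r) -> r <= B.
  move=> r0' /LM gM; rewrite ler_pdivlMr// -(ger0_norm r0') -normrZ.
  rewrite (_ : r *: v = g r - x); last by rewrite /g addrC addKr.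
  by apply: le_trans (ler_normB _ _) _; rewrite lerD2r.
pose T := `[0, B]%classic `&` g @^-1` L.
have cT : compact T.
  apply: (subclosed_compact _ (@segment_compact R 0 B)); last by move=> r [].
  apply: closedI; first exact: interval_closed.
  by apply: closed_comp; [move=> r _; exact: cg|exact: compact_closed_row].
have T0 : T !=set0 by exists r0; split => //=; rewrite in_itv /= r00 LB.
have [r1 r1T max] := compact_EVT_max T0 cT (continuous_subspaceT (fun x : R => @cvg_id _ (nbhs x))).
move: r1T; rewrite inE => -[_ Lr1]; exists r1; split => //.
  by apply: max; rewrite inE; split => //=; rewrite in_itv /= r00 LB.
by move=> r r0' Lr; apply: max; rewrite inE; split => //=; rewrite in_itv /= r0' LB.
Qed.

Lemma compact_translate_eq0 n (S : set 'rV[R]_n) d : compact S -> S !=set0 ->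
  (forall x, S x -> S (x + d)) -> (forall x, S x -> S (x - d)) -> d = 0.
Proof.
move=> cS S0 SD SB; apply/rowP => i; rewrite mxE.
have [c cin max] := compact_EVT_max S0 cS (continuous_subspaceT (@continuous_entry R n i)).
move: cin; rewrite inE => Sc.
have := max (c + d); rewrite inE => /(_ (SD _ Sc)); rewrite mxE => d0.
have := max (c - d); rewrite inE => /(_ (SB _ Sc)); rewrite !mxE => d0'.
by lra.
Qed.

Lemma convex_sec k m (D : set 'rV[R]_(k + m)) x : convex D -> convex (sec D x).
Proof.
move=> vD s a b s01 Da Db; have := vD s _ _ s01 Da Db.
by rewrite /sec /= !scale_row_mx add_row_mx -scalerDl subrKC scale1r.
Qed.

Section Cone.
Variables (k m : nat) (D : set 'rV[R]_(k.+1 + m.+1)) (x0 : 'rV[R]_k.+1).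
Hypotheses (cD : compact D) (vD : convex D).
Let w0 := lebr (sec D x0).
Hypothesis w00 : 0 < w0.
Hypothesis apex : forall s z, 0 < s < 1 -> w0 * s ^+ m.+1 <= lebr (sec D z) -> homothet s x0 (fstproj D) z.

Section Endpoint.
Variables (v : 'rV[R]_k.+1) (r1 : R).
Hypotheses (v0 : v != 0) (r10 : 0 < r1).
Hypothesis max_r1 : forall r, 0 <= r -> fstproj D (x0 + r *: v) -> r <= r1.

Let homothet_max s t : 0 < s < 1 -> 0 <= t -> homothet s x0 (fstproj D) (x0 + t *: v) ->
  t <= (1 - s) * r1.
Proof.
move=> /andP[s0 s1] t0 [x' Lx' E]; have s1' : 0 < 1 - s by rewrite subr_gt0.
rewrite mulrC -ler_pdivrMr//; apply: max_r1; first by rewrite divr_ge0 ?(ltW s1').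
rewrite (_ : x0 + _ = x')//; apply/rowP => i; have := congr1 (fun z : 'rV_k.+1 => z 0 i) E.
rewrite !mxE => E'; apply: (mulfI (lt0r_neq0 s1')); rewrite mulrDr mulrA mulrCA divff ?gt_eqF// mulr1.
by move: E'; lra.
Qed.

Lemma lebr_sec_ray_le t : 0 < t < 1 ->
  lebr (sec D (x0 + (t * r1) *: v)) <= w0 * (1 - t) ^+ m.+1.
Proof.
move=> /andP[t0 t1]; rewrite leNgt; apply/negP => W.
have t1' : 0 < 1 - t by rewrite subr_gt0.
have : (1 - t) ^+ m.+1 < lebr (sec D (x0 + (t * r1) *: v)) / w0 by rewrite ltr_pdivlMr// mulrC.
set y := lebr _ / w0 => ty.
pose z := Num.min (nroot m.+1 y) (1 - t / 2).
have y0 : 0 <= y by apply: le_trans (ltW ty); rewrite exprn_ge0 ?(ltW t1').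
have ry : 1 - t < nroot m.+1 y.
  by rewrite -(ltr_pXn2r (ltn0Sn m)) ?nnegrE ?nroot_ge0 ?(ltW t1')// nrootK.
have zt : 1 - t < z by rewrite lt_min ry /=; lra.
have z1 : z < 1 by rewrite gt_min; apply/orP; right; lra.
have z0 : 0 < z by exact: lt_trans zt.
have zy : w0 * z ^+ m.+1 <= lebr (sec D (x0 + (t * r1) *: v)).
  rewrite mulrC -ler_pdivlMr// -/y -[leRHS](nrootK m y0); apply: lerXn2r.
  - by rewrite nnegrE (ltW z0).
  - by rewrite nnegrE nroot_ge0.
  - by rewrite ge_min lexx.
have /homothet_max : homothet z x0 (fstproj D) (x0 + (t * r1) *: v) by apply: apex => //; rewrite z0.
by rewrite z0 z1 mulr_ge0 ?(ltW t0) ?(ltW r10)// => /(_ isT isT); rewrite ler_pM2r//; lra.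
Qed.

Lemma sec_ray t c : 0 < t < 1 -> D (row_mx (x0 + r1 *: v) c) ->
  sec D (x0 + (t * r1) *: v) = homothet t c (sec D x0).
Proof.
move=> t01 Dc; have /andP[t0 t1] := t01; have t1' : 0 < 1 - t by rewrite subr_gt0.
have hD : homothet t c (sec D x0) `<=` sec D (x0 + (t * r1) *: v).
  move=> _ [d Dd <-]; rewrite /sec /=.
  have -> : row_mx (x0 + (t * r1) *: v) (t *: c + (1 - t) *: d) =
      t *: row_mx (x0 + r1 *: v) c + (1 - t) *: row_mx x0 d.
    by rewrite !scale_row_mx add_row_mx; congr row_mx; apply/rowP => i; rewrite !mxE; ring.
  by apply: vD => //; rewrite (ltW t0) (ltW t1).
have ch : compact (homothet t c (sec D x0)) by apply: compact_homothet; exact: compact_sec.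
have hE : lebr (homothet t c (sec D x0)) = (1 - t) ^+ m.+1 * w0.
  by rewrite lebr_homothet//; exact: compact_sec.
apply/esym; apply: full_measure_eq => //.
- exact: compact_sec.
- exact: convex_sec.
- apply: (@lt_le_trans _ _ (lebr (homothet t c (sec D x0)))).
    by rewrite hE mulr_gt0// exprn_gt0.
  by apply: le_lebr => //; exact: compact_sec.
- by rewrite hE [leRHS]mulrC; exact: lebr_sec_ray_le.
Qed.

Lemma sec_ray_end c c' : D (row_mx (x0 + r1 *: v) c) -> D (row_mx (x0 + r1 *: v) c') -> c' = c.
Proof.
move=> Dc Dc'; have h01 : 0 < (2^-1 : R) < 1 by apply/andP; split; lra.
have E := etrans (esym (sec_ray h01 Dc)) (sec_ray h01 Dc').
apply/eqP; rewrite -subr_eq0; apply/eqP.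
have tr a b : homothet 2^-1 a (sec D x0) = homothet 2^-1 b (sec D x0) ->
    forall x, sec D x0 x -> sec D x0 (x + (a - b)).
  move=> ab x Dx; have : homothet 2^-1 a (sec D x0) (2^-1 *: a + (1 - 2^-1) *: x) by exists x.
  rewrite ab => -[x' Dx' E']; rewrite (_ : x + _ = x')//; apply/rowP => i.
  by have := congr1 (fun z : 'rV_m.+1 => z 0 i) E'; rewrite !mxE; lra.
apply: (@compact_translate_eq0 _ (sec D x0)).
- exact: compact_sec.
- by apply: lebr_nonempty; exact: w00.
- by apply: tr; exact/esym.
- by move=> x Dx; rewrite opprB; apply: tr.
Qed.

End Endpoint.

Lemma cone_along_ray v : exists w,
  [set z : 'rV[R]_(k.+1 + m.+1) | D z /\ exists2 r : R, 0 <= r & lsubmx z = x0 + r *: v] =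
  join [set row_mx x0 d | d in sec D x0] w.
Proof.
have D0 : sec D x0 !=set0 by exact: lebr_nonempty.
have [[r [r0 Lr rv]]|H] := pselect (exists r, [/\ 0 <= r, fstproj D (x0 + r *: v) & r *: v <> 0]).
  have v0 : v != 0 by apply/eqP => v0; apply: rv; rewrite v0 scaler0.
  have [r1 [rr1 [c Dc] max]] := ray_end (compact_fstproj cD) v0 r0 Lr.
  have r10 : 0 < r1.
    by apply: lt_le_trans rr1; rewrite lt_neqAle r0 andbT eq_sym; apply/eqP => r0'; apply: rv; rewrite r0' scale0r.
  exists (row_mx (x0 + r1 *: v) c); apply/seteqP; split.
    move=> z [Dz [s s0 zs]].
    have Ds : D (row_mx (x0 + s *: v) (rsubmx z)) by rewrite -zs hsubmxK.
    have : s <= r1 by apply: max => //; exists (rsubmx z).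
    rewrite le_eqVlt => /predU1P[sr1|sr1].
      left; rewrite -(hsubmxK z) zs sr1; congr row_mx.
      by apply: (sec_ray_end _ max Dc) => //; rewrite -sr1.
    move: s0; rewrite le_eqVlt => /predU1P[s0|s0].
      right; exists z, 0; rewrite subr0 scale1r scale0r addr0 lexx ler01; split => //.
      move: Ds zs; rewrite -s0 scale0r addr0 => Ds zs.
      by exists (rsubmx z) => //; rewrite -zs hsubmxK.
    have s1 : 0 < s / r1 < 1 by rewrite divr_gt0//= ltr_pdivrMr// mul1r.
    have sE : s = s / r1 * r1 by rewrite mulfVK ?gt_eqF.
    have : sec D (x0 + (s / r1 * r1) *: v) (rsubmx z) by rewrite -sE.
    rewrite (sec_ray _ max s1 Dc)// => -[d Dd zd].
    right; exists (row_mx x0 d), (s / r1); split; first by exists d.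
      by have /andP[a b] := s1; rewrite (ltW a) (ltW b).
    rewrite -{1}(hsubmxK z) -zd zs !scale_row_mx add_row_mx {1}sE.
    by congr row_mx; apply/rowP => i; rewrite !mxE; ring.
  move=> z [->|[_ [t [[d Dd <-] /andP[t0 t1] ->]]]].
    by split => //; exists r1; [exact: ltW|rewrite row_mxKl].
  split.
    rewrite addrC; apply: vD => //; first by rewrite t0.
  exists (t * r1); first by rewrite mulr_ge0// ltW.
  rewrite !scale_row_mx add_row_mx row_mxKl; apply/rowP => i; rewrite !mxE; ring.
have rv0 r : 0 <= r -> fstproj D (x0 + r *: v) -> r *: v = 0.
  by move=> r0 Lr; apply: contrapT => rv; apply: H; exists r.
have [d0 Dd0] := D0; exists (row_mx x0 d0); apply/seteqP; split.
  move=> z [Dz [r r0 zr]].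
  have Dr : D (row_mx (x0 + r *: v) (rsubmx z)) by rewrite -zr hsubmxK.
  have E : r *: v = 0 by apply: rv0 => //; exists (rsubmx z).
  rewrite E addr0 in Dr zr; right; exists z, 0; rewrite subr0 scale1r scale0r addr0 lexx ler01; split => //.
  by exists (rsubmx z) => //; rewrite -zr hsubmxK.
have S z : D z -> lsubmx z = x0 -> D z /\ exists2 r : R, 0 <= r & lsubmx z = x0 + r *: v.
  by move=> Dz zx; split => //; exists 0; rewrite ?scale0r ?addr0.
move=> z [->|[_ [t [[d Dd <-] /andP[t0 t1] ->]]]]; apply: S; rewrite ?row_mxKl//.
  by rewrite addrC; apply: vD => //; rewrite t0.
rewrite !scale_row_mx add_row_mx row_mxKl; apply/rowP => i; rewrite !mxE; ring.
Qed.

End Cone.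
End Rays.

Section Equality.
Variables (R : realType) (k p q : nat).
Variable C : set 'rV[R]_(k.+1 + (p.+1 + q.+1)).
Hypotheses (cC : compact C) (vC : convex C) (C0 : 0 < lebr C).

Let L := fstproj C.

Definition ray_section (x v : 'rV[R]_k.+1) : set 'rV[R]_(k.+1 + (p.+1 + q.+1)) :=
  [set z | C z /\ exists2 r : R, 0 <= r & lsubmx z = x + r *: v].

(* The equality condition of the theorem, with [K_1] and [K_2] read as [A] and [B]. *)
Definition conical (A : set 'rV[R]_p.+1) (B : set 'rV[R]_q.+1) (x0 : 'rV[R]_k.+1) : Prop :=
  L x0 /\ forall v, exists w, ray_section x0 v = join [set row_mx x0 d | d in prodset A B] w.

Let bA : R := 'C(k.+1 + p.+1, k.+1)%:R.
Let bB : R := 'C(k.+1 + q.+1, k.+1)%:R.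
Let bC : R := 'C(k.+1 + (p.+1 + q.+1), k.+1)%:R.

Lemma equality_conical :
  lebr L * lebr C = bA * bB / bC * lebr (projl C) * lebr (projr C) ->
  exists A B x0, [/\ compact A, convex A, compact B & convex B] /\ conical A B x0.
Proof.
move=> /(coord_equality_profiles cC vC C0) [a [b [a0 b0 profA profB profC]]].
have l0 := lebr_fstproj_gt0 cC C0; have ab0 : 0 < a * b by rewrite mulr_gt0.
have [x0 [Lx0 wx0 apex]] := @exists_apex R k (p + q.+1) C cC vC l0 _ ab0 profC.
have [[[cA vA] cB] vB] := (compact_projl cC, convex_projl vC, compact_projr cC, convex_projr vC).
have FA : lebr (sec (projl C) x0) <= a.
  by apply: (profile_bound cA vA); rewrite ?fstproj_projl.
have FB : lebr (sec (projr C) x0) <= b.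
  by apply: (profile_bound cB vB); rewrite ?fstproj_projr.
have csA := compact_sec (x := x0) cA; have csB := compact_sec (x := x0) cB.
have [vsA vsB] := (convex_sec (x := x0) vA, convex_sec (x := x0) vB).
have E : sec C x0 = prodset (sec (projl C) x0) (sec (projr C) x0).
  have W : lebr (prodset (sec (projl C) x0) (sec (projr C) x0)) <= lebr (sec C x0).
    by rewrite wx0 lebr_prodset//; apply: ler_pM => //; exact: lebr_ge0.
  apply: full_measure_eq W; [exact: compact_sec|exact: compact_prodset|exact: convex_prodset| |].
    exact: sec_prodset.
  apply: lt_le_trans (le_lebr _ _ (@sec_prodset _ _ _ _ C x0)); first by rewrite wx0.
    exact: compact_sec.
  exact: compact_prodset.
exists (sec (projl C) x0), (sec (projr C) x0), x0; split => //; split => // v; rewrite -E.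
apply: cone_along_ray => //; first by rewrite wx0.
by rewrite wx0.
Qed.

Section Converse.
Variables (A : set 'rV[R]_p.+1) (B : set 'rV[R]_q.+1) (x0 : 'rV[R]_k.+1).
Hypotheses (cA : compact A) (cB : compact B) (conC : conical A B x0).
Let D := prodset A B.
Let l0 : 0 < lebr L := lebr_fstproj_gt0 cC C0.

Let other_point : exists2 x, L x & x != x0.
Proof.
apply: contrapT => H; have : lebr L <= lebr [set x0].
  apply: le_lebr; [exact: compact_fstproj|exact: compact_set1|].
  by move=> x Lx; apply: contrapT => xx0; apply: H; exists x => //; apply/eqP.
by rewrite lebr_point leNgt l0.
Qed.

Lemma conical_nonempty : D !=set0.
Proof.
have [x [c Cxc] xx0] := other_point; have [[c0 Cx0] /(_ (x - x0)) [w E]] := conC.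
have : ray_section x0 (x - x0) (row_mx x c).
  by split => //; exists 1; rewrite ?ler01// scale1r row_mxKl subrKC.
have : ray_section x0 (x - x0) (row_mx x0 c0).
  by split => //; exists 0; rewrite // scale0r row_mxKl addr0.
rewrite E => -[<-|[_ [t [[d Dd _] _ _]]]]; last by exists d.
move=> [|[_ [t [[d Dd _] _ _]]]]; last by exists d.
by move=> /eq_row_mx[/eqP]; rewrite (negbTE xx0).
Qed.

Let section_point x : L x -> x != x0 -> exists t w,
  [/\ 0 < t <= 1, x = (1 - t) *: x0 + t *: lsubmx w, L (lsubmx w),
   sec C x = homothet t (rsubmx w) D & sec C x0 = D].
Proof.
move=> [c Cxc] xx0; have [_ /(_ (x - x0)) [w E]] := conC.
have [d0 Dd0] := conical_nonempty.
have xc : ray_section x0 (x - x0) (row_mx x c).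
  by split => //; exists 1; rewrite ?ler01// scale1r row_mxKl subrKC.
have : ray_section x0 (x - x0) w by rewrite E; left.
move=> [Cw [r r0 wr]].
have fiber z : ray_section x0 (x - x0) z ->
    exists d t, [/\ D d, 0 <= t <= 1, z = (1 - t) *: row_mx x0 d + t *: w & lsubmx z = x0 + (t * r) *: (x - x0)].
  have lw t : (1 - t) *: x0 + t *: lsubmx w = x0 + (t * r) *: (x - x0).
    by rewrite wr; apply/rowP => i; rewrite !mxE; ring.
  rewrite E => -[->|[_ [t [[d Dd <-] t01 ->]]]].
    by exists d0, 1; rewrite ler01 lexx subrr scale0r add0r scale1r mul1r.
  exists d, t; split => //; rewrite linearD !linearZ /= row_mxKl; exact: lw.
have [j xj] : exists j, x 0 j != x0 0 j.
  apply: contrapT => H; move/eqP: xx0; apply; apply/rowP => j; apply: contrapT => /eqP xj.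
  by apply: H; exists j.
have xj0 : x 0 j - x0 0 j != 0 by rewrite subr_eq0.
have [d [t [Dd /andP[t0 t1] _]]] := fiber _ xc.
rewrite row_mxKl => xt; have tr : t * r = 1.
  have := congr1 (fun z : 'rV_k.+1 => z 0 j) xt; rewrite !mxE => xtj.
  by apply: (mulIf xj0); move: xtj; lra.
have t_gt0 : 0 < t.
  by rewrite lt_neqAle t0 andbT eq_sym; apply/eqP => t00; move: tr; rewrite t00 mul0r => /eqP; rewrite eq_sym oner_eq0.
exists t, w; split.
- by rewrite t_gt0.
- by rewrite wr; apply/rowP => i; rewrite !mxE; have := congr1 (fun u => u * (x 0 i - x0 0 i)) tr; lra.
- by exists (rsubmx w); rewrite hsubmxK.
- apply/seteqP; split => y.
    move=> Cy; have : ray_section x0 (x - x0) (row_mx x y).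
      by split => //; exists 1; rewrite ?ler01// scale1r row_mxKl subrKC.
    move=> /fiber[d' [t' [Dd' _ yE]]]; rewrite row_mxKl => xt'.
    have t't : t' = t.
      have := congr1 (fun z : 'rV_k.+1 => z 0 j) xt'; rewrite !mxE => xtj.
      have t'r : t' * r = 1 by apply: (mulIf xj0); move: xtj; lra.
      have r_neq0 : r != 0 by apply: contra_eq_neq tr => ->; rewrite mulr0 eq_sym oner_neq0.
      by apply: (mulIf r_neq0); rewrite t'r tr.
    exists d' => //; have := congr1 rsubmx yE; rewrite row_mxKr linearD !linearZ /= row_mxKr t't => ->.
    by rewrite addrC.
  move=> [d' Dd' <-]; rewrite /sec /=.
  have : ray_section x0 (x - x0) ((1 - t) *: row_mx x0 d' + t *: w).
    by rewrite E; right; exists (row_mx x0 d'), t; rewrite t0 t1; split => //; exists d'.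
  move=> [+ _]; congr (C _); rewrite -{1}(hsubmxK w) !scale_row_mx add_row_mx wr.
  congr row_mx; last by rewrite addrC.
  by apply/rowP => i; rewrite !mxE; have := congr1 (fun u => u * (x 0 i - x0 0 i)) tr; lra.
- apply/seteqP; split => y.
    move=> Cy; have : ray_section x0 (x - x0) (row_mx x0 y).
      by split => //; exists 0; rewrite // scale0r row_mxKl addr0.
    move=> /fiber[d' [t' [Dd' _ yE]]]; rewrite row_mxKl => xt'.
    have t'0 : t' = 0.
      have := congr1 (fun z : 'rV_k.+1 => z 0 j) xt'; rewrite !mxE => xtj.
      have t'r : t' * r = 0 by apply: (mulIf xj0); move: xtj; lra.
      have r_neq0 : r != 0 by apply: contra_eq_neq tr => ->; rewrite mulr0 eq_sym oner_neq0.
      by apply: (mulIf r_neq0); rewrite t'r mul0r.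
    by move: yE; rewrite t'0 subr0 scale1r scale0r addr0 => /eq_row_mx[_ ->].
  move=> Dy; have : ray_section x0 (x - x0) (row_mx x0 y).
    by rewrite E; right; exists (row_mx x0 y), 0; rewrite lexx ler01 subr0 scale1r scale0r addr0; split => //; exists y.
  by case.
Qed.

Lemma conical_section x : L x -> exists t c, [/\ 0 <= t <= 1, sec C x = homothet t c D &
  forall s, 0 < s < 1 -> s <= 1 - t -> homothet s x0 L x].
Proof.
move=> Lx; have [xx0|xx0] := eqVneq x x0.
  have [y Ly yx0] := other_point; have [_ [_ [_ _ _ _ E]]] := section_point Ly yx0.
  exists 0, 0; split; rewrite ?lexx ?ler01//.
    rewrite xx0 E homothetE; apply/seteqP; split => [d Dd|_ [d Dd <-]].
      by exists d => //; rewrite subr0 scale1r scale0r addr0.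
    by rewrite subr0 scale1r scale0r addr0.
  move=> s _ _; exists x0; first by rewrite -xx0.
  by rewrite -scalerDl subrKC scale1r.
have [t [w [/andP[t0 t1] xE Lw E _]]] := section_point Lx xx0.
exists t, (rsubmx w); split => //; first by rewrite (ltW t0).
move=> s /andP[s0 s1] st; have s1' : 0 < 1 - s by rewrite subr_gt0.
pose u := t / (1 - s); exists (u *: lsubmx w + (1 - u) *: x0).
  apply: (convex_fstproj vC) => //; last by case: conC.
  by rewrite divr_ge0 ?(ltW t0) ?(ltW s1')//= ler_pdivrMr// mul1r; lra.
rewrite xE; have ut : u * (1 - s) = t by rewrite mulfVK ?gt_eqF.
by apply/rowP => i; rewrite !mxE -ut; ring.
Qed.

Lemma sec_projl_homothet x t c : sec C x = homothet t c D ->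
  sec (projl C) x = homothet t (lsubmx c) A.
Proof.
move=> E; have [d0 [_ Bd0]] := conical_nonempty.
have secE y : C (row_mx x y) <-> homothet t c D y by rewrite -E.
apply/seteqP; split => a.
  move=> /sec_projl[b /secE[d [Ad _] ab]]; exists (lsubmx d) => //.
  by have := congr1 lsubmx ab; rewrite row_mxKl linearD !linearZ.
move=> [a' Aa' <-]; apply/sec_projl; exists (t *: rsubmx c + (1 - t) *: rsubmx d0).
apply/secE; exists (row_mx a' (rsubmx d0)); first exact/prodsetP.
by rewrite -{1}(hsubmxK c) !scale_row_mx add_row_mx.
Qed.

Lemma sec_projr_homothet x t c : sec C x = homothet t c D ->
  sec (projr C) x = homothet t (rsubmx c) B.
Proof.
move=> E; have [d0 [Ad0 _]] := conical_nonempty.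
have secE y : C (row_mx x y) <-> homothet t c D y by rewrite -E.
apply/seteqP; split => b.
  move=> /sec_projr[a /secE[d [_ Bd] ab]]; exists (rsubmx d) => //.
  by have := congr1 rsubmx ab; rewrite row_mxKr linearD !linearZ.
move=> [b' Bb' <-]; apply/sec_projr; exists (t *: lsubmx c + (1 - t) *: lsubmx d0).
apply/secE; exists (row_mx (lsubmx d0) b'); first exact/prodsetP.
by rewrite -{1}(hsubmxK c) !scale_row_mx add_row_mx.
Qed.

Lemma lebr_homothet_le1 n (s : R) (x : 'rV[R]_n.+1) (S : set 'rV[R]_n.+1) : s <= 1 ->
  compact S -> S !=set0 -> lebr (homothet s x S) = (1 - s) ^+ n.+1 * lebr S.
Proof.
rewrite le_eqVlt => /predU1P[->|s1] cS [y Sy]; last exact: lebr_homothet.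
rewrite subrr exprS !mul0r -(lebr_point x); congr lebr.
apply/seteqP; split => [_ [z _ <-]|_ ->]; first by rewrite subrr scale1r scale0r addr0.
by exists y => //; rewrite subrr scale1r scale0r addr0.
Qed.

Let A_nonempty : A !=set0. Proof. by have [d [Ad _]] := conical_nonempty; exists (lsubmx d). Qed.
Let B_nonempty : B !=set0. Proof. by have [d [_ Bd]] := conical_nonempty; exists (rsubmx d). Qed.
Let cD : compact D. Proof. exact: compact_prodset. Qed.

Let conical_lebr_gt0 : 0 < lebr D.
Proof.
rewrite lt_neqAle lebr_ge0 andbT eq_sym; apply/eqP => D0.
suff : (lebr C)%:E = 0%E by move=> -[C00]; move: C0; rewrite C00 ltxx.
rewrite lebr_row_mx//; apply: integral0_eq => x _; congr (_%:E).
have [Lx|/sec0 ->] := pselect (L x); last by rewrite /lebr measure0.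
have [t [c [/andP[_ t1] -> _]]] := conical_section Lx.
by rewrite (@lebr_homothet_le1 (p + q.+1))//; [rewrite D0 mulr0|exact: conical_nonempty].
Qed.

Lemma conical_equality :
  lebr L * lebr C = bA * bB / bC * lebr (projl C) * lebr (projr C).
Proof.
have AB0 : 0 < lebr A * lebr B by rewrite -lebr_prodset.
have A0 : 0 < lebr A by move: AB0; rewrite lt_neqAle eq_sym mulf_eq0 negb_or lt_neqAle lebr_ge0 andbT eq_sym => /andP[/andP[]].
have B0 : 0 < lebr B by rewrite -(pmulr_rgt0 _ A0).
have [Lx0 _] := conC.
have [[[cA' vA'] cB'] vB'] := (compact_projl cC, convex_projl vC, compact_projr cC, convex_projr vC).
have [y Ly yx0] := other_point; have [_ [_ [_ _ _ _ Ex0]]] := section_point Ly yx0.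
have Ex0' : sec C x0 = homothet 0 0 D.
  rewrite Ex0 homothetE; apply/seteqP; split => [d Dd|_ [d Dd <-]].
    by exists d => //; rewrite subr0 scale1r scale0r addr0.
  by rewrite subr0 scale1r scale0r addr0.
have VC : lebr C = lebr D * (lebr L / bC).
  apply: (cone_volume cC vC l0 conical_lebr_gt0 Lx0); first by rewrite Ex0.
  move=> x Lx; have [t [c [/andP[t0 t1] E H]]] := conical_section Lx.
  exists t; split; [by rewrite t0| |exact: H].
  by rewrite E (@lebr_homothet_le1 (p + q.+1))//; exact: conical_nonempty.
have VA : lebr (projl C) = lebr A * (lebr L / bA).
  rewrite /L -(fstproj_projl C); apply: (cone_volume (x0 := x0)); rewrite ?fstproj_projl//.
    by rewrite (sec_projl_homothet Ex0') lebr_homothet_le1 ?ler01// subr0 expr1n mul1r.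
  move=> x Lx; have [t [c [/andP[t0 t1] E H]]] := conical_section Lx.
  exists t; split; [by rewrite t0| |exact: H].
  by rewrite (sec_projl_homothet E) lebr_homothet_le1.
have VB : lebr (projr C) = lebr B * (lebr L / bB).
  rewrite /L -(fstproj_projr C); apply: (cone_volume (x0 := x0)); rewrite ?fstproj_projr//.
    by rewrite (sec_projr_homothet Ex0') lebr_homothet_le1 ?ler01// subr0 expr1n mul1r.
  move=> x Lx; have [t [c [/andP[t0 t1] E H]]] := conical_section Lx.
  exists t; split; [by rewrite t0| |exact: H].
  by rewrite (sec_projr_homothet E) lebr_homothet_le1.
rewrite VC VA VB lebr_prodset//; field.
by rewrite !pnatr_eq0 -!lt0n !bin_gt0 !leq_addr.
Qed.

End Converse.
End Equality.

(** * Orthonormal frames and transfer *)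

Section Frames.
Variables (R : realType) (n : nat).
Implicit Types (F : {vspace 'rV[R]_n}).

Lemma dotmulE (u v : 'rV[R]_n) : dotmul u v = (u *m v^T) 0 0.
Proof. by rewrite mxE; apply: eq_bigr => i _; rewrite mxE. Qed.

Definition frame d F (M : 'M[R]_(d, n)) : Prop :=
  M *m M^T = 1%:M /\ forall x, x \in F <-> exists c, x = c *m M.

Lemma pair_ortho_nth (s : seq 'rV[R]_n) (i j : nat) : pair_ortho_rec (@dotmul R n) s ->
  (i < j < size s)%N -> dotmul s`_i s`_j = 0.
Proof.
elim: s i j => [i j|x s IH [|i] [|j]] //=; first by rewrite ltn0 andbF.
  by move=> /andP[/andP[/allP xs _] _] js; apply/eqP/xs; rewrite mem_nth.
by move=> /andP[_ os]; rewrite ltnS => ij; exact: IH.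
Qed.

Definition onbmx F : 'M[R]_(\dim F, n) := \matrix_i (onb F)`_i.

Lemma sum_onb F (x : 'rV[R]_(\dim F)) :
  \sum_(i < \dim F) x 0 i *: (onb F)`_i = x *m onbmx F.
Proof. by rewrite mulmx_sum_row; apply: eq_bigr => i _; rewrite rowK. Qed.

Lemma frame_onbmx F : frame F (onbmx F).
Proof.
have [/andP[/allP /= s1 s2] sF] := onbP F; split.
  apply/matrixP => i j; rewrite !mxE.
  rewrite (_ : \sum_k _ = dotmul (onb F)`_i (onb F)`_j); last first.
    by apply: eq_bigr => l _; rewrite !mxE.
  have [ij|ji|/val_inj ->] := ltngtP i j.
  - by rewrite pair_ortho_nth ?size_tuple ?ij ?ltn_ord// -val_eqE /= (ltn_eqF ij).
  - by rewrite dotmulC pair_ortho_nth ?size_tuple ?ji ?ltn_ord// eq_sym -val_eqE /= (ltn_eqF ji).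
  - by rewrite eqxx; apply/eqP; apply: s1; rewrite mem_nth ?size_tuple.
move=> x; split => [xF|[c ->]].
  exists (\row_i coord (onb F) i x); rewrite -sum_onb {1}(coord_basis sF xF).
  by apply: eq_bigr => i _; rewrite mxE.
rewrite -sum_onb; apply: memv_suml => i _; rewrite memvZ// (basis_mem sF)//.
by rewrite mem_nth ?size_tuple.
Qed.

Lemma frame_exists d F : \dim F = d -> exists M : 'M[R]_(d, n), frame F M.
Proof. by move=> <-; exists (onbmx F); exact: frame_onbmx. Qed.

Section Frame.
Variables (d : nat) (F : {vspace 'rV[R]_n}) (M : 'M[R]_(d, n)).
Hypothesis frM : frame F M.

Lemma frame_mem c : c *m M \in F.
Proof. by apply/(frM.2); exists c. Qed.

Lemma frame_row i : row i M \in F.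
Proof. by rewrite rowE; exact: frame_mem. Qed.

Lemma mulmx_frameK m (c : 'M[R]_(m, d)) : c *m M *m M^T = c.
Proof. by rewrite -mulmxA frM.1 mulmx1. Qed.

Lemma frameK x : x \in F -> x *m M^T *m M = x.
Proof. by move=> /(frM.2)[c ->]; rewrite mulmx_frameK. Qed.

Lemma frame_orthcP y : y \in orthc F <-> y *m M^T = 0.
Proof.
split=> [/mem_orthovP oy|yM].
  apply/rowP => i; rewrite [RHS]mxE -[RHS](oy _ (frame_row i)) [RHS]dotmulE !mxE.
  by apply: eq_bigr => j _; rewrite !mxE.
apply/mem_orthovP => _ /(frM.2)[c ->].
by rewrite [LHS]dotmulE trmx_mul mulmxA yM mul0mx mxE.
Qed.

Lemma orthproj_frame x : orthproj F x = x *m M^T *m M.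
Proof.
have [xF xF'] := orthprojP F x; apply/eqP; rewrite -subr_eq0 -memv0 -(orthc_disjoint F).
rewrite memv_cap memvB ?frame_mem//=; apply/frame_orthcP.
rewrite mulmxBl mulmx_frameK; apply/eqP; rewrite subr_eq0; apply/eqP/esym.
by apply/eqP; rewrite -subr_eq0 -mulmxBl; apply/eqP/frame_orthcP.
Qed.

Lemma vol_frame A : \dim F = d -> compact A -> vol F A = lebesgue_rV [set x | A (x *m M)].
Proof.
move=> dF cA; have frO := frame_onbmx F; rewrite /vol.
under eq_set do rewrite sum_onb.
have MO : M = M *m (onbmx F)^T *m onbmx F.
  apply/row_matrixP => i; rewrite !row_mul.
  have /frO.2[c ->] := frame_row i; rewrite -(mulmxA c) frO.1 mulmx1//.
pose B := [set y | A (y *m onbmx F)].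
have mB : measurable B.
  apply: closed_measurable_row; apply: closed_comp (compact_closed_row cA) => x _.
  exact: mulmxr_row_continuous.
have <- : [set x | B (x *m (M *m (onbmx F)^T))] = [set x | A (x *m M)].
  by apply/funext => x; rewrite /B /= -mulmxA -MO.
rewrite -!lebE leb_isometry// trmx_mul trmxK mulmxA -MO; exact: frM.1.
Qed.

Lemma vol_proj K : \dim F = d -> compact K ->
  vol F (orthproj F @` K) = lebesgue_rV ((fun x => x *m M^T) @` K).
Proof.
move=> dF cK; rewrite vol_frame//.
  congr lebesgue_rV; apply/seteqP; split => [u [y Ky]|_ [y Ky <-]] /=.
    by rewrite orthproj_frame => yu; exists y => //; rewrite -[RHS](mulmx_frameK u) -yu mulmx_frameK.
  by exists y => //; exact: orthproj_frame.
rewrite (_ : orthproj F @` K = (fun x => x *m (M^T *m M)) @` K).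
  by apply: continuous_compact => //; apply: continuous_subspaceT; exact: mulmxr_row_continuous.
by apply: eq_imagel => x _; rewrite orthproj_frame mulmxA.
Qed.

End Frame.

Lemma sub_orthc (E H : {vspace 'rV[R]_n}) : (orthc E <= H)%VS -> (orthc H <= E)%VS.
Proof.
move=> /subvP EH; apply/subvP => x /mem_orthovP xH.
have [xE rE] := orthprojP E x.
suff : x - orthproj E x == 0 by rewrite subr_eq0 => /eqP ->.
rewrite -memv0 -(orthc_disjoint (orthc E)) memv_cap rE /=.
apply/mem_orthovP => y yE.
have yx : dotmul (orthproj E x) y = 0 by rewrite dotmulC; move/mem_orthovP: yE; apply.
by rewrite linearBl /= yx subr0; exact: xH (EH _ yE).
Qed.

Lemma orthcS (E H : {vspace 'rV[R]_n}) : (E <= H)%VS -> (orthc H <= orthc E)%VS.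
Proof.
by move=> /subvP EH; apply/subvP => x /mem_orthovP xH; apply/mem_orthovP => y /EH; exact: xH.
Qed.

Lemma dim_orthc F : (\dim F + \dim (orthc F))%N = n.
Proof.
have := dimv_sum_cap F (orthc F).
by rewrite addv_orthc orthc_disjoint dimv0 addn0 dimvf /dim /= mul1n.
Qed.

End Frames.

Section ConvexHull.
Variables (R : realType) (n : nat).
Implicit Types (S : set 'rV[R]_n) (w : 'rV[R]_n).

Lemma convex_join S w : convex S -> convex (join S w).
Proof.
move=> vS l x y /andP[l0 l1] Sx Sy.
have rep s0 z : S s0 -> join S w z ->
    exists s t, [/\ S s, 0 <= t <= 1 & z = (1 - t) *: s + t *: w].
  move=> Ss0 [->|//]; exists s0, 1.
  by rewrite ler01 lexx subrr scale0r add0r scale1r.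
have [[s0 Ss0]|S0] := pselect (S !=set0); last first.
  have w_only z : join S w z -> z = w by case=> // -[s [t [Ss _ _]]]; case: S0; exists s.
  by left; rewrite (w_only _ Sx) (w_only _ Sy) -scalerDl subrKC scale1r.
have [s [t [Ss /andP[t0 t1] ->]]] := rep _ _ Ss0 Sx.
have [s' [t' [Ss' /andP[t'0 t'1] ->]]] := rep _ _ Ss0 Sy.
pose a := l * (1 - t); pose b := (1 - l) * (1 - t').
have a0 : 0 <= a by rewrite mulr_ge0 ?subr_ge0.
have b0 : 0 <= b by rewrite mulr_ge0 ?subr_ge0.
have ab : 1 - (l * t + (1 - l) * t') = a + b by rewrite /a /b; ring.
have [ab0|ab_neq0] := eqVneq (a + b) 0.
  have [a00 b00] : a = 0 /\ b = 0 by split; lra.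
  left; apply/rowP => i; rewrite !mxE.
  have -> : l * ((1 - t) * s 0 i + t * w 0 i) + (1 - l) * ((1 - t') * s' 0 i + t' * w 0 i)
      = a * s 0 i + b * s' 0 i + (1 - (a + b)) * w 0 i by rewrite /a /b; ring.
  by rewrite ab0 a00 b00 !mul0r !add0r subr0 mul1r.
have ab_gt0 : 0 < a + b by rewrite lt_neqAle eq_sym ab_neq0 addr_ge0.
right; exists ((a / (a + b)) *: s + (1 - a / (a + b)) *: s'), (l * t + (1 - l) * t'); split.
- by apply: vS => //; rewrite divr_ge0 ?(ltW ab_gt0)//= ler_pdivrMr// mul1r lerDl.
- by apply/andP; split; [rewrite addr_ge0// mulr_ge0// subr_ge0|move: ab; lra].
- have abK : (a + b) * (a / (a + b)) = a by rewrite mulrCA divff ?mulr1.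
  apply/rowP => i; rewrite ab !mxE; move: (a / (a + b)) abK => c abK.
  have -> : (a + b) * (c * s 0 i + (1 - c) * s' 0 i) =
      (a + b) * c * s 0 i + (a + b - (a + b) * c) * s' 0 i by ring.
  by rewrite abK /a /b; ring.
Qed.

Lemma conv_hull_join S w : convex S -> conv_hull (S `|` [set w]) = join S w.
Proof.
move=> vS; apply/seteqP; split.
  apply: smallest_sub; first by apply/convex_setE; exact: convex_join.
  move=> z [Sz|->]; last by left.
  by right; exists z, 0; rewrite lexx ler01 subr0 scale1r scale0r addr0.
move=> z zj B [/convex_setE vB SB]; case: zj => [->|[s [t [Ss /andP[t0 t1] ->]]]].
  by apply: SB; right.
by rewrite addrC; apply: vB; [rewrite t0|apply: SB; right|apply: SB; left].
Qed.

End ConvexHull.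

Section FrameSum.
Variables (R : realType) (n : nat).
Implicit Types (F : {vspace 'rV[R]_n}).

Lemma frame_orth d e (F1 F2 : {vspace 'rV[R]_n}) (M1 : 'M[R]_(d, n)) (M2 : 'M[R]_(e, n)) :
  frame F1 M1 -> frame F2 M2 -> (F2 <= orthc F1)%VS -> M2 *m M1^T = 0.
Proof.
move=> fr1 fr2 /subvP F21; apply/row_matrixP => i; rewrite row_mul row0.
by apply/(frame_orthcP fr1)/F21; exact: (frame_row fr2).
Qed.

Lemma frame_add d e (F1 F2 : {vspace 'rV[R]_n}) (M1 : 'M[R]_(d, n)) (M2 : 'M[R]_(e, n)) :
  frame F1 M1 -> frame F2 M2 -> (F2 <= orthc F1)%VS -> frame (F1 + F2)%VS (col_mx M1 M2).
Proof.
move=> fr1 fr2 F21; have M21 := frame_orth fr1 fr2 F21.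
have M12 : M1 *m M2^T = 0 by rewrite -[LHS]trmxK trmx_mul trmxK M21 trmx0.
split.
  rewrite tr_col_mx mul_col_mx !mul_mx_row fr1.1 fr2.1 M21 M12 -/(block_mx _ _ _ _).
  by rewrite -scalar_mx_block.
move=> x; split=> [/memv_addP[x1 /fr1.2[c1 ->] [x2 /fr2.2[c2 ->] ->]]|[c ->]].
  by exists (row_mx c1 c2); rewrite mul_row_col.
rewrite -(hsubmxK c) mul_row_col; apply: memv_add; exact: frame_mem.
Qed.

Lemma dim_addv_orth (F1 F2 : {vspace 'rV[R]_n}) : (F2 <= orthc F1)%VS ->
  \dim (F1 + F2) = (\dim F1 + \dim F2)%N.
Proof.
move=> F21; rewrite dimv_disjoint_sum//; apply/eqP; rewrite -subv0 -(orthc_disjoint F1).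
exact: capvS.
Qed.

Lemma eq_subv_dim F1 F2 : (F1 <= F2)%VS -> \dim F1 = \dim F2 -> F1 = F2.
Proof. by move=> F12 dF; apply/eqP; rewrite eqEdim F12 dF leqnn. Qed.

Lemma convex_mulmx m (S : set 'rV[R]_m) (M : 'M[R]_(m, n)) : convex S -> convex ((fun x => x *m M) @` S).
Proof.
move=> vS s _ _ s01 [x Sx <-] [y Sy <-]; exists (s *: x + (1 - s) *: y); first exact: vS.
by rewrite mulmxDl -!scalemxAl.
Qed.

Lemma compact_mulmx m (S : set 'rV[R]_m) (M : 'M[R]_(m, n)) : compact S -> compact ((fun x => x *m M) @` S).
Proof.
by move=> cS; apply: continuous_compact => //; apply: continuous_subspaceT; exact: mulmxr_row_continuous.
Qed.

Lemma convex_body_lebr_gt0 (K : set 'rV[R]_n) : convex_body K -> 0 < lebr K.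
Proof.
move=> [cK _ [x]]; rewrite /interior /= => /nbhs_ballP[e /= e0 eK].
pose r := e / 2; have r0 : 0 < r by rewrite divr_gt0.
pose a := x - const_mx r; pose b := x + const_mx r.
have ab i : a 0 i <= b 0 i by rewrite !mxE; lra.
have cubeK : [set y : 'rV[R]_n | forall i, a 0 i <= y 0 i <= b 0 i] `<=` K.
  move=> y H; apply: eK; rewrite -ball_normE /=.
  apply: row_norm_lt => // i; have := H i; rewrite !mxE => /andP[y1 y2].
  by rewrite ltr_norml; apply/andP; split; rewrite /r in y1 y2; lra.
rewrite -lte_fin lebrE//; apply: (@lt_le_trans _ _ (leb [set y : 'rV[R]_n | forall i, a 0 i <= y 0 i <= b 0 i])).
  by rewrite leb_cube// lte_fin prodr_gt0// => i _; rewrite !mxE; lra.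
by apply: le_measure; rewrite ?inE//; [exact: measurable_box|exact: compact_measurable_row].
Qed.

End FrameSum.

Section Transfer.
Variables (R : realType) (n k p q : nat) (K : set 'rV[R]_n) (E H : {vspace 'rV[R]_n}).
Hypotheses (cK : compact K) (nE : (k.+1 + (p.+1 + q.+1))%N = n).
Hypotheses (dimE : \dim E = (k.+1 + p.+1)%N) (dimH : \dim H = (k.+1 + q.+1)%N).
Hypothesis EH : (orthc E <= H)%VS.
Let G := (E :&: H)%VS.

Let HE : (orthc H <= E)%VS. Proof. exact: sub_orthc. Qed.

Let dimG : \dim G = k.+1.
Proof. by rewrite dimv_cap_orthc// dimE dimH; move: nE; lia. Qed.

Let dimP : \dim (orthc H) = p.+1.
Proof. by have := dim_orthc H; rewrite dimH; move: nE; lia. Qed.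

Let dimQ : \dim (orthc E) = q.+1.
Proof. by have := dim_orthc E; rewrite dimE; move: nE; lia. Qed.

Let PG : (orthc H <= orthc G)%VS. Proof. exact/orthcS/capvSr. Qed.
Let QG : (orthc E <= orthc G)%VS. Proof. exact/orthcS/capvSl. Qed.
Let QP : (orthc E <= orthc (orthc H))%VS. Proof. exact: orthcS. Qed.
Let PQG : (orthc H + orthc E <= orthc G)%VS. Proof. by rewrite subv_add PG QG. Qed.

Variables (MG : 'M[R]_(k.+1, n)) (MP : 'M[R]_(p.+1, n)) (MQ : 'M[R]_(q.+1, n)).
Hypotheses (frG : frame G MG) (frP : frame (orthc H) MP) (frQ : frame (orthc E) MQ).

Let M := col_mx MG (col_mx MP MQ).
Definition coord_body : set 'rV[R]_(k.+1 + (p.+1 + q.+1)) := [set w | K (w *m M)].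
Let C := coord_body.

Let frM : frame fullv M.
Proof.
have := frame_add frG (frame_add frP frQ QP) PQG; congr (frame _ _).
apply: eq_subv_dim; first exact: subvf.
by rewrite !dim_addv_orth// dimG dimP dimQ dimvf /dim /= mul1n.
Qed.

Let frE : frame E (col_mx MG MP).
Proof.
have := frame_add frG frP PG; congr (frame _ _).
apply: eq_subv_dim; first by rewrite subv_add capvSl.
by rewrite dim_addv_orth// dimG dimP dimE.
Qed.

Let frH : frame H (col_mx MG MQ).
Proof.
have := frame_add frG frQ QG; congr (frame _ _).
apply: eq_subv_dim; first by rewrite subv_add capvSr.
by rewrite dim_addv_orth// dimG dimQ dimH.
Qed.

Let MK (y : 'rV[R]_n) : y *m M^T *m M = y. Proof. by apply: (frameK frM); exact: memvf. Qed.
Let KM (w : 'rV[R]_(k.+1 + (p.+1 + q.+1))) : w *m M *m M^T = w. Proof. exact: (mulmx_frameK frM). Qed.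
Let trM (y : 'rV[R]_n) : y *m M^T = row_mx (y *m MG^T) (row_mx (y *m MP^T) (y *m MQ^T)).
Proof. by rewrite !tr_col_mx !mul_mx_row. Qed.
Let lsubM (y : 'rV[R]_n) : lsubmx (y *m M^T) = y *m MG^T. Proof. by rewrite trM row_mxKl. Qed.
Let mulM (a : 'rV[R]_k.+1) (b : 'rV[R]_p.+1) (c : 'rV[R]_q.+1) : row_mx a (row_mx b c) *m M = a *m MG + (b *m MP + c *m MQ).
Proof. by rewrite !mul_row_col. Qed.

Let CK : C = (fun y => y *m M^T) @` K.
Proof.
apply/seteqP; split => [w Kw|_ [y Ky <-]]; first by exists (w *m M); rewrite ?KM.
by rewrite /C /coord_body /= MK.
Qed.

Lemma compact_coord_body : compact C. Proof. by rewrite CK; exact: compact_mulmx. Qed.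

Lemma convex_coord_body : convex K -> convex C.
Proof. by rewrite CK; exact: convex_mulmx. Qed.

Lemma lebr_coord_body : lebr C = lebr K.
Proof.
by rewrite /lebr (leb_isometry nE frM.1)//; exact: compact_measurable_row.
Qed.

Lemma fstproj_coord_body : (fun y => y *m MG^T) @` K = fstproj C.
Proof.
apply/seteqP; split => [_ [y Ky <-]|a [b Kab]].
  by exists (row_mx (y *m MP^T) (y *m MQ^T)); rewrite /C /coord_body /= -trM MK.
by exists (row_mx a b *m M); rewrite // -lsubM KM row_mxKl.
Qed.

Lemma projl_coord_body : (fun y => y *m (col_mx MG MP)^T) @` K = projl C.
Proof.
apply/seteqP; split => [_ [y Ky <-]|u [b Kab]].
  exists (y *m MQ^T); rewrite /C /coord_body /= tr_col_mx mul_mx_row row_mxKl row_mxKr.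
  by rewrite -trM MK.
exists (row_mx (lsubmx u) (row_mx (rsubmx u) b) *m M) => //.
have := KM (row_mx (lsubmx u) (row_mx (rsubmx u) b)); rewrite trM.
by move=> /eq_row_mx[E1 /eq_row_mx[E2 _]]; rewrite tr_col_mx mul_mx_row E1 E2 hsubmxK.
Qed.

Lemma projr_coord_body : (fun y => y *m (col_mx MG MQ)^T) @` K = projr C.
Proof.
apply/seteqP; split => [_ [y Ky <-]|u [a Kab]].
  exists (y *m MP^T); rewrite /C /coord_body /= tr_col_mx mul_mx_row row_mxKl row_mxKr.
  by rewrite -trM MK.
exists (row_mx (lsubmx u) (row_mx a (rsubmx u)) *m M) => //.
have := KM (row_mx (lsubmx u) (row_mx a (rsubmx u))); rewrite trM.
by move=> /eq_row_mx[E1 /eq_row_mx[_ E2]]; rewrite tr_col_mx mul_mx_row E1 E2 hsubmxK.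
Qed.

Lemma vol_coord_body :
  [/\ lebesgue_rV K = (lebr C)%:E,
      vol G (orthproj G @` K) = (lebr (fstproj C))%:E,
      vol E (orthproj E @` K) = (lebr (projl C))%:E &
      vol H (orthproj H @` K) = (lebr (projr C))%:E].
Proof.
have cC := compact_coord_body; split.
- by rewrite lebr_coord_body lebrE.
- by rewrite (vol_proj frG)// fstproj_coord_body lebrE//; exact: compact_fstproj.
- by rewrite (vol_proj frE)// projl_coord_body lebrE//; exact: compact_projl.
- by rewrite (vol_proj frH)// projr_coord_body lebrE//; exact: compact_projr.
Qed.

Let slice (A : set 'rV[R]_p.+1) (B : set 'rV[R]_q.+1) (x0 : 'rV[R]_k.+1) :=
  [set row_mx x0 d | d in prodset A B].

Let embed (A : set 'rV[R]_p.+1) (B : set 'rV[R]_q.+1) (x0 : 'rV[R]_k.+1) : set 'rV[R]_n :=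
  minkowski_sum [set x0 *m MG]
    (minkowski_sum ((fun a => a *m MP) @` A) ((fun b => b *m MQ) @` B)).

Let embedE A B x0 y : embed A B x0 y <-> slice A B x0 (y *m M^T).
Proof.
split=> [[_ -> [_ [_ [a Aa <-] [_ [b Bb <-] <-]] <-]]|[d [Ad Bd] dy]].
  by rewrite -mulM KM; exists (row_mx a b) => //; exact/prodsetP.
exists (x0 *m MG) => //; exists (lsubmx d *m MP + rsubmx d *m MQ).
  by exists (lsubmx d *m MP); [exists (lsubmx d)|exists (rsubmx d *m MQ) => //; exists (rsubmx d)].
by rewrite -mulM hsubmxK dy MK.
Qed.

Let convex_embed A B x0 : convex A -> convex B -> convex (embed A B x0).
Proof.
move=> vA vB s x y s01 /embedE[d Dd dx] /embedE[d' Dd' dy]; apply/embedE.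
exists (s *: d + (1 - s) *: d'); first exact: convex_prodset.
rewrite mulmxDl -!scalemxAl -dx -dy !scale_row_mx add_row_mx -scalerDl subrKC.
by rewrite scale1r.
Qed.

Let join_embed A B x0 w y : join (embed A B x0) (w *m M) y <-> join (slice A B x0) w (y *m M^T).
Proof.
split=> [[->|[s [t [/embedE Ss t01 ->]]]]|[yw|[s [t [Ss t01 yst]]]]].
- by left; rewrite KM.
- by right; exists (s *m M^T), t; split => //; rewrite mulmxDl -!scalemxAl KM.
- by left; rewrite -yw MK.
- right; exists (s *m M), t; split => //; first by apply/embedE; rewrite KM.
  by rewrite -(MK y) yst mulmxDl -!scalemxAl.
Qed.

Let ray_embed x0 v y :
  (K `&` minkowski_sum (minkowski_sum [set x0 *m MG] [set` orthc G]) (ray (v *m MG))) y <->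
  ray_section C x0 v (y *m M^T).
Proof.
rewrite /ray_section /C /coord_body /= MK lsubM; split.
  move=> [Ky [_ [_ -> [e /= eG <-]] [_ [s /= s0 <-] yE]]]; split; [exact: Ky|exists s => //].
  rewrite -yE.
  by rewrite !mulmxDl -scalemxAl !(mulmx_frameK frG) (frame_orthcP frG e).1// addr0.
move=> [Ky [r r0 yr]]; split => //.
exists (y - r *: (v *m MG)); last by exists (r *: (v *m MG)); [exists r|rewrite subrK].
exists (x0 *m MG) => //; exists (y - (x0 + r *: v) *m MG).
  by apply/(frame_orthcP frG); rewrite mulmxBl (mulmx_frameK frG) yr subrr.
by rewrite mulmxDl -scalemxAl opprD addrA addrCA addrA subrr add0r || by rewrite mulmxDl -scalemxAl; apply/rowP => i; rewrite !mxE; ring.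
Qed.

Let equality_cond (K1 K2 : set 'rV[R]_n) (x0 : 'rV[R]_n) :=
  [/\ [/\ compact K1, convex_set K1 & K1 `<=` [set` orthc H]],
      [/\ compact K2, convex_set K2 & K2 `<=` [set` orthc E]],
      (orthproj G @` K) x0 &
      forall v : 'rV[R]_n, v \in G ->
        exists p : 'rV[R]_n,
          K `&` minkowski_sum (minkowski_sum [set x0] [set` orthc G]) (ray v)
          = conv_hull (minkowski_sum [set x0] (minkowski_sum K1 K2) `|` [set p])].

Lemma conical_coord_body :
  (exists A B x0, [/\ compact A, convex A, compact B & convex B] /\ conical C A B x0) <->
  exists K1 K2 x0, equality_cond K1 K2 x0.
Proof.
split=> [[A [B [x0 [[cA vA cB vB] [Lx0 con]]]]]|].
  exists ((fun a => a *m MP) @` A), ((fun b => b *m MQ) @` B), (x0 *m MG); split.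
  - split; [exact: compact_mulmx|by apply/convex_setE; exact: convex_mulmx|].
    by move=> _ [a _ <-]; exact: (frame_mem frP).
  - split; [exact: compact_mulmx|by apply/convex_setE; exact: convex_mulmx|].
    by move=> _ [b _ <-]; exact: (frame_mem frQ).
  - move: Lx0; rewrite -fstproj_coord_body => -[y Ky <-].
    by exists y => //; rewrite (orthproj_frame frG).
  move=> _ /frG.2[v ->]; have [w wE] := con v; exists (w *m M).
  rewrite conv_hull_join; last exact: convex_embed.
  by apply/seteqP; split => y; [move/ray_embed; rewrite wE => /join_embed|
     move/join_embed; rewrite -[join _ _]wE => /ray_embed].
move=> [K1 [K2 [x0 [[cK1 /convex_setE vK1 K1H] [cK2 /convex_setE vK2 K2E] [y0 Ky0 y0x0] con]]]].
pose A := (fun x => x *m MP^T) @` K1; pose B := (fun x => x *m MQ^T) @` K2.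
have K1E : K1 = (fun a => a *m MP) @` A.
  apply/seteqP; split => [x K1x|_ [_ [x K1x <-] <-]]; last by rewrite (frameK frP)//; exact: K1H.
  by exists (x *m MP^T); [exists x|rewrite (frameK frP)//; exact: K1H].
have K2E' : K2 = (fun b => b *m MQ) @` B.
  apply/seteqP; split => [x K2x|_ [_ [x K2x <-] <-]]; last by rewrite (frameK frQ)//; exact: K2E.
  by exists (x *m MQ^T); [exists x|rewrite (frameK frQ)//; exact: K2E].
have [vA vB] : convex A /\ convex B by split; exact: convex_mulmx.
have x0E : x0 = x0 *m MG^T *m MG.
  by rewrite (frameK frG)// -y0x0; exact: (orthprojP _ _).1.
exists A, B, (x0 *m MG^T); split; first by split => //; exact: compact_mulmx.
split.
  rewrite -fstproj_coord_body; exists y0 => //.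
  by rewrite -y0x0 (orthproj_frame frG) (mulmx_frameK frG).
move=> v; have [w wE] := con _ (frame_mem frG v); exists (w *m M^T).
move: wE; rewrite K1E K2E' {1 2}x0E conv_hull_join; last exact: convex_embed.
rewrite -{1}(MK w) => wE.
apply/seteqP; split => z.
  by rewrite -(KM z) => /ray_embed; rewrite wE => /join_embed.
by rewrite -(KM z) => /join_embed; rewrite -[join _ _]wE => /ray_embed.
Qed.

End Transfer.

Theorem theorem1p7 (R : realType) (n i j k : nat) (K : set 'rV[R]_n)
    (E H : {vspace 'rV[R]_n}) (convK : convex_body K)
    (dimE : \dim E = i) (dimH : \dim H = j)
    (i_range : (2 <= i <= n.-1)%N) (j_range : (2 <= j <= n.-1)%N)
    (ij_ge : (n.+1 <= i + j)%N) (orthE_sub_H : (orthc E <= H)%VS)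
    (kE : k = (i + j - n)%N) :
  let G := (E :&: H)%VS in
  let lhs := (vol G (orthproj G @` K) * lebesgue_rV K)%E in
  let rhs := ((('C(i, k)%:R * 'C(j, k)%:R / 'C(n, k)%:R : R)%:E
    * vol E (orthproj E @` K)) * vol H (orthproj H @` K))%E in
  (lhs <= rhs)%E /\
  (lhs = rhs <->
   exists (K1 K2 : set 'rV[R]_n) (x0 : 'rV[R]_n),
     [/\ [/\ compact K1, convex_set K1 & K1 `<=` [set` orthc H]],
         [/\ compact K2, convex_set K2 & K2 `<=` [set` orthc E]],
         (orthproj G @` K) x0 &
         forall v : 'rV[R]_n, v \in G ->
           exists p : 'rV[R]_n,
             K `&` minkowski_sum (minkowski_sum [set x0] [set` orthc G]) (ray v)
             = conv_hull (minkowski_sum [set x0] (minkowski_sum K1 K2) `|` [set p])]).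
Proof.
have [cK /convex_setE vK _] := convK.
have [k' kS] : exists k', k = k'.+1 by exists k.-1; lia.
have [p pS] : exists p, (n - j)%N = p.+1 by exists (n - j).-1; lia.
have [q qS] : exists q, (n - i)%N = q.+1 by exists (n - i).-1; lia.
have iE : i = (k'.+1 + p.+1)%N by lia.
have jE : j = (k'.+1 + q.+1)%N by lia.
have nE : (k'.+1 + (p.+1 + q.+1))%N = n by lia.
rewrite iE in dimE; rewrite jE in dimH.
move=> G.
have dimG : \dim G = k'.+1 by rewrite dimv_cap_orthc// dimE dimH; move: nE; lia.
have dimP : \dim (orthc H) = p.+1 by have := dim_orthc H; rewrite dimH; move: nE; lia.
have dimQ : \dim (orthc E) = q.+1 by have := dim_orthc E; rewrite dimE; move: nE; lia.
have [MG frG] := frame_exists dimG.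
have [MP frP] := frame_exists dimP.
have [MQ frQ] := frame_exists dimQ.
have [-> -> -> ->] := vol_coord_body cK nE dimE dimH orthE_sub_H frG frP frQ.
have := compact_coord_body cK nE dimE dimH orthE_sub_H frG frP frQ.
have := convex_coord_body nE dimE dimH orthE_sub_H frG frP frQ vK.
have := lebr_coord_body cK nE dimE dimH orthE_sub_H frG frP frQ.
have := conical_coord_body K nE dimE dimH orthE_sub_H frG frP frQ.
set C := coord_body _ _ _ _ => conC CK vC cC.
have C0 : 0 < lebr C by rewrite CK; exact: convex_body_lebr_gt0.
have nB : 'C(n, k) = 'C(k'.+1 + (p.+1 + q.+1), k'.+1) by rewrite nE kS.
rewrite /= nB iE jE kS -!EFinM lee_fin; split.
  exact: coord_inequality.
rewrite -conC; split=> [[]|[A [B [x0 [[cA _ cB _] con]]]]].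
  exact: equality_conical.
by congr (_%:E); exact: conical_equality con.
Qed.
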